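(* Every strongly regular $(d-1)$-dimensional normal pseudomanifold that has exactly $d+2$ facets is combinatorially equivalent to the boundary complex of a $d$-dimensional convex polytope.
   Context: All CW complexes are finite. A CW complex is regular if every attaching map is a homeomorphism; its closed cells are called faces ($k$-faces in dimension $k$; top-dimensional faces are facets). A regular CW complex is strongly regular if the intersection of any two faces is a face (possibly empty). A CW complex is pure if all its facets (maximal faces) have the same dimension. A $(d-1)$-dimensional pseudomanifold is a pure regular CW complex $X$ of dimension $d-1$ such that every $(d-2)$-face is contained in exactly two $(d-1)$-faces; it is normal if $X$ is connected and $H_{d-1}(X)$ and $H_{d-1}(X,X\setminus\{x\})$ are $1$-dimensional for all $x\in X$, where homology is (relative) singular homology with coefficients in $\mathbb{Z}/2\mathbb{Z}$. Two complexes are combinatorially equivalent if their face posets (faces ordered by inclusion) are isomorphic. *)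

(* Defs.v *)
From HB Require Import structures.
From mathcomp Require Import all_boot all_order all_algebra.
From mathcomp Require Import all_classical all_reals all_analysis.
Import Order.TTheory GRing.Theory Num.Theory.
Import numFieldNormedType.Exports.

Set Implicit Arguments.
Unset Strict Implicit.
Unset Printing Implicit Defensive.

Local Open Scope classical_set_scope.
Local Open Scope ring_scope.

(* The standard simplex with m vertices, i.e. of dimension m - 1. *)
Definition std_simplex (R : realType) (m : nat) : set 'rV[R]_m :=
  [set x | (forall i, 0 <= x 0 i) /\ \sum_i x 0 i = 1].
Arguments std_simplex R m : clear implicits.

Section Coface.
Variables (R : realType) (m : nat) (i : 'I_m.+1).

(* Insert a zero in position i. *)
Definition coface_row (x : 'rV[R]_m) : 'rV[R]_m.+1 :=
  \row_j oapp (x 0) 0 (unlift i j).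

Lemma coface_row_simplex x : x \in std_simplex R m ->
  coface_row x \in std_simplex R m.+1.
Proof.
move=> /set_mem [x0 x1]; apply/mem_set; split.
  by move=> j; rewrite mxE; case: unliftP => [k|] _ /=.
rewrite -x1 (bigD1_ord i) //= mxE unlift_none /= add0r.
by apply: eq_bigr => k _; rewrite mxE liftK.
Qed.

Definition coface (x : std_simplex R m) : std_simplex R m.+1 :=
  exist _ (coface_row (set_val x)) (coface_row_simplex (valP x)).

Lemma coface_continuous : continuous coface.
Proof.
have row_cts : continuous coface_row.
  move=> x B [P Px sPB]; exists (fun k l => P k (lift i l)).
    by move=> k l; have := Px k (lift i l); rewrite mxE liftK (ord1 k).
  move=> y Py; apply: sPB => k l; rewrite (ord1 k) mxE.
  case: unliftP => [l' ->|->] /=; first exact: Py.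
  by have := nbhs_singleton (Px 0 i); rewrite mxE unlift_none.
apply: continuous_comp_initial => x.
apply: (@continuous_comp _ _ _ set_val coface_row); last exact: row_cts.
exact: initial_continuous.
Qed.

HB.instance Definition _ :=
  @isContinuous.Build (std_simplex R m) (std_simplex R m.+1)
    coface coface_continuous.

End Coface.

Section SingularHomology.
Variables (R : realType) (X : topologicalType).

Definition singular_simplex (n : nat) : Type :=
  continuousType (std_simplex R n.+1) X.

Definition simplex_face (n : nat) (i : 'I_n.+2) (s : singular_simplex n.+1) :
  singular_simplex n := s \o coface i.

(* Singular n-chains with coefficients in Z/2Z are the finitely supported
   functions on the singular n-simplices. *)
Definition chain (n : nat) : Type := singular_simplex n -> 'F_2.

Definition finsupp (n : nat) (c : chain n) : Prop :=
  finite_set [set s | c s != 0].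

Definition chain_in (A : set X) (n : nat) (c : chain n) : Prop :=
  forall s, c s != 0 -> range s `<=` A.

Definition boundary (n : nat) (c : chain n.+1) : chain n :=
  fun t => \sum_(i < n.+2) \sum_(s \in [set s | simplex_face i s = t]) c s.

(* Every 0-chain is a cycle. *)
Definition rel_cycle (A : set X) (n : nat) : chain n -> Prop :=
  match n with
  | 0 => fun c => finsupp c
  | k.+1 => fun c => finsupp c /\ chain_in A (boundary c)
  end.

Definition rel_boundary (A : set X) (n : nat) (c : chain n) : Prop :=
  exists2 b : chain n.+1,
    finsupp b & chain_in A (fun s => c s - boundary b s).

(* The relative homology group H_n(X, A; Z/2Z), the quotient of relative cycles
   by relative boundaries, has dimension k: the classes of some cycles
   z_0, ..., z_(k-1) form a basis of it.  Taking A = set0 gives H_n(X; Z/2Z). *)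
Definition homology_dim (A : set X) (n k : nat) : Prop :=
  exists z : 'I_k -> chain n,
    (forall j, rel_cycle A (z j)) /\
    forall c : chain n, rel_cycle A c ->
      exists! a : {ffun 'I_k -> 'F_2},
        rel_boundary A (fun s => c s - \sum_j a j * z j s).

End SingularHomology.

Section Disks.
Variables (R : realType) (n : nat).

Definition sqnorm (x : 'rV[R]_n) : R := \sum_i x 0 i ^+ 2.
Definition closed_disk : set 'rV[R]_n := [set x | sqnorm x <= 1].
Definition open_disk : set 'rV[R]_n := [set x | sqnorm x < 1].
Definition unit_sphere : set 'rV[R]_n := [set x | sqnorm x = 1].

End Disks.

(* The restriction of f to A is a homeomorphism onto its image. *)
Definition homeo_onto_image (T U : topologicalType) (A : set T) (f : T -> U) :=
  {within A, continuous f} /\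
  exists2 g : U -> T, {within f @` A, continuous g} & {in A, cancel f g}.

(* A finite CW structure on X, given by its characteristic maps, which only
   matter on the closed disks.  As there are finitely many cells and X is
   Hausdorff, closure-finiteness and the weak topology condition are
   automatic, and so is the fact that the characteristic maps are
   homeomorphisms from the open disks onto the open cells. *)
Record cw_complex (R : realType) (X : topologicalType) := CWComplex {
  cell : finType;
  cell_dim : cell -> nat;
  char_map : forall i : cell, 'rV[R]_(cell_dim i) -> X;
  cw_hausdorff : hausdorff_space X;
  char_map_continuous : forall i,
    {within @closed_disk R (cell_dim i), continuous (@char_map i)};
  char_map_inj : forall i,
    {in @open_disk R (cell_dim i) &, injective (@char_map i)};
  open_cells_partition : forall x : X,
    exists! i, (@char_map i @` @open_disk R (cell_dim i)) x;
  char_map_sphere : forall i,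
    @char_map i @` @unit_sphere R (cell_dim i) `<=`
    \bigcup_(j in [set j | (cell_dim j < cell_dim i)%N])
      (@char_map j @` @open_disk R (cell_dim j))
}.
Arguments char_map {R X c} i _.

Section CWTheory.
Variables (R : realType) (X : topologicalType) (K : cw_complex R X).
Implicit Types i j : cell K.

(* The attaching map of a cell is the restriction of its characteristic map to
   the sphere. *)
Definition regular_cw : Prop :=
  forall i, homeo_onto_image (@unit_sphere R (cell_dim i)) (char_map i).

(* The closed cell.  Distinct cells have distinct closed cells, so that faces
   can be counted, and given a dimension, through their indices. *)
Definition face i : set X := char_map i @` @closed_disk R (cell_dim i).

Definition faces : set (set X) := range face.

Definition strongly_regular : Prop :=
  regular_cw /\
  forall i j, face i `&` face j = set0 \/ faces (face i `&` face j).

Definition facet i : Prop := forall j, face i `<=` face j -> face i = face j.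

Definition pure_cw : Prop :=
  forall i j, facet i -> facet j -> cell_dim i = cell_dim j.

Definition has_dim (e : nat) : Prop :=
  (forall i, (cell_dim i <= e)%N) /\ exists i, cell_dim i = e.

Definition pseudomanifold (e : nat) : Prop :=
  [/\ regular_cw, pure_cw, has_dim e &
      forall i, (cell_dim i).+1 = e ->
        #|[set j | (cell_dim j == e) && `[< face i `<=` face j >]]%SET| = 2%N].

Definition normal_pseudomanifold (e : nat) : Prop :=
  [/\ pseudomanifold e,
      connected [set: X],
      @homology_dim R X set0 e 1 &
      forall x : X, @homology_dim R X [set~ x] e 1].

Definition num_facets : nat := #|[set i | `[< facet i >]]%SET|.

End CWTheory.

Section Polytopes.
Variables (R : realType) (n : nat).

(* The points are the rows of V. *)
Definition convex_hull (m : nat) (V : 'M[R]_(m, n)) : set 'rV[R]_n :=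
  [set c *m V | c in std_simplex R m].

(* The rank is the dimension of the affine hull of the rows of V. *)
Definition polytope (d : nat) (P : set 'rV[R]_n) : Prop :=
  exists (m : nat) (V : 'M[R]_(m.+1, n)),
    P = convex_hull V /\ \rank (\matrix_i (row i V - row ord0 V)) = d.

Definition polytope_face (P F : set 'rV[R]_n) : Prop :=
  exists (a : 'cV[R]_n) (b : R),
    (forall x, P x -> (x *m a) 0 0 <= b) /\
    F = [set x | P x /\ (x *m a) 0 0 = b].

(* The empty face is left out, as it is in [faces]. *)
Definition boundary_complex (P : set 'rV[R]_n) : set (set 'rV[R]_n) :=
  [set F | [/\ polytope_face P F, F <> set0 & F <> P]].

End Polytopes.

(* Complexes are given by their sets of faces. *)
Definition combinatorially_equivalent (T U : Type)
    (FT : set (set T)) (FU : set (set U)) : Prop :=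
  exists f : set T -> set U,
    set_bij FT FU f /\
    forall A B, FT A -> FT B -> (f A `<=` f B <-> A `<=` B).

(* Main.v *)
Require Import Defs.
From HB Require Import structures.
From mathcomp Require Import all_boot all_order all_algebra.
From mathcomp Require Import all_classical all_reals all_analysis.
From mathcomp Require Import zify ring lra.
Import Order.TTheory GRing.Theory Num.Theory.
Import numFieldNormedType.Exports.

(* Idea.  Invariance of domain makes the face poset behave: the boundary of a
   closed k-cell is a (k-1)-sphere, so every proper face of the cell lies in a
   (k-1)-face of it, and a (k-2)-face lies in exactly two of those.  Indeed,
   coning turns an open piece of the sphere into an open set of R^k, a single
   (k-1)-face would make it a half-space, and the union of two of them already
   fills a neighbourhood, leaving no room for a third.

   Hence every face is the intersection of the facets above it, and the sets of
   facets above faces form a family of subsets of a (d+2)-element set T, closed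
   under intersection and graded of rank d+1.  So the cardinality of such a set
   exceeds its corank by 0 or 1.  The sets with excess 0 form a simplicial
   complex; those with excess 1 form an up-set, namely the sets containing some
   fixed D; and the maximal sets with excess 0 are complements of pairs in D.
   By the diamond property these pairs are the edges of a complete bipartite
   graph on D, with parts A and B.  This is the face lattice of the
   (|T| - |D|)-fold pyramid over a product of two simplices with |A| and |B|
   vertices.

   Invariance of domain itself is obtained as in Kulpa's and Tao's proofs from
   the Poincare-Miranda theorem, which in turn rests on a mod 2 cup product
   computation on the cubical grid. *)

Set Implicit Arguments.
Unset Strict Implicit.
Unset Printing Implicit Defensive.

Local Open Scope classical_set_scope.
Local Open Scope ring_scope.

(** * The Poincare-Miranda theorem *)

(** That intersections of faces are faces enters in three places: it makes a closed cell a union of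
    open cells, it makes a face the intersection of any two faces covering it, and it closes the
    family of facet sets under intersection. The two bounds on the excess are dual. Coranks grow
    strictly with the sets, from 0 at the empty set to d + 1 at T. Counting along a maximal chain
    from the empty set bounds the corank by the cardinality; the same count for complements gives
    the other bound, and d + 2 facets leave room for an excess of exactly 1. The graph on D is
    bipartite because of its triples: if a triple in D contains an edge, its complement has corank d
    - 1, so exactly two sets lie strictly between it and T, and the triple contains exactly two
    edges. The parts have at least two elements each because every single facet is a face. The case
    d = 1 stands apart: a connected complex of dimension 0 is a point and cannot have three
    facets. *)

Lemma addF2xx (x : 'F_2) : x + x = 0.
Proof. by apply/val_inj; case: x => [[|[|]]]. Qed.

Lemma addF2_eq0 (x y : 'F_2) : (x + y == 0) = (x == y).
Proof. by rewrite addr_eq0 -[in RHS](addrK y y) addF2xx sub0r. Qed.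

(** The pairs [(i, j)] and [(j, i)] contribute equally and cancel modulo 2; this is the mechanism
    behind the closedness of the forms below. *)
Lemma sum_sym_F2 (n : nat) (A : {set 'I_n}) (g : 'I_n -> 'I_n -> 'F_2) :
  (forall i j, g i j = g j i) ->
  \sum_(i in A) \sum_(j in (A :\ i)%SET) g i j = 0.
Proof.
move=> gC.
rewrite (eq_bigr (fun i : 'I_n => \sum_(j in A | (j < i)%N) g i j +
    \sum_(j in A | (i < j)%N) g i j)); last first.
  move=> i iA; rewrite (bigID (fun j : 'I_n => (j < i)%N)) /=.
  congr (_ + _); apply: eq_bigl => j; rewrite !inE.
    by rewrite -val_eqE /=; case: ltngtP => //; rewrite ?andbT ?andbF.
  by rewrite -val_eqE /=; case: ltngtP => //; rewrite ?andbT ?andbF.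
rewrite big_split /= [X in _ + X](exchange_big_dep (mem A)) /=;
  last by move=> i j _ /andP[].
under [X in _ + X]eq_bigr => i iA.
  under eq_bigl => j do rewrite iA /=.
  under eq_bigr => j _ do rewrite gC.
  over.
exact: addF2xx.
Qed.

Lemma setD1C (T : finType) (A : {set T}) (x y : T) :
  ((A :\ x) :\ y = (A :\ y) :\ x)%SET.
Proof. by rewrite !finset.setDDl finset.setUC. Qed.

(** * Discrete exterior calculus modulo 2 on the cubical lattice *)

Section CubicalCup.
Variable n : nat.
Implicit Types (b c : 'I_n -> nat) (i j k : 'I_n) (s : seq 'I_n).
Implicit Types A : {set 'I_n}.

Definition incr i b : 'I_n -> nat := fun j => (b j + (j == i))%N.
Definition upd i t b : 'I_n -> nat := fun j => if j == i then t else b j.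

Lemma incrC i j b : incr i (incr j b) = incr j (incr i b).
Proof. by apply: funext => k; rewrite /incr addnAC. Qed.

Lemma upd_incr i j t b : i != j -> upd i t (incr j b) = incr j (upd i t b).
Proof.
by move=> ij; apply: funext => k; rewrite /upd /incr; case: eqP => [->|//]; rewrite (negPf ij) addn0.
Qed.

Lemma incr_upd i t b : incr i (upd i t b) = upd i t.+1 b.
Proof.
by apply: funext => k; rewrite /upd /incr; case: eqP => _; rewrite ?addn1 ?addn0.
Qed.

Lemma upd_updC i j t u b : i != j -> upd i t (upd j u b) = upd j u (upd i t b).
Proof.
by move=> ij; apply: funext => k; rewrite /upd; case: eqP => // ->; rewrite (negPf ij).
Qed.

Variable f : 'I_n -> ('I_n -> nat) -> 'F_2.

(* The coefficient of [prod_(i in A) dx_i] in the product [df_k1 df_k2 ...],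
   modulo 2, in the discrete exterior calculus of the lattice, where
   [dx_i f = (f \o incr i) dx_i]. *)
Fixpoint cup s A b : 'F_2 :=
  if s is k :: s' then
    \sum_(i in A) (f k (incr i b) + f k b) * cup s' (A :\ i)%SET (incr i b)
  else 1.

(* The form [df_k1 df_k2 ...] is closed. *)
Lemma cup_closed s A b :
  \sum_(i in A) cup s (A :\ i)%SET (incr i b) =
  \sum_(i in A) cup s (A :\ i)%SET b.
Proof.
elim: s A b => [//|k s IHs] A b /=.
under eq_bigr => i _ do under eq_bigr => j _ do rewrite mulrDl.
under eq_bigr => i _ do rewrite big_split /=.
rewrite big_split /= sum_sym_F2 ?add0r; last first.
  by move=> i j; rewrite incrC setD1C.
under [RHS]eq_bigr => i _ do under eq_bigr => j _ do rewrite mulrDl.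
under [RHS]eq_bigr => i _ do rewrite big_split /=.
rewrite big_split /=.
have -> : \sum_(i in A) \sum_(j in (A :\ i)%SET)
    f k b * cup s ((A :\ i) :\ j)%SET (incr j b) = 0.
  under eq_bigr => i _.
    rewrite -big_distrr /= IHs big_distrr /=.
    over.
  by rewrite sum_sym_F2 // => i j; rewrite setD1C.
rewrite addr0.
rewrite [RHS](exchange_big_dep (mem A)) /=; last by move=> i j _; rewrite inE => /andP[].
apply: eq_bigr => i iA.
rewrite -big_distrr /=.
rewrite IHs big_distrr /=.
apply: eq_big => j; first by rewrite !inE iA andbT eq_sym andbC.
by move=> _; rewrite setD1C.
Qed.

(** Since the form [w] of [s] is closed, [df_k w] equals [d(f_k w)], so that sums over a box
    telescope to its sides. *)
Lemma cup_cons k s A b :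
  cup (k :: s) A b =
  \sum_(i in A) (f k (incr i b) * cup s (A :\ i)%SET (incr i b) +
                 f k b * cup s (A :\ i)%SET b).
Proof.
rewrite /=; under eq_bigr => i _ do rewrite mulrDl.
by rewrite !big_split /= -!big_distrr /= cup_closed.
Qed.

(** On a side where coordinate [i] is fixed, [f i] is constant, so [df_i] vanishes there, and with
    it every product that contains it. *)
Lemma cup_side0 i s A b : i \in s -> i \notin A ->
  (forall c, c i = b i -> f i c = f i b) -> cup s A b = 0.
Proof.
elim: s A b => [//|k s IHs] A b; rewrite inE => /orP[/eqP <-|si] iA fib.
  rewrite /=; apply: big1 => j jA; rewrite fib ?addF2xx ?mul0r // /incr.
  by rewrite (_ : i == j = false) ?addn0 //; apply: contraNF iA => /eqP ->.
rewrite /=; apply: big1 => j jA.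
have ij : (i == j) = false by apply: contraNF iA => /eqP ->.
rewrite IHs ?mulr0 // ?inE ?(negPf iA) ?andbF //.
by move=> c; rewrite {1}/incr ij addn0 => cb; rewrite fib // [RHS]fib // /incr ij addn0.
Qed.

(** A nonzero summand of the expanded product is a monotone lattice path from [b] in directions of
    [A], and each [f k] changes across some edge of this path. *)
Lemma cup_neq0 s A b : cup s A b != 0 -> forall k, k \in s ->
  exists u v, f k u != f k v /\
    forall j, (b j <= u j <= b j + (j \in A) /\ b j <= v j <= b j + (j \in A))%N.
Proof.
elim: s A b => [//|k s IHs] A b /= nz l.
have [i iA] : exists2 i, i \in A &
    (f k (incr i b) + f k b) * cup s (A :\ i)%SET (incr i b) != 0.
  apply/exists_inP; apply: contraNT nz => /exists_inPn h.
  by apply/eqP/big1 => i /h; rewrite negbK => /eqP.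
rewrite mulf_eq0 negb_or => /andP[fk cs].
rewrite inE => /orP[/eqP ->|ls].
  exists (incr i b), b; split; first by rewrite -addF2_eq0.
  move=> j; rewrite /incr; case: (j == i) / eqP => [->|_]; rewrite ?iA /=; lia.
have [u [v [fuv uv]]] := IHs _ _ cs _ ls.
exists u, v; split => // j; have := uv j; rewrite /incr !inE.
case: (j == i) / eqP => [->|_]; rewrite ?iA /=; lia.
Qed.

Variable N : nat.

Definition boxsum : seq 'I_n -> (('I_n -> nat) -> 'F_2) -> ('I_n -> nat) -> 'F_2 :=
  fix F s h c := if s is i :: s' then \sum_(t < N) F s' h (upd i t c) else h c.

Lemma eq_boxsum s h h' c : (forall b, h b = h' b) -> boxsum s h c = boxsum s h' c.
Proof. by move=> /funext ->. Qed.

Lemma boxsumD s h h' c :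
  boxsum s (fun b => h b + h' b) c = boxsum s h c + boxsum s h' c.
Proof.
elim: s c => [//|i s IHs] c /=.
by rewrite -big_split /=; apply: eq_bigr => t _.
Qed.

Lemma boxsum_sum s A (h : 'I_n -> ('I_n -> nat) -> 'F_2) c :
  boxsum s (fun b => \sum_(i in A) h i b) c = \sum_(i in A) boxsum s (h i) c.
Proof.
elim: s c => [//|i s IHs] c /=.
by rewrite exchange_big /=; apply: eq_bigr => t _.
Qed.

Lemma boxsum_comm s (phi : ('I_n -> nat) -> ('I_n -> nat)) h c :
  (forall i t b, i \in s -> phi (upd i t b) = upd i t (phi b)) ->
  boxsum s (h \o phi) c = boxsum s h (phi c).
Proof.
elim: s c => [//|i s IHs] c phiP /=.
apply: eq_bigr => t _; rewrite IHs ?phiP ?mem_head // => j u b js.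
by rewrite phiP // inE js orbT.
Qed.

(** The discrete fundamental theorem of calculus in direction [i]; the sign of the lower limit
    disappears modulo 2. *)
Lemma boxsum_telescope s i h c : uniq s -> i \in s ->
  boxsum s (fun b => h (incr i b) + h b) c =
  boxsum (rem i s) (fun b => h (upd i N b) + h (upd i 0 b)) c.
Proof.
elim: s c => [//|k s IHs] c /= /andP[ks us]; rewrite inE => /orP[/eqP ik|si].
  rewrite ik eqxx -ik.
  have ins j : j \in s -> i != j by apply: contraTneq => <-; rewrite ik.
  rewrite boxsumD (boxsum_comm (phi := upd i N)); last first.
    by move=> j t b /ins ij; rewrite upd_updC.
  rewrite (boxsum_comm (phi := upd i 0)); last first.
    by move=> j t b /ins ij; rewrite upd_updC.
  pose u t := boxsum s h (upd i t c).
  under eq_bigr => t _.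
    rewrite boxsumD (boxsum_comm (phi := incr i)) ?incr_upd; last first.
      by move=> j v b /ins ij; rewrite upd_incr // eq_sym.
    rewrite -[X in X + _]/(u t.+1) -[X in _ + X]/(u t).
    over.
  rewrite -/(u 0%N) -/(u N) /=.
  elim: N => [|m IHm]; first by rewrite big_ord0 addF2xx.
  by rewrite big_ord_recr /= IHm addrC -addrA (addrA (u m)) addF2xx add0r.
have ki : k != i by apply: contraNneq ks => ->.
by rewrite (negPf ki) /=; apply: eq_bigr => t _; apply: IHs.
Qed.

Lemma boxsum_neq0 s h c : uniq s -> boxsum s h c != 0 ->
  exists b, [/\ h b != 0, (forall i, i \in s -> (b i < N)%N) &
    forall i, i \notin s -> b i = c i].
Proof.
elim: s c => [|i s IHs] c /=; first by exists c.
move=> /andP[si us] nz.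
have [t] : exists t : 'I_N, boxsum s h (upd i t c) != 0.
  apply/existsP; apply: contraNT nz => /existsPn h0.
  by apply/eqP/big1 => t _; apply/eqP; rewrite -[_ == _]negbK h0.
move=> /(IHs _ us)[b [hb bN bc]]; exists b; split => // j.
  rewrite inE => /orP[/eqP ->|/bN //]; by rewrite bc // /upd eqxx.
by rewrite inE negb_or => /andP[ji /bc ->]; rewrite /upd (negPf ji).
Qed.

Hypothesis f0 : forall k b, b k = 0%N -> f k b = 0.
Hypothesis fN : forall k b, b k = N -> f k b = 1.

(** Stokes: the integrand is exact by [cup_cons]. On the sides transverse to another direction [i],
    the factor [df_i] vanishes. Of the two sides transverse to [k], one has [f k] equal to 0 and the
    other has it equal to 1, which leaves the same integral in one dimension less. *)
Lemma boxsum_cup s c : uniq s -> boxsum s (cup s [set i in s]%SET) c = 1.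
Proof.
elim: s c => [//|k s IHs] c us; have := us; rewrite cons_uniq => /andP[ks us'].
rewrite (eq_boxsum (k :: s) c (cup_cons k s _)) boxsum_sum (bigD1 k) ?inE ?eqxx //.
have side i t b h : i \in s -> (t = 0%N \/ t = N) ->
    h * cup s ([set i in k :: s]%SET :\ i)%SET (upd i t b) = 0.
  move=> si tP; rewrite (@cup_side0 i) ?mulr0 // ?inE ?eqxx //.
  have ut : upd i t b i = t by rewrite /upd eqxx.
  move=> d; rewrite ut => dt; case: tP => tE.
    by rewrite (f0 (b := d)) ?dt // (f0 (b := upd i t b)) ?ut.
  by rewrite (fN (b := d)) ?dt // (fN (b := upd i t b)) ?ut.
rewrite big1; last first.
  move=> i /andP[]; rewrite !inE => /orP[/eqP ->|si ik]; first by rewrite eqxx.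
  rewrite (@boxsum_telescope (k :: s) i (fun b => f k b * cup s ([set i in k :: s]%SET :\ i)%SET b) c) //; last by rewrite inE si orbT.
  rewrite [X in boxsum _ X](_ : _ = fun=> 0); last first.
    by apply: funext => b; rewrite !side ?addr0; auto.
  by elim: (rem _ _) c {IHs} => [//|j s' IH] c /=; rewrite big1.
rewrite [LHS]addr0 (@boxsum_telescope (k :: s) k (fun b => f k b * cup s ([set i in k :: s]%SET :\ k)%SET b) c) //; last by rewrite mem_head.
rewrite /= eqxx.
have -> : ([set i in k :: s]%SET :\ k)%SET = [set i in s]%SET.
  apply/setP => i; rewrite !inE; case: eqP => //= ->; by rewrite (negPf ks).
rewrite [X in boxsum _ X](_ : _ = cup s [set i in s]%SET \o upd k N); last first.
  apply: funext => b /=; rewrite (fN (b := upd k N b)) ?(f0 (b := upd k 0 b)).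
  - by rewrite mul0r addr0 mul1r.
  - by rewrite /upd eqxx.
  - by rewrite /upd eqxx.
rewrite boxsum_comm ?IHs //.
move=> i t b si; rewrite upd_updC //; by apply: contraNneq ks => ->.
Qed.

(** An integral equal to 1 has a nonzero term, that is, a unit cube in which each of the [n] labels
    takes both values. *)
Lemma kuhn_labelling : exists b : 'I_n -> nat, (forall i, (b i < N)%N) /\
  forall k, exists u v, f k u != f k v /\
    forall j, (b j <= u j <= (b j).+1 /\ b j <= v j <= (b j).+1)%N.
Proof.
have := boxsum_cup (fun=> 0%N) (enum_uniq 'I_n) => nz.
have [|b [cb bN _]] := @boxsum_neq0 (enum 'I_n)
    (cup (enum 'I_n) [set i in enum 'I_n]%SET) (fun=> 0%N) (enum_uniq 'I_n).
  by rewrite nz oner_eq0.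
exists b; split=> [i|k]; first by apply: bN; rewrite mem_enum.
have [|u [v [fuv uv]]] := cup_neq0 cb (k := k); first by rewrite mem_enum.
exists u, v; split=> // j; have := uv j; rewrite inE mem_enum /=; lia.
Qed.

End CubicalCup.

(** * From labellings to zeros of continuous maps *)

Section MetricLemmas.
Context {R : realType}.

Lemma within_continuous_normP (V W : normedModType R) (A : set V) (f : V -> W) :
  {within A, continuous f} <->
  forall x, A x -> forall e, 0 < e ->
    exists2 d, 0 < d & forall y, A y -> `|x - y| < d -> `|f x - f y| < e.
Proof.
split=> [/subspace_continuousP fc x Ax e e0|fc].
  have /cvgrPdist_lt /(_ e e0) := fc x Ax.
  rewrite /within /prop_near1 /= => /nbhs_normP[d /= d0 h].
  by exists d => // y Ay xy; apply: h.
apply/subspace_continuousP => x Ax; apply/cvgrPdist_lt => e e0.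
have [d d0 h] := fc x Ax e e0.
by apply/nbhs_normP; exists d => // y /= xy Ay; apply: h.
Qed.

Lemma nbhs_rVP n (x : 'rV[R]_n) (A : set 'rV[R]_n) :
  nbhs x A <-> exists2 e, 0 < e & forall y, `|x - y| < e -> A y.
Proof.
split=> [/(@nbhs_normP _ 'rV[R]_n)[e /= e0 h]|[e e0 h]]; first by exists e.
by apply/(@nbhs_normP _ 'rV[R]_n); exists e.
Qed.

Lemma normr_rV_le n (x : 'rV[R]_n) (r : R) : 0 <= r ->
  (`|x| <= r) = [forall i, `|x 0 i| <= r].
Proof.
move=> r0; apply/idP/forallP => [xr i|h].
  apply: le_trans xr; rewrite [leRHS]/Num.norm /= mx_normrE.
  by rewrite (le_bigmax _ (fun ij : 'I_1 * 'I_n => `|x ij.1 ij.2|) (0, i)).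
rewrite /Num.norm /= mx_normrE; apply/bigmax_leP; split => // -[i j] _ /=.
by rewrite (ord1 i).
Qed.

Lemma normr_rV_lt n (x : 'rV[R]_n) (r : R) : 0 < r ->
  (`|x| < r) = [forall i, `|x 0 i| < r].
Proof.
move=> r0; apply/idP/forallP => [xr i|h].
  apply: le_lt_trans xr; rewrite [leRHS]/Num.norm /= mx_normrE.
  by rewrite (le_bigmax _ (fun ij : 'I_1 * 'I_n => `|x ij.1 ij.2|) (0, i)).
rewrite /Num.norm /= mx_normrE; apply/bigmax_ltP; split => // -[i j] _ /=.
by rewrite (ord1 i).
Qed.

Lemma coord_le_norm n (x : 'rV[R]_n) i : `|x 0 i| <= `|x|.
Proof. by have := normr_rV_le x (normr_ge0 x); rewrite lexx => /esym/forallP. Qed.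

Lemma norm_attained n (x : 'rV[R]_n) : x != 0 -> exists i, `|x 0 i| = `|x|.
Proof.
move=> x0; have [|[i j] /= h] := @mx_norm_neq0 _ _ _ x.
  by apply: contra_neq x0 => /mx_norm_eq0.
by exists j; rewrite [RHS]h (ord1 i).
Qed.

(** The norm of row vectors is the maximum norm, so its unit ball is a cube. *)
Definition cube n : set 'rV[R]_n := [set x | `|x| <= 1].

Lemma cubeP n (x : 'rV[R]_n) : cube x <-> forall i, `|x 0 i| <= 1.
Proof. by rewrite /cube /= normr_rV_le //; split=> /forallP. Qed.

Lemma closed_norm_le n (r : R) : closed [set x : 'rV[R]_n | `|x| <= r].
Proof.
apply: (@closed_comp _ _ (fun x : 'rV[R]_n => `|x|) [set t : R | t <= r]).
  by move=> x _; apply: norm_continuous.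
exact: closed_le.
Qed.

Lemma compact_norm_le n (r : R) : compact [set x : 'rV[R]_n | `|x| <= r].
Proof.
apply: bounded_closed_compact; last exact: closed_norm_le.
exists r; split; first exact: num_real.
by move=> M rM x /= xr; apply: le_trans xr (ltW rM).
Qed.

Lemma poincare_miranda n (F : 'rV[R]_n -> 'rV[R]_n) :
  {within @cube n, continuous F} ->
  (forall x i, cube x -> x 0 i = -1 -> F x 0 i <= 0) ->
  (forall x i, cube x -> x 0 i = 1 -> F x 0 i >= 0) ->
  exists2 x, cube x & F x = 0.
Proof.
move=> Fc Fm1 F1.
(* Grid points of mesh [2 / N.+1]; clamping at 2 keeps lattice points beyond the box inside the
   cube. *)
pose pt N (b : 'I_n -> nat) : 'rV[R]_n :=
  \row_i (Num.min ((b i)%:R / N.+1%:R *+ 2) 2 - 1).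
have ptcube N b : cube (pt N b).
  apply/cubeP => i; rewrite mxE ler_norml.
  have h0 : 0 <= (b i)%:R / N.+1%:R :> R by rewrite divr_ge0.
  by move: (_ / _) h0 => t h0; rewrite mulr2n; case: (leP (t + t)) => h; apply/andP; split; lra.
have pt0 N b i : b i = 0%N -> pt N b 0 i = -1.
  by rewrite mxE => ->; rewrite mul0r mul0rn minEle ler0n add0r.
have ptN N b i : b i = N.+1 -> pt N b 0 i = 1.
  rewrite mxE => ->; rewrite divff ?pnatr_eq0 // minEle lexx; lra.
(* The labels are signs of [F], overridden on the sides of the cube. The sign conditions there make
   label 0 imply a value at most 0, and label 1 a value at least 0, everywhere. *)
pose lab N (k : 'I_n) b : 'F_2 :=
  if b k == 0%N then 0 else if b k == N.+1 then 1 else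
  if 0 < F (pt N b) 0 k then 1 else 0.
have K N : exists x, [/\ cube x & forall k, exists u v, [/\ cube u /\ cube v,
    F u 0 k <= 0, F v 0 k >= 0, `|x - u| <= 2 / N.+1%:R & `|x - v| <= 2 / N.+1%:R]].
  have [||b [bN bl]] := @kuhn_labelling n (lab N) N.+1.
  - by move=> k b bk; rewrite /lab bk eqxx.
  - by move=> k b bk; rewrite /lab bk eqxx.
  exists (pt N b); split=> // k.
  have close u : (forall j, (b j <= u j <= (b j).+1)%N) ->
      `|pt N b - pt N u| <= 2 / N.+1%:R.
    move=> bu; rewrite normr_rV_le ?divr_ge0 //; apply/forallP => j.
    rewrite !mxE; move: (bu j) => /andP[b1 b2].
    have N0 : 0 < N.+1%:R^-1 :> R by rewrite invr_gt0.
    have h1 : (b j)%:R / N.+1%:R <= (u j)%:R / N.+1%:R :> R.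
      by rewrite ler_pM2r // ler_nat.
    have h2 : (u j)%:R / N.+1%:R <= (b j)%:R / N.+1%:R + N.+1%:R^-1 :> R.
      by rewrite -{3}[N.+1%:R^-1]mul1r -mulrDl ler_pM2r // natr1 ler_nat.
    move: N0 h1 h2; rewrite ler_norml !mulr2n.
    move: (_^-1) ((u j)%:R / _) ((b j)%:R / _) => e u' t N0 h1 h2.
    by case: (leP (t + t)) => g1; case: (leP (u' + u')) => g2; apply/andP; split; lra.
  have lab0 w : lab N k w = 0 -> F (pt N w) 0 k <= 0.
    rewrite /lab; case: eqP => [w0 _|_]; first by apply: Fm1; rewrite ?pt0.
    by case: eqP => // _; case: ltP.
  have lab1 w : lab N k w = 1 -> 0 <= F (pt N w) 0 k.
    rewrite /lab; case: eqP => [//|_].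
    case: eqP => [wN _|_]; first by apply: F1; rewrite ?ptN.
    by case: ltP => // /ltW.
  have labE w : lab N k w = 0 \/ lab N k w = 1.
    rewrite /lab; case: ifP => _; auto; case: ifP => _; auto; case: ifP; auto.
  have [u [v [fuv uv]]] := bl k.
  have [u1 v1] : (forall j, (b j <= u j <= (b j).+1)%N) /\
      (forall j, (b j <= v j <= (b j).+1)%N) by split=> j; case: (uv j).
  have [u0|u0] := labE u; have [v0|v0] := labE v.
  - by rewrite u0 v0 eqxx in fuv.
  - exists (pt N u), (pt N v); split; [by split|exact: lab0|exact: lab1|exact: close|exact: close].
  - exists (pt N v), (pt N u); split; [by split|exact: lab0|exact: lab1|exact: close|exact: close].
  - by rewrite u0 v0 eqxx in fuv.
have [xs xsP] := choice K.
have /(_ (xs @ \oo) _)[] := @compact_norm_le n 1.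
  by exists 0%N => // N _; have [] := xsP N.
move=> x [cx clx]; exists x => //.
(* A nonzero coordinate at the cluster point would keep its strict sign nearby, whereas each small
   cube contains values of both weak signs. *)
apply/rowP => k; rewrite mxE; apply/eqP/negPn/negP => Fk.
have e0 : 0 < `|F x 0 k| by rewrite normr_gt0.
have [d d0 dP] := (within_continuous_normP _ _).1 Fc x cx _ e0.
have [N [xN N2]] : exists N, `|x - xs N| < d / 2 /\ 2 / N.+1%:R < d / 2.
  have [M M2] : exists M, forall N, (M <= N)%N -> 2 / N.+1%:R < d / 2.
    have [M hM] := ltr_add_invr (divr_gt0 d0 (ltr0n R 4)).
    exists M => N MN; rewrite add0r in hM.
    suff : N.+1%:R^-1 <= M.+1%:R^-1 :> R.
      by move: (N.+1%:R^-1) (M.+1%:R^-1) hM => a a' ? ?; lra.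
    by rewrite lef_pV2 ?posrE // ler_nat.
  have h1 : (xs @ \oo) (xs @` [set N | (M <= N)%N]).
    by exists M => // N MN; exists N.
  have h2 : nbhs x [set y | `|x - y| < d / 2].
    by apply/nbhs_rVP; exists (d / 2) => //; rewrite divr_gt0.
  have [_ [[N MN <-] xN]] := clx _ _ h1 h2.
  by exists N; split => //; apply: M2.
have [_ /(_ k)[u [v [[cu cv] Fu Fv xu xv]]]] := xsP N.
have near w : cube w -> `|xs N - w| <= 2 / N.+1%:R -> `|F x 0 k - F w 0 k| < `|F x 0 k|.
  move=> cw xw.
  have /(dP w cw) : `|x - w| < d.
    rewrite -[x - w](subrKA (xs N)); rewrite [ltRHS]splitr.
    exact: le_lt_trans (ler_normD _ _) (ltrD xN (le_lt_trans xw N2)).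
  by apply: le_lt_trans; have := coord_le_norm (F x - F w) k; rewrite !mxE.
have absurd (a p q : R) : p <= 0 -> 0 <= q -> `|a - p| < `|a| -> `|a - q| < `|a| -> False.
  by move=> ? ?; case: (ger0P a) => h; rewrite !ltr_norml => /andP[? ?] /andP[? ?]; lra.
exact: absurd Fu Fv (near u cu xu) (near v cv xv).
Qed.

End MetricLemmas.

(** * Invariance of domain *)

Section GeneralPosition.
Context {R : realType}.

Lemma poly_nonroot_ge (p : {poly R}) (T : R) : p != 0 ->
  exists2 t, T <= t & p.[t] != 0.
Proof.
move=> p0; pose rs := [seq T + i%:R | i <- iota 0 (size p)].
have [/allP rsp|/allPn[t /mapP[i _ ->] pt]] := boolP (all (root p) rs).
  have urs : uniq rs by rewrite map_inj_uniq ?iota_uniq // => i j /addrI/eqP; rewrite eqr_nat => /eqP.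
  by have := max_poly_roots p0 (introT allP rsp) urs; rewrite size_map size_iota ltnn.
by exists (T + i%:R) => //; rewrite lerDl ler0n.
Qed.

(** Small multiples of points of the moment curve are added. Up to scaling, each determinant is a
    polynomial in [t] whose value at 0 is a Vandermonde determinant, so some large [t] avoids the
    roots of all of them. *)
Lemma generic_perturbation n (I : finType) (x : I -> 'rV[R]_n) (e : R) : 0 < e ->
  exists2 w : I -> 'rV[R]_n, (forall k, `|x k - w k| <= e) &
    forall iota : 'I_n -> I, injective iota -> \matrix_i w (iota i) \in unitmx.
Proof.
move=> e0; pose s (k : I) : R := (enum_rank k)%:R.
pose mom (k : I) : 'rV[R]_n := \row_j s k ^+ j.
pose A (iota : 'I_n -> I) : 'M[{poly R}]_n :=
  \matrix_(i, j) ((mom (iota i) 0 j)%:P + x (iota i) 0 j *: 'X).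
pose Q := \prod_(iota : {ffun 'I_n -> I} | injectiveb iota) \det (A iota).
have hA iota t : (\det (A iota)).[t] =
    \det (\matrix_(i, j) (mom (iota i) 0 j + t * x (iota i) 0 j)).
  rewrite -[LHS]/(horner_eval t (\det (A iota))) -det_map_mx; congr (\det _).
  apply/matrixP => i j; rewrite 3!mxE -[LHS]/(_.[t]) hornerD hornerC hornerZ hornerX.
  by rewrite !mxE mulrC.
have Q0 : Q != 0.
  apply/prodf_neq0 => iota /injectiveP iinj.
  suff : (\det (A iota)).[0] != 0 by apply: contra_neq => ->; rewrite horner0.
  rewrite hA -det_tr.
  have -> : (\matrix_(i, j) (mom (iota i) 0 j + 0 * x (iota i) 0 j))^T =
      Vandermonde n (\row_i s (iota i)).
    by apply/matrixP => i j; rewrite !mxE mul0r addr0.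
  rewrite det_Vandermonde; apply/prodf_neq0 => i _; apply/prodf_neq0 => j ij.
  rewrite !mxE subr_eq0 eqr_nat val_eqE (inj_eq enum_rank_inj) (inj_eq iinj).
  by rewrite neq_ltn orbC ij.
(* The bound [(M + 1) / e] on [t] makes the displacement by [t^-1 *: mom k] at most [e]; the added 1
   makes [t] positive. *)
pose M := \sum_k `|mom k|.
have M0 : 0 <= M by apply: sumr_ge0.
have [t tM Qt] := poly_nonroot_ge ((M + 1) / e) Q0.
have t0 : 0 < t by apply: lt_le_trans tM; rewrite divr_gt0 // ltr_pwDr.
exists (fun k => x k + t^-1 *: mom k) => [k|iota iinj].
  rewrite opprD addrA subrr sub0r normrN normrZ gtr0_norm ?invr_gt0 //.
  rewrite ler_pdivrMl //; apply: (@le_trans _ _ M).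
    by rewrite /M (bigD1 k) //= lerDl sumr_ge0.
  rewrite ler_pdivrMr // in tM; apply: le_trans tM; by rewrite lerDl.
rewrite unitmxE unitfE.
have -> : \matrix_i (x (iota i) + t^-1 *: mom (iota i)) = t^-1 *:
    \matrix_(i, j) (mom (iota i) 0 j + t * x (iota i) 0 j).
  apply/matrixP => i j; rewrite !mxE mulrDr mulKf ?gt_eqF //; exact: addrC.
rewrite detZ mulf_neq0 // ?expf_neq0 ?invr_eq0 ?(gt_eqF t0) //.
move: Qt; rewrite /Q horner_prod => /prodf_neq0/(_ (finfun iota)).
rewrite (_ : injectiveb _); last first.
  by apply/injectiveP => i j; rewrite !ffunE; apply: iinj.
move=> /(_ isT); rewrite hA; congr (_ != 0); congr (\det _).
by apply/matrixP => i j; rewrite !mxE ffunE.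
Qed.

(** The support of [a] is padded to exactly [n] indices, whose vectors form an invertible matrix;
    this is where [n <= #|I|] enters. *)
Lemma general_position n (I : finType) (x : I -> 'rV[R]_n) (e : R) :
  (n <= #|I|)%N -> 0 < e ->
  exists2 w : I -> 'rV[R]_n, (forall k, `|x k - w k| <= e) &
    forall a : I -> R, (#|[set k | a k != 0%R]%SET| <= n)%N ->
      \sum_k a k *: w k = 0 -> forall k, a k = 0.
Proof.
move=> nI e0; have [w wx wP] := generic_perturbation x e0.
exists w => // a cA aw0 k0; set A := [set k | a k != 0]%SET in cA.
pose s := enum A ++ enum (~: A)%SET.
have us : uniq s.
  rewrite cat_uniq !enum_uniq andbT /=; apply/hasPn => k.
  by rewrite !mem_enum inE.
have ss : size s = #|I| by rewrite size_cat -!cardE cardsC.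
have sn : (size (take n s) = n) by rewrite size_take ss; case: ltngtP nI.
have aD k : k \in drop n s -> a k = 0.
  rewrite drop_cat -cardE ltnNge cA /= => /mem_drop.
  by rewrite mem_enum !inE negbK => /eqP.
have sE : perm_eq (index_enum I) s.
  apply: uniq_perm => //; first exact: index_enum_uniq.
  by move=> k; rewrite mem_index_enum mem_cat !mem_enum finset.in_setC orbN.
pose iota (i : 'I_n) := nth k0 s i.
have iinj : injective iota.
  move=> i j /eqP; rewrite nth_uniq ?ss ?(leq_trans (ltn_ord _)) //.
  by move=> /eqP/val_inj.
have a0 : \row_i a (iota i) = 0.
  apply: (can_inj (mulmxK (wP iota iinj))); rewrite mul0mx -[RHS]aw0.
  rewrite (perm_big _ sE) /= -(cat_take_drop n s) big_cat /=.
  rewrite [X in _ = _ + X]big1_seq ?addr0; last by move=> k /andP[_ /aD ->]; rewrite scale0r.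
  rewrite (big_nth k0) sn big_mkord mulmx_sum_row; apply: eq_bigr => i _.
  by rewrite mxE rowK nth_take.
have [k0s|] := boolP (k0 \in take n s).
  have /(nthP k0)[i] := k0s; rewrite sn => ilt kE.
  by have /rowP/(_ (Ordinal ilt)) := a0; rewrite !mxE /iota /= -(nth_take _ ilt) kE.
move=> k0s; apply: aD; have : k0 \in s by rewrite -(perm_mem sE) mem_index_enum.
by rewrite -{1}(cat_take_drop n s) mem_cat (negPf k0s).
Qed.

End GeneralPosition.

(** * Bump functions on the Kuhn triangulation *)

Section KuhnHat.
Context {R : realType}.
Variable n : nat.
Implicit Types (k : 'I_n -> nat) (u : 'rV[R]_n).

(* A bump function supported on the star of the vertex [k] in the Kuhn
   triangulation of the integer lattice. *)
Definition hat k u : R :=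
  (\prod_i Num.max 0 (1 - `|u 0 i - (k i)%:R|)) *
  \prod_i \prod_j Num.max 0 (1 - ((u 0 i - (k i)%:R) - (u 0 j - (k j)%:R))).

Lemma hat_ge0 k u : 0 <= hat k u.
Proof.
rewrite mulr_ge0 //; apply: prodr_ge0 => i _; first by rewrite le_max lexx.
by apply: prodr_ge0 => j _; rewrite le_max lexx.
Qed.

Lemma hat_neq0P k u : hat k u != 0 <->
  (forall i, `|u 0 i - (k i)%:R| < 1) /\
  (forall i j, (u 0 i - (k i)%:R) - (u 0 j - (k j)%:R) < 1).
Proof.
have maxE (x : R) : (Num.max 0 (1 - x) != 0) = (x < 1).
  case: (ltP x 1) => h; last by rewrite max_l ?eqxx // subr_le0.
    by rewrite max_r ?subr_ge0 ?ltW // gt_eqF // subr_gt0.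
rewrite /hat mulf_eq0 negb_or; split.
  move=> /andP[/prodf_neq0 h1 /prodf_neq0 h2]; split=> [i|i j].
    by rewrite -maxE h1.
  by have /prodf_neq0 := h2 i isT => /(_ j isT); rewrite maxE.
move=> [h1 h2]; apply/andP; split; apply/prodf_neq0 => i _; first by rewrite maxE.
by apply/prodf_neq0 => j _; rewrite maxE.
Qed.

Lemma hat_continuous k : continuous (hat k).
Proof.
have coord i : continuous (fun u : 'rV[R]_n => u 0 i) by move=> u; apply: coord_continuous.
have maxc (g : 'rV[R]_n -> R) : continuous g ->
    continuous (fun u => Num.max 0 (1 - g u)).
  move=> gc u; apply: (@continuous_max _ _ (fun=> 0 : R) (fun u => 1 - g u)); first exact: cst_continuous.
  by apply: (@continuousB _ R^o); [exact: cst_continuous|exact: gc].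
have prodc (I : finType) (g : I -> 'rV[R]_n -> R) :
    (forall i, continuous (g i)) -> continuous (fun u => \prod_i g i u).
  by move=> gc; apply: continuous_big => //; exact: mul_continuous.
have cB i : continuous (fun u : 'rV[R]_n => u 0 i - (k i)%:R).
  move=> v; exact: (@continuousB _ R^o _ (fun u : 'rV[R]_n => u 0 i) (fun=> (k i)%:R) v (coord i v) (@cst_continuous _ _ _ v)).
have c1 : continuous (fun u : 'rV[R]_n => \prod_i Num.max 0 (1 - `|u 0 i - (k i)%:R|)).
  apply: (prodc _ (fun i u => Num.max 0 (1 - `|u 0 i - (k i)%:R|))) => i.
  apply: maxc => v; apply: (@continuous_comp _ _ _ (fun u : 'rV[R]_n => u 0 i - (k i)%:R) Num.norm).
    exact: cB.
  exact: (@norm_continuous _ R^o).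
have c2 : continuous (fun u : 'rV[R]_n =>
    \prod_i \prod_j Num.max 0 (1 - ((u 0 i - (k i)%:R) - (u 0 j - (k j)%:R)))).
  apply: (prodc _ (fun i u => \prod_j Num.max 0 (1 - ((u 0 i - (k i)%:R) - (u 0 j - (k j)%:R))))) => i.
  apply: (prodc _ (fun j u => Num.max 0 (1 - ((u 0 i - (k i)%:R) - (u 0 j - (k j)%:R))))) => j.
  apply: (maxc (fun u => (u 0 i - (k i)%:R) - (u 0 j - (k j)%:R))) => v.
  exact: (@continuousB _ R^o _ _ _ v (cB i v) (cB j v)).
move=> u; exact: (@continuousM _ _ _ _ u (c1 u) (c2 u)).
Qed.

(** The vertex of integer parts is always active, so the supports cover the nonnegative orthant. *)
Lemma hat_truncn u : (forall i, 0 <= u 0 i) ->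
  hat (fun i => Num.truncn (u 0 i)) u != 0.
Proof.
move=> u0; apply/hat_neq0P.
have tP i : 0 <= u 0 i - (Num.truncn (u 0 i))%:R < 1.
  have /andP[] := truncn_itv (u0 i); rewrite -natr1 => ? ?.
  by apply/andP; split; lra.
split=> [i|i j]; first by have /andP[h ?] := tP i; rewrite ger0_norm.
by move: (tP i) (tP j) => /andP[? ?] /andP[? ?]; lra.
Qed.

(** If [k] were above [k'] at [i] and below it at [j], the conditions of the two bumps on opposite
    differences of coordinates would add up to a contradiction. Active vertices thus form a chain,
    as in a simplex of the triangulation. *)
Lemma hat_comparable k k' u : hat k u != 0 -> hat k' u != 0 ->
  (forall i, (k i <= k' i)%N) \/ (forall i, (k' i <= k i)%N).
Proof.
move=> /hat_neq0P[_ h] /hat_neq0P[_ h'].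
have [/forallP|/forallPn[i]] := boolP [forall i, (k i <= k' i)%N]; first by left.
rewrite -ltnNge => ik; right=> j; rewrite leqNgt; apply/negP => jk.
have := h j i; have := h' i j.
have : (k' i)%:R + 1 <= (k i)%:R :> R by rewrite natr1 ler_nat.
have : (k j)%:R + 1 <= (k' j)%:R :> R by rewrite natr1 ler_nat.
by move=> ? ? ? ?; lra.
Qed.

(* On a lattice hyperplane the triangulation has dimension [n - 1], so at most
   [n] bump functions are active at a point of it. *)
Lemma card_hat_lattice (L : nat) u (i0 : 'I_n) (m : nat) :
  (forall i, 0 <= u 0 i) -> u 0 i0 = m%:R ->
  (#|[set k : {ffun 'I_n -> 'I_L} | hat (fun i => k i) u != 0%R]%SET| <= n)%N.
Proof.
move=> u0 um; set A := [set k | _]%SET.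
pose t i := Num.truncn (u 0 i).
have kt (k : {ffun 'I_n -> 'I_L}) i : k \in A -> (t i <= k i <= (t i).+1)%N.
  rewrite inE => /hat_neq0P[/(_ i) + _]; rewrite ltr_norml => /andP[h1 h2].
  have /andP[t1 t2] := truncn_itv (u0 i).
  by apply/andP; split; rewrite -ltnS -(ltr_nat R) -?natr1; rewrite -?natr1 in t2; lra.
have k0 (k : {ffun 'I_n -> 'I_L}) : k \in A -> k i0 = t i0 :> nat.
  rewrite inE => /hat_neq0P[/(_ i0) + _]; rewrite ltr_norml um => /andP[h1 h2].
  rewrite /t um natrK; apply/eqP; rewrite eqn_leq.
  by apply/andP; split; rewrite -ltnS -(ltr_nat R) -?natr1; lra.
(* [w] counts the coordinates that are rounded up. It separates the members of a chain, and it stays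
   below [n] because the integral coordinate [i0] is never rounded. *)
pose w (k : {ffun 'I_n -> 'I_L}) := (\sum_i (k i - t i))%N.
have wlt (k : {ffun 'I_n -> 'I_L}) : k \in A -> (w k < n)%N.
  move=> kA; rewrite /w (bigD1 i0) //= (k0 _ kA) subnn add0n.
  apply: (@leq_ltn_trans (\sum_(i < n | i != i0) 1)).
    by apply: leq_sum => i _; have := kt k i kA; lia.
  by rewrite sum1_card cardC1 card_ord ltn_predL (leq_trans _ (ltn_ord i0)).
have winj : {in A &, injective w}.
  move=> k k' kA kA' wE.
  wlog le : k k' kA kA' wE / forall i, (k i <= k' i)%N.
    move=> W; have := kA; rewrite inE => h; have := kA'; rewrite inE => h'.
    by case: (hat_comparable h h') => le; [apply: W|apply/esym/W].
  apply/ffunP => i; apply/val_inj/eqP; rewrite eqn_leq le /=.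
  have le' j : (k j - t j <= k' j - t j)%N by rewrite leq_sub2r.
  move: wE; rewrite /w (bigD1 i) //= [RHS](bigD1 i) //= => wE.
  have : (\sum_(j < n | j != i) (k j - t j) <= \sum_(j < n | j != i) (k' j - t j))%N.
    by apply: leq_sum => j _.
  move: wE (kt k i kA) (kt k' i kA').
  move: (\sum_(j < n | j != i) (k j - t j))%N (\sum_(j < n | j != i) (k' j - t j))%N.
  by move: (nat_of_ord (k i)) (nat_of_ord (k' i)) (t i) => *; lia.
rewrite cardE -(size_map w) -[leqRHS](size_iota 0).
apply: uniq_leq_size.
  by rewrite map_inj_in_uniq ?enum_uniq // => k k'; rewrite !mem_enum; apply: winj.
by move=> m' /mapP[k]; rewrite mem_enum => kA ->; rewrite mem_iota add0n wlt.
Qed.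

End KuhnHat.

(** * Embeddings of compact sets, and the image of a cube *)

Section InvarianceOfDomain.
Context {R : realType}.

(** The points of [A] outside the interior of [U] form a compact set, whose closed image misses
    [f x]; the complement of this image serves as [V]. *)
Lemma compact_embedding (T Y : topologicalType) (A : set T) (f : T -> Y) :
  hausdorff_space Y -> compact A -> {within A, continuous f} ->
  {in A &, injective f} -> forall x (U : set T), A x -> nbhs x U ->
  exists2 V : set Y, nbhs (f x) V & forall z, A z -> V (f z) -> U z.
Proof.
move=> hY cA fc fi x U Ax Ux.
pose B := A `&` ~` U^°.
have cB : compact B by apply: compact_closedI => //; apply: open_closedC; apply: open_interior.
have fB : closed (f @` B).
  apply: compact_closed => //; apply: continuous_compact => //.
  by apply: continuous_subspaceW fc => y [].
exists (~` (f @` B)).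
  apply: open_nbhs_nbhs; split; first exact: closed_openC.
  by move=> [z [Az Uz] /fi]; rewrite !inE => /(_ Az Ax) zx; apply: Uz; rewrite zx.
move=> z Az fz; apply: contrapT => Uz; apply: fz; exists z => //; split=> //.
by move=> /interior_subset.
Qed.

(** Uniform continuity of the inverse, by compactness of [A], in a form that does not name the
    inverse. *)
Lemma inj_modulus n m (A : set 'rV[R]_n) (f : 'rV[R]_n -> 'rV[R]_m) :
  compact A -> {within A, continuous f} -> {in A &, injective f} ->
  forall d, 0 < d -> exists2 e, 0 < e &
    forall x y, A x -> A y -> `|f x - f y| < e -> `|x - y| < d.
Proof.
move=> cA fc fi d d0.
have [|] := (compact_near_coveringP A).1 cA R (0^'+)
  (fun e x => A x -> forall y, A y -> `|f x - f y| < e -> `|x - y| < d) _.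
  move=> x Ax.
  have d2 : 0 < d / 2 by rewrite divr_gt0.
  have hU : nbhs x [set y | `|x - y| < d / 2] by apply/nbhs_rVP; exists (d / 2).
  have [V /nbhs_rVP[e e0 eV] VU] :=
    compact_embedding (@norm_hausdorff _ 'rV[R]_m) cA fc fi Ax hU.
  have e2 : 0 < e / 2 by rewrite divr_gt0.
  have [r r0 rP] := (within_continuous_normP _ _).1 fc x Ax _ e2.
  exists ([set y | `|x - y| < Num.min r (d / 2)], [set t | t < e / 2]).
    split; first by apply/nbhs_rVP; exists (Num.min r (d / 2)); rewrite // lt_min r0.
    exact: nbhs_right_lt.
  move=> [y t] /= []; rewrite lt_min => /andP[xyr xyd] te Ay z Az fyz.
  have : `|x - z| < d / 2.
    apply: (VU z Az); apply: eV; rewrite -[f x - f z](subrKA (f y)) [ltRHS]splitr.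
    by apply: le_lt_trans (ler_normD _ _) (ltrD _ _); [apply: rP|apply: lt_trans te].
  move=> xz; rewrite -[y - z](subrKA x) [ltRHS]splitr.
  by apply: le_lt_trans (ler_normD _ _) (ltrD _ _) => //; rewrite distrC.
move=> e [/= e0 eP].
have e2 : 0 < e / 2 by rewrite divr_gt0.
exists (e / 2) => // x y Ax Ay; apply: (eP (e / 2)) => //=.
by rewrite sub0r normrN gtr0_norm // ltr_pdivrMr // ltr_pMr // ltr1n.
Qed.

Lemma rowV_sum_continuous n (I : finType) (T : topologicalType) (g : I -> T -> R)
    (w : I -> 'rV[R]_n) (y : T) :
  (forall k, {for y, continuous (g k)}) ->
  {for y, continuous (fun z => \sum_k g k z *: w k)}.
Proof.
move=> gc; elim: (index_enum I) => [|k r IHr].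
  rewrite (_ : (fun z => _) = fun=> 0); first exact: cst_continuous.
  by apply: funext => z; rewrite big_nil.
have ck : {for y, continuous (fun z => g k z *: w k)}.
  exact: (@continuousZr_tmp R 'rV[R]_n T (g k) (w k) y (gc k)).
have -> : (fun z => \sum_(j <- k :: r) g j z *: w j) =
    (fun z => g k z *: w k) + (fun z => \sum_(j <- r) g j z *: w j).
  by apply: funext => z; rewrite big_cons.
exact: (@continuousD R 'rV[R]_n T _ _ y ck IHr).
Qed.

(** This is the radial push away from [c]: points at distance at least [eps] stay, the others move
    out to distance [eps]. *)
Lemma push_continuous n (c : 'rV[R]_n) (eps : R) (y : 'rV[R]_n) : y != c ->
  {for y, continuous (fun y : 'rV[R]_n => c + Num.max 1 (eps / `|y - c|) *: (y - c))}.
Proof.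
move=> yc; pose V := 'rV[R]_n.
have cB : {for y, continuous (fun z : V => z - c)}.
  apply: (@continuousB _ V _ (fun z : V => z) (fun=> c)); first exact: cvg_id.
  exact: cst_continuous.
have cN : {for y, continuous (fun z : V => `|z - c|)}.
  by apply: (@continuous_comp _ _ _ (fun z : V => z - c) Num.norm) => //; apply: norm_continuous.
have cV : {for y, continuous (fun z : V => `|z - c|^-1)}.
  by apply: (@continuousV R V (fun z : V => `|z - c|)) => //; rewrite normr_eq0 subr_eq0.
have cM : {for y, continuous (fun z : V => Num.max 1 (eps / `|z - c|) : R^o)}.
  apply: (@continuous_max R V (fun=> 1) (fun z => eps / `|z - c|)); first exact: cst_continuous.
  by apply: (@continuousM R V (fun=> eps)) => //; apply: cst_continuous.
apply: (@continuousD _ V V (fun=> c)); first exact: cst_continuous.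
exact: (@continuousZ _ V V _ _ y cM cB).
Qed.

(* If [f @` cube] misses a point [c] close to [f 0], push the image out of a
   small cube around [c], and then apply a generic simplicial approximation of
   the inverse of [f].  The latter does not vanish on the boundary of the small
   cube for dimension reasons, nor on the rest of the image because it is close
   to the inverse of [f] there.  The composition with [f] is then a map without
   zero that stays close to the identity. *)
Lemma nbhs_image_cube n (f : 'rV[R]_n -> 'rV[R]_n) :
  {within @cube R n, continuous f} -> {in @cube R n &, injective f} ->
  nbhs (f 0) (f @` @cube R n).
Proof.
move=> fc fi; apply: contrapT => not_int.
have cube0 : @cube R n 0 by rewrite /cube /= normr0.
have ccube : compact (@cube R n) by apply: compact_norm_le.
have [e1 e10 e1P] := inj_modulus ccube fc fi (divr_gt0 ltr01 (ltr0n R 4)).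
(* A third of [e1]: a point whose image is within [eps + eps] of [c] has its image within [e1] of
   [f 0], hence norm below 1/4. *)
have [eps eps0 e1E] : exists2 eps, 0 < eps & e1 = eps + eps + eps.
  by exists (e1 / 3); [rewrite divr_gt0|lra].
have [c c0 cF] : exists2 c, `|f 0 - c| < eps & ~ (f @` @cube R n) c.
  apply: contrapT => nc; apply: not_int; apply/nbhs_rVP; exists eps => // y fy.
  by apply: contrapT => ?; apply: nc; exists y.
have [d1 d10 d1P] : exists2 d1, 0 < d1 &
    forall x, cube x -> eps <= `|f x - c| -> d1 <= `|x|.
  have e' : 0 < eps - `|f 0 - c| by rewrite subr_gt0.
  have [d d0 dP] := (within_continuous_normP _ _).1 fc 0 cube0 _ e'.
  exists d => // x cx; apply: contraTT; rewrite -!ltNge => xd.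
  have := dP x cx; rewrite sub0r normrN => /(_ xd).
  rewrite ltrBrDr; apply: le_lt_trans.
  by rewrite -[f x - c](subrKA (f 0)) (distrC (f 0) (f x)) ler_normD.
(* Errors below [d + d < d1] preserve the sign of a largest coordinate of a point away from 0, and
   [d + d <= 1 / 4] keeps all distances below 1. *)
have [d [d0 dd1 d4]] : exists d, [/\ 0 < d, d + d < d1 & d + d <= 1 / 4].
  exists (Num.min d1 1 / 8); split; first by rewrite divr_gt0 // lt_min d10 ltr01.
    by case: (leP d1 1) => ?; lra.
  by case: (leP d1 1) => ?; lra.
have [eta eta0 etaP] := inj_modulus ccube fc fi d0.
have [N N1 Neta] : exists2 N : nat, (1 < N)%N & eps / N%:R + eps / N%:R < eta.
  have e2 : 0 < eta / (eps + eps) by rewrite divr_gt0 // addr_gt0.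
  have [N hN] := ltr_add_invr e2; rewrite add0r in hN; exists N.+2 => //.
  have hN2 : N.+2%:R^-1 <= N.+1%:R^-1 :> R by rewrite lef_pV2 ?posrE // ler_nat.
  rewrite -mulrDl mulrC -ltr_pdivlMr ?addr_gt0 //; exact: le_lt_trans hN.
have N0 : 0 < N%:R :> R by rewrite ltr0n ltnW.
(* The mesh [h] divides [eps], so that the sides of the small cube of radius [eps] around [c] lie on
   lattice hyperplanes. *)
have [h [h0 epsE hE]] : exists h, [/\ 0 < h, eps = h * N%:R & h + h < eta].
  by exists (eps / N%:R); rewrite divr_gt0 // divfK // gt_eqF.
have hh : h + h <= eps.
  have N2 : 2%:R <= N%:R :> R by rewrite ler_nat.
  by rewrite epsE; have := ler_wpM2l (ltW h0) N2; lra.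
have [B BP] : exists B, forall x, cube x -> `|f x - c| <= B.
  have /compact_bounded [b [_ bP]] := continuous_compact fc ccube.
  exists (b + 1 + `|c|) => x cx; apply: le_trans (ler_normB _ _) _; rewrite lerD2r.
  by apply: (bP (b + 1)); [rewrite ltrDl|exists x].
have [M NM MB] : exists2 M, (N <= M)%N & B <= h * M%:R.
  exists (maxn N (Num.truncn (B / h)).+1); first exact: leq_maxl.
  rewrite -ler_pdivrMl // mulrC; have [B0|/ltW B0] := leP 0 (B / h); last by apply: le_trans B0 _.
  have /andP[_ /ltW h1] := truncn_itv B0; apply: le_trans h1 _.
  by rewrite ler_nat leq_maxr.
pose L := (M + M).+1; pose I := {ffun 'I_n -> 'I_L}.
have nI : (n <= #|I|)%N.
  rewrite card_ffun !card_ord ltnW // ltn_expl // ltnS addn_gt0.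
  by rewrite (leq_trans (ltnW N1) NM).
(* [U] sends [c] to the centre of the lattice box of side [M + M] and the mesh [h] to 1; by the
   choice of [M] the pushed image lands in this box. *)
pose U (y : 'rV[R]_n) : 'rV[R]_n := const_mx M%:R + h^-1 *: (y - c).
have UE y i : U y 0 i = M%:R + h^-1 * (y - c) 0 i by rewrite !mxE.
pose act (k : I) y := hat (fun i => k i) (U y) != 0.
have actP k y y' : act k y -> act k y' -> `|y - y'| < h + h.
  move=> /hat_neq0P[a1 _] /hat_neq0P[a2 _]; rewrite normr_rV_lt ?addr_gt0 //.
  apply/forallP => i; move: (a1 i) (a2 i); rewrite !mxE.
  rewrite !(mulrC h^-1).
  have -> : y 0 i - y' 0 i = h * ((y 0 i - c 0 i) / h - (y' 0 i - c 0 i) / h).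
    by rewrite -mulrBl mulrC divfK ?gt_eqF //; ring.
  rewrite normrM gtr0_norm // (_ : h + h = h * 2); last by ring.
  rewrite ltr_pM2l //.
  move: ((y 0 i - c 0 i) / h) ((y' 0 i - c 0 i) / h) => a b; rewrite !ltr_norml.
  by move=> /andP[? ?] /andP[? ?]; apply/andP; split; lra.
(* The approximate inverse at the vertex [k]: a point mapped into the star of [k], with default 0 if
   the image misses this star. *)
have /choice [xk xkP] : forall k : I, exists x, cube x /\
    ((exists2 x', cube x' & act k (f x')) -> act k (f x)) /\
    (~ (exists2 x', cube x' & act k (f x')) -> x = 0).
  move=> k; have [[x cx ax]|nx] := pselect (exists2 x', cube x' & act k (f x')).
    by exists x; split=> //; split=> // nx; case: nx; exists x.
  by exists 0.
have [w wxk wgen] := general_position xk nI d0.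
pose Phi (y : 'rV[R]_n) : 'rV[R]_n := c + Num.max 1 (eps / `|y - c|) *: (y - c).
(* The weights are not normalized, since only the signs and the zeros of [F] matter. *)
pose F x := \sum_(k : I) hat (fun i => k i) (U (Phi (f x))) *: w k.
have fxc x : cube x -> 0 < `|f x - c|.
  by move=> cx; rewrite normr_gt0 subr_eq0; apply/eqP => fxc; apply: cF; exists x.
have PhiB x : cube x -> `|Phi (f x) - c| <= h * M%:R.
  move=> cx; rewrite /Phi addrC addKr normrZ ger0_norm; last by rewrite le_max ler01.
  rewrite maxEle; case: ifP => _; last by rewrite mul1r (le_trans (BP x cx)).
  by rewrite divfK ?gt_eqF ?fxc // epsE ler_pM2l // ler_nat.
have U0 x i : cube x -> 0 <= U (Phi (f x)) 0 i <= (M + M)%:R.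
  move=> cx; have := le_trans (coord_le_norm _ i) (PhiB x cx).
  rewrite UE.
  rewrite -ler_pdivrMl // -{1}(gtr0_norm h0) -normfV -normrM natrD.
  by move: (h^-1 * _) => a; rewrite ler_norml => /andP[? ?]; apply/andP; split; lra.
have actex x : cube x -> exists k, act k (Phi (f x)).
  move=> cx; pose t i := Num.truncn (U (Phi (f x)) 0 i).
  have tL i : (t i < L)%N.
    have /andP[u0 uM] := U0 x i cx; have /andP[t1 _] := truncn_itv u0.
    by rewrite ltnS -(ler_nat R); apply: le_trans uM.
  exists [ffun i => Ordinal (tL i)].
  have := @hat_truncn R n (U (Phi (f x))) (fun i => proj1 (andP (U0 x i cx))).
  by rewrite /act; congr (hat _ _ != 0); apply: funext => i; rewrite ffunE.
have close x : cube x ->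
    (forall k, act k (Phi (f x)) -> `|x - w k| < 1) /\ F x != 0.
  move=> cx; have [big|small] := leP eps `|f x - c|.
    have PhiE : Phi (f x) = f x.
      by rewrite /Phi max_l ?ler_pdivrMr ?mul1r ?fxc // scale1r addrC subrK.
    have xw k : act k (Phi (f x)) -> `|x - w k| < d + d.
      rewrite PhiE => ax; have [cxk [axk _]] := xkP k.
      have {}axk : act k (f (xk k)) by apply: axk; exists x.
      rewrite -[x - w k](subrKA (xk k)).
      apply: le_lt_trans (ler_normD _ _) (ltr_leD _ (wxk k)).
      by apply: etaP => //; apply: lt_trans (actP _ _ _ ax axk) hE.
    split=> [k ax|]; first by apply: lt_le_trans (xw k ax) _; lra.
    have xd1 := d1P x cx big.
    have x0 : x != 0 by rewrite -normr_gt0; lra.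
    have [i xi] := norm_attained x0.
    (* In a largest coordinate of [x], every active [w k] has the sign of [x], being closer to [x]
       than the norm of [x]. *)
    suff : 0 < F x 0 i * x 0 i.
      by apply: contraTneq => ->; rewrite mxE mul0r ltxx.
    have pos k : act k (Phi (f x)) -> 0 < w k 0 i * x 0 i.
      move=> ax; have := le_lt_trans (coord_le_norm _ i) (xw k ax).
      rewrite !mxE => h1.
      have : `|x 0 i - w k 0 i| < `|x 0 i| by rewrite xi; lra.
      move: (x 0 i) (w k 0 i) => a b; clear.
      by case: (ger0P a) => ha; rewrite ltr_norml => /andP[? ?]; nra.
    rewrite /F summxE mulr_suml.
    have [k0 ak0] := actex x cx; rewrite (bigD1 k0) //= ltr_pwDl //.
      rewrite mxE -mulrA pmulr_lgt0 ?pos //.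
      by rewrite lt_def hat_ge0 andbT.
    apply: sumr_ge0 => k _; rewrite mxE -mulrA.
    have [->|ak] := eqVneq (hat (fun i => k i) (U (Phi (f x)))) 0; first by rewrite mul0r.
    by rewrite mulr_ge0 ?hat_ge0 // ltW // pos.
  have near0 x' : cube x' -> `|f x' - c| < eps + eps -> `|x'| < 1 / 4.
    move=> cx' fx'; rewrite -[x']subr0; apply: e1P => //; rewrite e1E.
    rewrite -(subrKA c); apply: le_lt_trans (ler_normD _ _) (ltrD _ _) => //.
    by rewrite distrC.
  have Phic : `|Phi (f x) - c| = eps.
    rewrite /Phi addrC addKr normrZ max_r; last by rewrite ler_pdivlMr ?mul1r ?ltW ?fxc.
    by rewrite ger0_norm ?divr_ge0 ?(ltW eps0) // divfK // gt_eqF ?fxc.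
  split=> [k ak|].
    have xk4 : `|xk k| < 1 / 4.
      have [cxk [axk xk0]] := xkP k.
      have [ex|nex] := pselect (exists2 x', cube x' & act k (f x')); last first.
        by rewrite xk0 // normr0; lra.
      apply: near0 => //; rewrite -(subrKA (Phi (f x))).
      apply: le_lt_trans (ler_normD _ _) _; rewrite Phic ltrD2r.
      by apply: lt_le_trans hh; apply: actP (axk ex) ak.
    have x4 : `|x| < 1 / 4 by apply: near0 => //; lra.
    rewrite -(subrKA (xk k)); apply: le_lt_trans (ler_normD _ _) _.
    have := ler_normB x (xk k); have := wxk k; lra.
  (* Here [Phi (f x)] lies on the boundary of the small cube, hence on a lattice hyperplane. At most
     [n] weights are nonzero, and general position makes them vanish, against the active [k0]. *)
  apply/eqP => F0.
  have [k0 ak0] := actex x cx.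
  suff : hat (fun i => k0 i) (U (Phi (f x))) = 0 by apply/eqP.
  apply: (wgen (fun k : I => hat (fun i => k i) (U (Phi (f x)))) _ F0).
  have zc0 : Phi (f x) - c != 0 by rewrite -normr_gt0 Phic.
  have [i0] := norm_attained zc0; rewrite Phic => zi0.
  have [m mE] : exists m : nat, U (Phi (f x)) 0 i0 = m%:R.
    rewrite UE; move: zi0; case: ger0P => _ zi0.
      by exists (M + N)%N; rewrite zi0 epsE mulKf ?gt_eqF // natrD.
    exists (M - N)%N; rewrite natrB // -[(Phi (f x) - c) 0 i0]opprK zi0 epsE.
    by rewrite mulrN mulKf ?gt_eqF.
  by apply: card_hat_lattice mE => i; have /andP[] := U0 x i cx.
have Fc : {within @cube R n, continuous F}.
  apply/subspace_continuousP => x cx.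
  pose G y := \sum_(k : I) hat (fun i => k i) (U (Phi y)) *: w k.
  have Gc : {for f x, continuous G}.
    apply: rowV_sum_continuous => k.
    have Pc : {for f x, continuous Phi}.
      by apply: push_continuous; rewrite -subr_eq0 -normr_eq0 gt_eqF ?fxc.
    have Uc : {for Phi (f x), continuous U}.
      apply: (@continuousD _ 'rV[R]_n 'rV[R]_n (fun=> const_mx M%:R)); first exact: cst_continuous.
      apply: (@continuousZl_tmp _ 'rV[R]_n 'rV[R]_n (fun z => z - c)).
      apply: (@continuousB _ 'rV[R]_n 'rV[R]_n (fun z => z) (fun=> c)); first exact: cvg_id.
      exact: cst_continuous.
    apply: (@continuous_comp _ _ _ Phi (hat (fun i => k i) \o U)) => //.
    by apply: continuous_comp => //; apply: hat_continuous.
  exact: (@cvg_comp _ _ _ f G _ _ _ ((subspace_continuousP _ _).1 fc x cx) Gc).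
have [] := poincare_miranda Fc.
- move=> x i cx xi; rewrite summxE; apply: sumr_le0 => k _; rewrite mxE.
  have [->|ak] := eqVneq (hat (fun i => k i) (U (Phi (f x)))) 0; first by rewrite mul0r.
  rewrite pmulr_rle0 ?lt_def ?ak ?hat_ge0 //.
  have := le_lt_trans (coord_le_norm _ i) ((close x cx).1 k ak).
  by rewrite !mxE xi ltr_norml => /andP[? ?]; lra.
- move=> x i cx xi; rewrite summxE; apply: sumr_ge0 => k _; rewrite mxE.
  have [->|ak] := eqVneq (hat (fun i => k i) (U (Phi (f x)))) 0; first by rewrite mul0r.
  rewrite pmulr_rge0 ?lt_def ?ak ?hat_ge0 //.
  have := le_lt_trans (coord_le_norm _ i) ((close x cx).1 k ak).
  by rewrite !mxE xi ltr_norml => /andP[? ?]; lra.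
- by move=> x cx /eqP; apply/negP; apply: (close x cx).2.
Qed.

End InvarianceOfDomain.

Section WithinContinuity.
Context {R : realType}.
Implicit Types T U V : topologicalType.

Lemma within_comp T U V (A : set T) (B : set U) (f : T -> U) (g : U -> V) :
  {within A, continuous f} -> {within B, continuous g} ->
  (forall x, A x -> B (f x)) -> {within A, continuous (g \o f)}.
Proof.
move=> /subspace_continuousP fc /subspace_continuousP gc AB.
apply/subspace_continuousP => x Ax W Wn.
have hg : nbhs (f x) [set y | B y -> W (g y)] := gc (f x) (AB x Ax) W Wn.
have hf : nbhs x [set y | A y -> B (f y) -> W (g (f y))] := fc x Ax _ hg.
suff : nbhs x [set y | A y -> W (g (f y))] by [].
by apply: filterS hf => y h Ay; apply: h => //; apply: AB.
Qed.

Lemma within_row T n (A : set T) (f : T -> 'rV[R]_n) :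
  (forall i, {within A, continuous (fun x => f x 0 i)}) ->
  {within A, continuous f}.
Proof.
move=> fc; apply/subspace_continuousP => x Ax W /nbhs_rVP[e e0 eW].
have : \forall y \near x, forall i, A y -> `|f x 0 i - f y 0 i| < e.
  apply: filter_forall => i; have /subspace_continuousP/(_ x Ax) := fc i.
  move=> /(@cvgrPdist_lt _ R^o)/(_ e e0); exact.
move=> h; suff : nbhs x [set y | A y -> W (f y)] by [].
apply: filterS h => y h Ay; apply: eW.
by rewrite normr_rV_lt //; apply/forallP => i; rewrite !mxE; apply: h.
Qed.

Lemma within_coord T n (A : set T) (f : T -> 'rV[R]_n) i :
  {within A, continuous f} -> {within A, continuous (fun x => f x 0 i)}.
Proof.
move=> fc; apply: (@within_comp _ _ _ A setT f (fun v : 'rV[R]_n => v 0 i)) => //.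
by apply: continuous_subspaceT; apply: coord_continuous.
Qed.

Lemma within_row_mx T n m (A : set T) (f : T -> 'rV[R]_n) (g : T -> 'rV[R]_m) :
  {within A, continuous f} -> {within A, continuous g} ->
  {within A, continuous (fun x => row_mx (f x) (g x))}.
Proof.
move=> fc gc; apply: within_row => i; case: (splitP i) => j ij.
  have -> : i = lshift m j by apply: val_inj.
  rewrite (_ : (fun x => _) = fun x => f x 0 j); first exact: within_coord.
  by apply: funext => x; rewrite row_mxEl.
have -> : i = rshift n j by apply: val_inj.
rewrite (_ : (fun x => _) = fun x => g x 0 j); first exact: within_coord.
by apply: funext => x; rewrite row_mxEr.
Qed.

Lemma within_scale T n (A : set T) (t : T -> R) (f : T -> 'rV[R]_n) :
  {within A, continuous t} -> {within A, continuous f} ->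
  {within A, continuous (fun x => t x *: f x)}.
Proof.
move=> /subspace_continuousP tc /subspace_continuousP fc.
apply/subspace_continuousP => x Ax.
exact: (@cvgZ R 'rV[R]_n _ (within A (nbhs x)) _ t f (t x) (f x) (tc x Ax) (fc x Ax)).
Qed.

Lemma within_cst T U (A : set T) (c : U) : {within A, continuous (fun=> c)}.
Proof. by apply: continuous_subspaceT => x; apply: cvg_cst. Qed.

Lemma within_id T (A : set T) : {within A, continuous (fun x : T => x)}.
Proof. by apply: continuous_subspaceT => x; apply: cvg_id. Qed.

Lemma inverse_continuous T U (A : set T) (f : T -> U) (g : U -> T) :
  hausdorff_space U -> compact A -> {within A, continuous f} ->
  {in A &, injective f} -> (forall x, A x -> g (f x) = x) ->
  {within f @` A, continuous g}.
Proof.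
move=> hU cA fc fi gf; apply/subspace_continuousP => _ [x Ax <-] W.
rewrite /from_subspace gf // => Wx; have [V Vf VW] := compact_embedding hU cA fc fi Ax Wx.
suff : nbhs (f x) [set y | (f @` A) y -> W (g y)] by [].
apply: filterS Vf => y Vy [z Az zy].
by rewrite /= -zy gf //; apply: VW => //; rewrite zy.
Qed.

End WithinContinuity.

(** * Euclidean disks and spheres *)

Section EuclideanNorm.
Context {R : realType}.

Lemma sqnorm_ge0 n (x : 'rV[R]_n) : 0 <= sqnorm x.
Proof. by apply: sumr_ge0 => i _; rewrite sqr_ge0. Qed.

Lemma sqnorm_eq0 n (x : 'rV[R]_n) : (sqnorm x == 0) = (x == 0).
Proof.
apply/idP/eqP => [|->]; last by rewrite /sqnorm big1 // => i _; rewrite mxE expr0n.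
rewrite psumr_eq0 => [/allP h|i _]; last exact: sqr_ge0.
apply/rowP => i; rewrite mxE; apply/eqP; rewrite -sqrf_eq0.
by apply: h; rewrite mem_index_enum.
Qed.

Lemma sqnormZ n (a : R) (x : 'rV[R]_n) : sqnorm (a *: x) = a ^+ 2 * sqnorm x.
Proof. by rewrite /sqnorm mulr_sumr; apply: eq_bigr => i _; rewrite mxE exprMn. Qed.

Lemma sqnorm0 n : sqnorm (0 : 'rV[R]_n) = 0.
Proof. by apply/eqP; rewrite sqnorm_eq0. Qed.

Lemma sqnorm_continuous n : continuous (@sqnorm R n).
Proof.
apply: continuous_big; first exact: (@pseudometric_normed_Zmodule.add_continuous _ R^o).
move=> i _ x; exact: (@continuous_comp _ _ _ (fun x : 'rV[R]_n => x 0 i) (fun t : R => t ^+ 2) x (@coord_continuous _ _ _ _ _ x) (@exprn_continuous _ _ _)).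
Qed.

(** Disks and spheres are Euclidean, while the norm of row vectors is the maximum norm. *)
Definition enorm n (x : 'rV[R]_n) := Num.sqrt (sqnorm x).

Lemma enorm_gt0 n (x : 'rV[R]_n) : (0 < enorm x) = (x != 0).
Proof. by rewrite sqrtr_gt0 lt_def sqnorm_ge0 andbT sqnorm_eq0. Qed.

Lemma enorm_sphere n (x : 'rV[R]_n) : unit_sphere x -> enorm x = 1.
Proof. by rewrite /enorm => ->; rewrite sqrtr1. Qed.

Lemma unit_sphere_normalize n (x : 'rV[R]_n) : x != 0 ->
  unit_sphere ((enorm x)^-1 *: x).
Proof.
move=> x0; rewrite /unit_sphere /= sqnormZ exprVn sqr_sqrtr ?sqnorm_ge0 //.
by rewrite mulVf // sqnorm_eq0.
Qed.

Lemma sphere_disk n (x : 'rV[R]_n) : unit_sphere x -> closed_disk x.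
Proof. by rewrite /unit_sphere /closed_disk /= => ->. Qed.

Lemma open_disk_disk n (x : 'rV[R]_n) : open_disk x -> closed_disk x.
Proof. exact: ltW. Qed.

Lemma disk_cases n (x : 'rV[R]_n) : closed_disk x -> open_disk x \/ unit_sphere x.
Proof.
rewrite /closed_disk /open_disk /unit_sphere /= le_eqVlt => /orP[/eqP|]; by auto.
Qed.

Lemma open_disk0 n : @open_disk R n 0.
Proof. by rewrite /open_disk /= sqnorm0 ltr01. Qed.

Lemma enorm_continuous n : continuous (@enorm n).
Proof.
move=> x; apply: (@continuous_comp _ _ _ (@sqnorm R n) Num.sqrt).
  exact: sqnorm_continuous.
exact: sqrt_continuous.
Qed.

Lemma compact_disk n : compact (@closed_disk R n).
Proof.
apply: (@subclosed_compact _ _ _ _ (@compact_norm_le R n 1)).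
  apply: (@closed_comp _ _ (@sqnorm R n) [set t : R | t <= 1]); last exact: closed_le.
  by move=> x _; apply: sqnorm_continuous.
move=> x xd; rewrite /= normr_rV_le //; apply/forallP => i.
rewrite -sqrtr_sqr -sqrtr1 ler_wsqrtr //; apply: le_trans xd.
rewrite /sqnorm (bigD1 i) //= lerDl sumr_ge0 // => j _; exact: sqr_ge0.
Qed.

Lemma open_open_disk n : open (@open_disk R n).
Proof.
apply: (@open_comp _ _ (@sqnorm R n) [set t : R | t < 1]); last exact: open_lt.
by move=> x _; apply: sqnorm_continuous.
Qed.

End EuclideanNorm.

(** * Balls embedded in a Hausdorff space *)

Section BallEmbeddings.
Context {R : realType}.

Lemma norm_row_mx_lt n m (u : 'rV[R]_n) (v : 'rV[R]_m) (r : R) : 0 < r ->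
  (`|row_mx u v| < r) = (`|u| < r) && (`|v| < r).
Proof.
move=> r0; rewrite !normr_rV_lt //; apply/forallP/andP => [h|[/forallP h1 /forallP h2] i].
  by split; apply/forallP => i; [have := h (lshift m i)|have := h (rshift n i)];
    rewrite ?row_mxEl ?row_mxEr.
by rewrite mxE; case: (fintype.split i).
Qed.

Lemma sub_row_mx n m (u u' : 'rV[R]_n) (v v' : 'rV[R]_m) :
  row_mx u v - row_mx u' v' = row_mx (u - u') (v - v').
Proof. by rewrite opp_row_mx add_row_mx. Qed.

Theorem invariance_of_domain n (f : 'rV[R]_n -> 'rV[R]_n) (U : set 'rV[R]_n) :
  open U -> {within U, continuous f} -> {in U &, injective f} ->
  forall x, U x -> nbhs (f x) (f @` U).
Proof.
move=> oU fc fi x Ux.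
have /nbhs_rVP[r r0 rU] : nbhs x U by apply: open_nbhs_nbhs.
have r2 : 0 < r / 2 by rewrite divr_gt0.
pose a (z : 'rV[R]_n) := x + (r / 2) *: z.
have aU z : cube z -> U (a z).
  move=> cz; apply: rU; rewrite /a opprD addrA subrr sub0r normrN normrZ gtr0_norm //.
  by apply: le_lt_trans (ler_piMr (ltW r2) cz) _; rewrite ltr_pdivrMr // ltr_pMr // ltr1n.
have ac : {within @cube R n, continuous a}.
  apply: continuous_subspaceT => z; apply: (@continuousD _ 'rV[R]_n 'rV[R]_n (fun=> x)).
    exact: cst_continuous.
  by apply: (@continuousZl_tmp _ 'rV[R]_n 'rV[R]_n (fun z => z)); apply: cvg_id.
have := @nbhs_image_cube R n (f \o a) (within_comp ac fc aU) _.
rewrite /= /a scaler0 addr0 => h; apply: filterS (h _).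
  by move=> _ [z cz <-]; exists (a z) => //; apply: aU.
move=> y z; rewrite !inE => cy cz /fi; rewrite !inE => /(_ (aU y cy) (aU z cz)).
by move=> /addrI/(scalerI (lt0r_neq0 r2)).
Qed.

Variable X : topologicalType.
Hypothesis hX : hausdorff_space X.

(** Continuity and injectivity suffice: the disk is compact and [X] is Hausdorff, so the map is a
    homeomorphism onto its image. *)
Definition ball_embedding k (phi : 'rV[R]_k -> X) :=
  {within @closed_disk R k, continuous phi} /\ {in @closed_disk R k &, injective phi}.

Definition ball_inv k (phi : 'rV[R]_k -> X) (x : X) : 'rV[R]_k :=
  get [set z | closed_disk z /\ phi z = x].

Lemma ball_invK k (phi : 'rV[R]_k -> X) x : (phi @` @closed_disk R k) x ->
  closed_disk (ball_inv phi x) /\ phi (ball_inv phi x) = x.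
Proof. by move=> [z zd zx]; apply: (@getPex _ [set z | closed_disk z /\ phi z = x]); exists z. Qed.

Lemma ball_invE k (phi : 'rV[R]_k -> X) z : ball_embedding phi ->
  closed_disk z -> ball_inv phi (phi z) = z.
Proof.
move=> [_ inj] zd; have [|id iE] := @ball_invK k phi (phi z); first by exists z.
by apply: inj => //; rewrite inE.
Qed.

Lemma ball_inv_continuous k (phi : 'rV[R]_k -> X) : ball_embedding phi ->
  {within phi @` @closed_disk R k, continuous (ball_inv phi)}.
Proof.
move=> hphi; have [pc pin] := hphi.
apply: inverse_continuous => //; first exact: compact_disk.
by move=> x xd; apply: ball_invE.
Qed.

Lemma within_normalize k (A : set 'rV[R]_k) : (forall x, A x -> x != 0) ->
  {within A, continuous (fun x => (enorm x)^-1 *: x)}.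
Proof.
move=> A0; apply: within_scale; last exact: within_id.
apply/subspace_continuousP => x Ax; apply: cvgV; first by rewrite gt_eqF // enorm_gt0 A0.
by have /continuous_subspaceT/subspace_continuousP/(_ x Ax) := @enorm_continuous R k; apply.
Qed.

(* The cone over a relatively open piece of the sphere is open in space, and
   the cone over its embedded image lives in dimension [m.+1]. *)
Lemma sphere_piece_in_ball k m e (phi : 'rV[R]_k -> X) (psi : 'rV[R]_m -> X) (N : set X) p q :
  k = (m + 1 + e)%N -> ball_embedding phi -> ball_embedding psi -> open N ->
  N `&` (phi @` @unit_sphere R k) `<=` psi @` @closed_disk R m ->
  unit_sphere p -> N (phi p) -> closed_disk q -> psi q = phi p ->
  e = 0%N /\ nbhs q (@closed_disk R m).
Proof.
move=> kE; move: phi p; rewrite {k}kE => phi p hphi hpsi oN sub ps Np qd qp.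
set k := (m + 1 + e)%N in phi p hphi sub ps Np qp *.
pose hat (y : 'rV[R]_k) := (enorm y)^-1 *: y.
pose D := [set y : 'rV[R]_k | y != 0 /\ N (phi (hat y))].
have hatS y : D y -> unit_sphere (hat y) by move=> [y0 _]; apply: unit_sphere_normalize.
have hatD y : D y -> closed_disk (hat y) by move=> /hatS; apply: sphere_disk.
have Dsub y : D y -> (psi @` @closed_disk R m) (phi (hat y)).
  by move=> Dy; apply: sub; split; [case: Dy|exists (hat y); [exact: hatS|]].
pose u y := ball_inv psi (phi (hat y)).
(* Polar coordinates: the direction as seen in the ball [psi], then the radius, then [e] zeros that
   fill up the dimension of the source. *)
pose f y : 'rV[R]_k := row_mx (row_mx (u y) (const_mx (enorm y) : 'rV_1)) 0.
have hatc : {within [set y : 'rV[R]_k | y != 0], continuous hat}.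
  exact: within_normalize.
have phc : {within [set y : 'rV[R]_k | y != 0], continuous (phi \o hat)}.
  apply: within_comp hatc hphi.1 _ => y y0; apply: sphere_disk.
  exact: unit_sphere_normalize.
have o0 : open [set y : 'rV[R]_k | y != 0].
  rewrite (_ : [set _ | _] = @enorm R k @^-1` [set t | 0 < t]).
    by apply: open_comp => [y _|]; [exact: enorm_continuous|exact: open_gt].
  by apply/seteqP; split=> y /=; rewrite enorm_gt0.
have oD : open D.
  have /(continuous_inP _ o0)/(_ N oN) : {in [set y : 'rV[R]_k | y != 0], continuous (phi \o hat)}.
    by rewrite -continuous_open_subspace.
  exact.
have uc : {within D, continuous u}.
  apply: (@within_comp _ _ _ _ _ (phi \o hat) (ball_inv psi)) Dsub.
    by apply: continuous_subspaceW phc => y [].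
  exact: ball_inv_continuous.
have fc : {within D, continuous f}.
  apply: within_row_mx; last exact: within_cst.
  apply: within_row_mx => //; apply: within_row => i.
  rewrite (_ : (fun x => _) = @enorm R k); last by apply: funext => y; rewrite mxE.
  by apply: continuous_subspaceT; apply: enorm_continuous.
have fi : {in D &, injective f}.
  move=> y y'; rewrite !inE => Dy Dy' /eq_row_mx[/eq_row_mx[uE nE] _].
  have {}nE : enorm y = enorm y' by have /rowP/(_ 0) := nE; rewrite !mxE.
  have [_ iK] := ball_invK (Dsub y Dy); have [_ iK'] := ball_invK (Dsub y' Dy').
  have : hat y = hat y'.
    apply: hphi.2; rewrite ?inE; [exact: hatD|exact: hatD|].
    by rewrite -iK -iK' -/(u y) -/(u y') uE.
  rewrite /hat nE => /scalerI; apply; rewrite invr_eq0 gt_eqF // enorm_gt0.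
  by case: Dy'.
have p0 : p != 0.
  by apply: contra_eq_neq ps => ->; rewrite sqnorm0 eq_sym oner_eq0.
have hatp : hat p = p by rewrite /hat enorm_sphere // invr1 scale1r.
have Dp : D p by split=> //; rewrite hatp.
have up : u p = q by rewrite /u hatp -qp ball_invE.
have /nbhs_rVP[r r0 rP] := invariance_of_domain oD fc fi Dp.
have fp : f p = row_mx (row_mx q (const_mx 1)) 0.
  by rewrite /f up enorm_sphere.
have r2 : 0 < r / 2 by rewrite divr_gt0.
have r2r : r / 2 < r by rewrite ltr_pdivrMr // ltr_pMr // ltr1n.
split.
  (* If [e] is positive, the last block vanishes on the image, which nevertheless contains a
     neighbourhood of [f p]. *)
  apply/eqP; rewrite -leqn0 leqNgt; apply/negP => e0.
  have [|y Dy] := rP (row_mx (row_mx q (const_mx 1)) (const_mx (r / 2))).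
    rewrite fp !sub_row_mx !subrr !norm_row_mx_lt // sub0r normrN !normr0 r0 /=.
    rewrite normr_rV_lt //; apply/forallP => i; rewrite mxE gtr0_norm //.
  move=> /eq_row_mx[_ /rowP/(_ (Ordinal e0))]; rewrite !mxE => /esym/eqP.
  by rewrite gt_eqF.
apply/nbhs_rVP; exists r => // z zq.
have [|y Dy] := rP (row_mx (row_mx z (const_mx 1)) 0).
  by rewrite fp !sub_row_mx !subrr !norm_row_mx_lt // !normr0 r0 zq.
move=> /eq_row_mx[/eq_row_mx[<- _] _].
by have [] := ball_invK (Dsub y Dy).
Qed.

(** The cone over the piece is a continuous injection between spaces of equal dimension, so its
    image contains a neighbourhood of the point of the sphere over [h v]; compactness of the disk
    carries this neighbourhood to [X]. *)
Lemma nbhs_sphere_of_embedding n (phi : 'rV[R]_(n + 1) -> X) (V : set 'rV[R]_n)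
    (h : 'rV[R]_n -> X) v :
  ball_embedding phi -> open V -> {within V, continuous h} -> {in V &, injective h} ->
  h @` V `<=` phi @` @unit_sphere R (n + 1) -> V v ->
  exists2 N, nbhs (h v) N & N `&` (phi @` @unit_sphere R (n + 1)) `<=` h @` V.
Proof.
move=> hphi oV hc hi hS Vv; set k := (n + 1)%N in phi hphi hS *.
have hD x : V x -> (phi @` @closed_disk R k) (h x).
  by move=> Vx; have [|p ps <-] := hS (h x); [exists x|exists p => //; apply: sphere_disk].
pose s x := ball_inv phi (h x).
have sS x : V x -> unit_sphere (s x).
  move=> Vx; have [|p ps pE] := hS (h x); first by exists x.
  by rewrite /s -pE ball_invE //; apply: sphere_disk.
have sc : {within V, continuous s}.
  by apply: within_comp hc _ hD; apply: ball_inv_continuous.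
pose last (y : 'rV[R]_k) := y 0 (rshift n ord0).
pose D := [set y : 'rV[R]_k | V (lsubmx y) /\ 0 < last y].
pose f y : 'rV[R]_k := last y *: s (lsubmx y).
have lc : continuous last by apply: coord_continuous.
have lsc : continuous (lsubmx : 'rV[R]_k -> 'rV[R]_n).
  apply/continuous_subspace_setT; apply: within_row => i.
  rewrite (_ : (fun x => _) = fun x : 'rV[R]_k => x 0 (lshift 1 i)).
    by apply: continuous_subspaceT; apply: coord_continuous.
  by apply: funext => y; rewrite mxE.
have oD : open D.
  apply: openI; first by apply: open_comp => // y _; apply: lsc.
  by apply: (@open_comp _ _ last [set t | 0 < t]) => [y _|]; [apply: lc|apply: open_gt].
have fc : {within D, continuous f}.
  apply: within_scale; first by apply: continuous_subspaceT.
  apply: (@within_comp _ _ _ D V lsubmx s) => //; last by move=> y [].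
  by apply: continuous_subspaceT.
have fE y : D y -> enorm (f y) = last y.
  move=> [Vy y0]; rewrite /enorm sqnormZ sS // mulr1 sqrtr_sqr gtr0_norm //.
have row1 (y : 'rV[R]_k) : y = row_mx (lsubmx y) (const_mx (last y)).
  rewrite -[LHS]hsubmxK; congr row_mx; apply/rowP => j.
  by rewrite !mxE (ord1 j).
have fi : {in D &, injective f}.
  move=> y y'; rewrite !inE => Dy Dy' E.
  have lE : last y = last y' by rewrite -!fE // E.
  have [[Vy y0] [Vy' _]] := (Dy, Dy').
  rewrite [y]row1 [y']row1 lE; congr row_mx; apply: hi; rewrite ?inE //.
  have [_ <-] := ball_invK (hD _ Vy); have [_ <-] := ball_invK (hD _ Vy').
  congr phi; move: E; rewrite /f lE => /scalerI; apply.
  by rewrite gt_eqF // -lE.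
have last_row (x : 'rV[R]_n) (t : R) : last (row_mx x (const_mx t)) = t.
  by rewrite /last row_mxEr mxE.
have Dv : D (row_mx v (const_mx 1)).
  by split; rewrite /= ?row_mxKl // last_row.
have nb := invariance_of_domain oD fc fi Dv.
have fv : f (row_mx v (const_mx 1)) = s v by rewrite /f last_row row_mxKl scale1r.
rewrite fv in nb.
have sd : closed_disk (s v) by apply/sphere_disk/sS.
have hv : phi (s v) = h v by have [] := ball_invK (hD v Vv).
have [N Nv NP] := compact_embedding hX (@compact_disk R k) hphi.1 hphi.2 sd nb.
exists N; first by rewrite -hv.
move=> x [Nx [z zS zx]].
have [|y Dy yz] := NP z (sphere_disk zS); first by rewrite zx.
have y1 : last y = 1 by rewrite -fE // yz enorm_sphere.
exists (lsubmx y); first by case: Dy.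
have [Vy _] := Dy; have [_ <-] := ball_invK (hD _ Vy).
by rewrite -zx -yz /f y1 scale1r.
Qed.

Lemma onem_clamp (a e : R) : `|a| < 1 -> e = a \/ e = - a -> 0 <= 1 - Num.max 0 e <= 1.
Proof.
rewrite ltr_norml => /andP[? ?] [] ->; [case: (leP 0 a)|case: (leP 0 (- a))] => ?;
  by apply/andP; split; lra.
Qed.

Lemma clamp_lt1 (a : R) : `|a| < 1 ->
  (0 <= a -> 0 <= Num.max 0 a < 1) /\ (a < 0 -> 0 < Num.max 0 (- a) < 1).
Proof.
rewrite ltr_norml => /andP[? ?]; split=> ?.
  by rewrite max_r //; apply/andP; split; lra.
by rewrite max_r; [apply/andP; split; lra|lra].
Qed.

Lemma onem_lt1 (t : R) : 0 < t < 1 -> 0 <= 1 - t < 1.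
Proof. by move=> /andP[? ?]; apply/andP; split; lra. Qed.

Lemma onem_le1 (t : R) : 0 <= t < 1 -> 0 <= 1 - t <= 1.
Proof. by move=> /andP[? ?]; apply/andP; split; lra. Qed.

(* The collars of [gam] in the two balls fit together into an embedding of an
   open set of dimension [j + 1], which is open in the sphere. *)
Lemma nbhs_sphere_of_two_balls j (phi : 'rV[R]_(j + 1 + 1) -> X)
    (psi1 psi2 : 'rV[R]_(j + 1) -> X) (gam : 'rV[R]_j -> X) :
  ball_embedding phi -> ball_embedding psi1 -> ball_embedding psi2 -> ball_embedding gam ->
  psi1 @` @closed_disk R (j + 1) `<=` phi @` @unit_sphere R (j + 1 + 1) ->
  psi2 @` @closed_disk R (j + 1) `<=` phi @` @unit_sphere R (j + 1 + 1) ->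
  gam @` @open_disk R j `<=` psi1 @` @unit_sphere R (j + 1) ->
  gam @` @open_disk R j `<=` psi2 @` @unit_sphere R (j + 1) ->
  (psi1 @` @open_disk R (j + 1)) `&` (psi2 @` @open_disk R (j + 1)) = set0 ->
  exists2 N, nbhs (gam 0) N & N `&` (phi @` @unit_sphere R (j + 1 + 1)) `<=`
    (psi1 @` @closed_disk R (j + 1)) `|` (psi2 @` @closed_disk R (j + 1)).
Proof.
move=> hphi h1 h2 hgam S1 S2 B1 B2 disj.
set n := (j + 1)%N in phi hphi psi1 h1 psi2 h2 S1 S2 B1 B2 disj *.
pose tt (y : 'rV[R]_n) := y 0 (rshift j ord0).
pose V := [set y : 'rV[R]_n | open_disk (lsubmx y) /\ `|tt y| < 1].
pose rim (psi : 'rV[R]_n -> X) (y : 'rV[R]_n) := ball_inv psi (gam (lsubmx y)).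
pose m1 y := psi1 ((1 - Num.max 0 (tt y)) *: rim psi1 y).
pose m2 y := psi2 ((1 - Num.max 0 (- tt y)) *: rim psi2 y).
(* The last coordinate [tt y] is a signed depth: its sign selects the ball, and its absolute value
   tells how far to move inwards from the rim point over [lsubmx y]. *)
pose h y := if 0 <= tt y then m1 y else m2 y.
have rimP psi y : ball_embedding psi -> gam @` @open_disk R j `<=` psi @` @unit_sphere R n ->
    V y -> unit_sphere (rim psi y) /\ psi (rim psi y) = gam (lsubmx y).
  move=> hpsi sub [Vy _]; have [|z zS zE] := sub (gam (lsubmx y)); first by exists (lsubmx y).
  rewrite /rim -zE ball_invE //; exact: sphere_disk.
have tc : continuous tt by apply: coord_continuous.
have lsc : continuous (lsubmx : 'rV[R]_n -> 'rV[R]_j).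
  apply/continuous_subspace_setT; apply: within_row => i.
  rewrite (_ : (fun x => _) = fun x : 'rV[R]_n => x 0 (lshift 1 i)).
    by apply: continuous_subspaceT; apply: coord_continuous.
  by apply: funext => y; rewrite mxE.
have oV : open V.
  apply: openI; first by apply: open_comp => [y _|]; [apply: lsc|apply: open_open_disk].
  apply: (@open_comp _ _ (Num.norm \o tt) [set t : R | t < 1]); last exact: open_lt.
  by move=> y _; apply: continuous_comp; [apply: tc|apply: (@norm_continuous _ R^o)].
have scale_disk (psi : 'rV[R]_n -> X) y a : unit_sphere (rim psi y) -> 0 <= a <= 1 ->
    closed_disk (a *: rim psi y).
  move=> yS /andP[a0 a1]; rewrite /closed_disk /= sqnormZ yS mulr1 expr_le1 //.
have scale_open (psi : 'rV[R]_n -> X) y a : unit_sphere (rim psi y) -> 0 <= a < 1 ->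
    open_disk (a *: rim psi y).
  move=> yS /andP[a0 a1]; rewrite /open_disk /= sqnormZ yS mulr1 expr_lt1 //.
have maxP y (e : R) : V y -> e = tt y \/ e = - tt y -> 0 <= 1 - Num.max 0 e <= 1.
  by move=> [_ ?]; apply: onem_clamp.
have mc psi (sg : R -> R) : ball_embedding psi -> continuous sg ->
    (forall y, V y -> sg (tt y) = tt y \/ sg (tt y) = - tt y) ->
    gam @` @open_disk R j `<=` psi @` @unit_sphere R n ->
    {within V, continuous (fun y => psi ((1 - Num.max 0 (sg (tt y))) *: rim psi y))}.
  move=> hpsi sgc sgE sub.
  apply: (@within_comp _ _ _ V (@closed_disk R n)
    (fun y => (1 - Num.max 0 (sg (tt y))) *: rim psi y) psi).
  - apply: within_scale.
      apply: continuous_subspaceT => y.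
      apply: (@continuousB _ R^o _ (fun=> 1) (fun y => Num.max 0 (sg (tt y)))); first exact: cst_continuous.
      apply: (@continuous_max _ _ (fun=> 0) (sg \o tt)); first exact: cst_continuous.
      by apply: continuous_comp; [apply: tc|apply: sgc].
    apply: (@within_comp _ _ _ V (@open_disk R j) lsubmx (fun w => ball_inv psi (gam w))).
    + by apply: continuous_subspaceT.
    + apply: (@within_comp _ _ _ _ (psi @` @closed_disk R n) gam).
      * by apply: continuous_subspaceW hgam.1 => z; apply: open_disk_disk.
      * exact: ball_inv_continuous.
      * move=> w wd; have [|z zS <-] := sub (gam w); first by exists w.
        by exists z => //; apply: sphere_disk.
    + by move=> y [].
  - exact: hpsi.1.
  - move=> y Vy; apply: scale_disk; first exact: (rimP psi y hpsi sub Vy).1.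
    exact: maxP (sgE y Vy).
have c1 : {within V, continuous m1}.
  by apply: (mc psi1 id) => //; [by move=> ?; apply: cvg_id|left].
have c2 : {within V, continuous m2}.
  by apply: (mc psi2 -%R) => //; [exact: (@pseudometric_normed_Zmodule.opp_continuous _ R^o)|right].
have m12 y : V y -> tt y = 0 -> m1 y = m2 y.
  move=> Vy y0; rewrite /m1 /m2 y0 oppr0 max_l // subr0 !scale1r.
  by rewrite (rimP psi1 y h1 B1 Vy).2 (rimP psi2 y h2 B2 Vy).2.
have hc : {within V, continuous h}.
  apply/subspace_continuousP => y Vy W Wy.
  suff : nbhs y [set z | V z -> W (h z)] by [].
  have n1 : m1 y = h y -> nbhs y [set z | V z -> W (m1 z)].
    move=> E; have /subspace_continuousP/(_ y Vy W) := c1.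
    by rewrite /from_subspace E => /(_ Wy).
  have n2 : m2 y = h y -> nbhs y [set z | V z -> W (m2 z)].
    move=> E; have /subspace_continuousP/(_ y Vy W) := c2.
    by rewrite /from_subspace E => /(_ Wy).
  have [ylt|ygt|y0] := ltgtP 0 (tt y).
  - have : nbhs y [set z | 0 < tt z] by apply: (tc y [set t : R | 0 < t]); apply: open_nbhs_nbhs; split; [exact: open_gt|].
    have := n1 _; rewrite {1}/h (ltW ylt) => /(_ erefl); apply: filterS2 => z /= hz z0 Vz.
    by rewrite /h (ltW z0); apply: hz.
  - have : nbhs y [set z | tt z < 0] by apply: (tc y [set t : R | t < 0]); apply: open_nbhs_nbhs; split; [exact: open_lt|].
    have := n2 _; rewrite {1}/h leNgt ygt => /(_ erefl); apply: filterS2 => z /= hz z0 Vz.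
    by rewrite /h leNgt z0; apply: hz.
  - have E1 : m1 y = h y by rewrite /h -y0 lexx.
    have E2 : m2 y = h y by rewrite -E1 m12.
    apply: filterS2 (n1 E1) (n2 E2) => z /= W1 W2 Vz.
    by rewrite /h; case: ifP => _; [apply: W1|apply: W2].
have hS : h @` V `<=` phi @` @unit_sphere R (n + 1).
  move=> _ [y Vy <-]; rewrite /h; case: ifP => _; [apply: S1|apply: S2];
    (eexists; last by []); apply: scale_disk.
  - exact: (rimP psi1 y h1 B1 Vy).1.
  - by apply: (maxP y _ Vy); left.
  - exact: (rimP psi2 y h2 B2 Vy).1.
  - by apply: (maxP y _ Vy); right.
have injm psi (t t' : R) y y' : ball_embedding psi -> gam @` @open_disk R j `<=` psi @` @unit_sphere R n ->
    V y -> V y' -> 0 <= t < 1 -> 0 <= t' < 1 ->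
    psi ((1 - t) *: rim psi y) = psi ((1 - t') *: rim psi y') -> t = t' /\ lsubmx y = lsubmx y'.
  move=> hpsi sub Vy Vy' tP t'P E.
  have [t1 t1'] : 0 < 1 - t /\ 0 < 1 - t'.
    by rewrite !subr_gt0; case/andP: tP => _ ->; case/andP: t'P.
  have [yS yE] := rimP psi y hpsi sub Vy; have [yS' yE'] := rimP psi y' hpsi sub Vy'.
  have {}E : (1 - t) *: rim psi y = (1 - t') *: rim psi y'.
    by apply: hpsi.2 E; rewrite inE; apply: scale_disk => //; apply: onem_le1.
  have tE : t = t'.
    have := congr1 (@enorm R n) E; rewrite /enorm !sqnormZ yS yS' !mulr1 !sqrtr_sqr.
    by rewrite !gtr0_norm // => /addrI/oppr_inj.
  split=> //; move: E; rewrite tE => /scalerI E.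
  apply: hgam.2; rewrite ?inE; [by apply: open_disk_disk; case: Vy|by apply: open_disk_disk; case: Vy'|].
  by rewrite -yE -yE' E // gt_eqF.
have row1 (y : 'rV[R]_n) : y = row_mx (lsubmx y) (const_mx (tt y)).
  rewrite -[LHS]hsubmxK; congr row_mx; apply/rowP => i.
  by rewrite !mxE (ord1 i).
have side y : V y -> (0 <= tt y -> 0 <= Num.max 0 (tt y) < 1) /\
    (tt y < 0 -> 0 < Num.max 0 (- tt y) < 1).
  by move=> [_ ?]; apply: clamp_lt1.
(* Positive depth in both balls would give a common point of the disjoint open balls. A point of
   depth 0 also lies on the rim of the second ball, where depths are compared directly. *)
have cross y y' : V y -> V y' -> 0 <= tt y -> tt y' < 0 -> m1 y = m2 y' -> False.
  move=> Vy Vy' ty ty' E.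
  have /andP[a0 a1] := (side y Vy).1 ty; have /andP[b0 b1] := (side y' Vy').2 ty'.
  have [yS yE] := rimP psi1 y h1 B1 Vy; have [yS' yE'] := rimP psi2 y' h2 B2 Vy'.
  have [t0|t0] := eqVneq (tt y) 0.
    move: E; rewrite m12 // => /(injm psi2 _ _ _ _ h2 B2 Vy Vy').
    rewrite t0 oppr0 max_l // lexx ltr01 => /(_ isT).
    by rewrite (ltW b0) b1 => /(_ isT)[bE _]; rewrite -bE ltxx in b0.
  have tp : 0 < Num.max 0 (tt y) by rewrite max_r // lt_def t0.
  suff : ((psi1 @` @open_disk R n) `&` (psi2 @` @open_disk R n)) (m1 y) by rewrite disj.
  split; first by eexists; last by []; apply: scale_open => //; apply: onem_lt1; rewrite tp.
  by rewrite E; eexists; last by []; apply: scale_open => //; apply: onem_lt1; rewrite b0.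
have hi : {in V &, injective h}.
  move=> y y'; rewrite !inE => Vy Vy'; rewrite /h.
  case: (leP 0 (tt y)) => ty; case: (leP 0 (tt y')) => ty' E.
  - have [tE lE] := injm psi1 _ _ _ _ h1 B1 Vy Vy' ((side y Vy).1 ty) ((side y' Vy').1 ty') E.
    by rewrite [y]row1 [y']row1 lE; move: tE; rewrite !max_r // => ->.
  - by case: (cross y y').
  - by case: (cross y' y).
  - have /andP[a0 a1] := (side y Vy).2 ty; have /andP[b0 b1] := (side y' Vy').2 ty'.
    have [||tE lE] := injm psi2 _ _ _ _ h2 B2 Vy Vy' _ _ E; first by rewrite ltW.
      by rewrite ltW.
    rewrite [y]row1 [y']row1 lE; move: tE.
    by rewrite !max_r ?oppr_ge0 1?ltW // => /oppr_inj ->.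
have V0 : V 0.
  by split; rewrite /= ?linear0 /tt ?mxE ?normr0 //; apply: open_disk0.
have [N N0 NP] := nbhs_sphere_of_embedding hphi oV hc hi hS V0.
exists N.
  move: N0; rewrite /h /tt mxE lexx /m1 /tt mxE max_l // subr0 scale1r.
  by rewrite (rimP psi1 0 h1 B1 V0).2 linear0.
move=> x /NP[y Vy <-]; rewrite /h; case: ifP => _; [left|right];
  (eexists; last by []); apply: scale_disk.
- exact: (rimP psi1 y h1 B1 Vy).1.
- by apply: (maxP y _ Vy); left.
- exact: (rimP psi2 y h2 B2 Vy).1.
- by apply: (maxP y _ Vy); right.
Qed.

End BallEmbeddings.

(** * Faces of strongly regular complexes *)

Section CellPoset.
Context {R : realType} {X : topologicalType} (K : cw_complex R X).
Hypothesis sreg : strongly_regular K.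
Implicit Types i j h F G H : cell K.

Let hX : hausdorff_space X := @cw_hausdorff R X K.

Definition open_cell i : set X := char_map i @` @open_disk R (cell_dim i).

Definition carrier (x : X) : cell K := sval (cid (@open_cells_partition R X K x)).

Lemma carrierP x : open_cell (carrier x) x.
Proof. by rewrite /carrier; case: cid => i []. Qed.

Lemma carrierE x i : open_cell i x -> carrier x = i.
Proof. by rewrite /carrier; case: cid => j [jx juniq] /juniq. Qed.

Definition cell_le i j := face i `<=` face j.

Lemma open_cell_face i : open_cell i `<=` face i.
Proof. by move=> x [z zd <-]; exists z => //; apply: open_disk_disk. Qed.

Lemma face_cases i x : face i x -> carrier x = i \/ (cell_dim (carrier x) < cell_dim i)%N.
Proof.
move=> [z zd <-]; have [zo|zs] := disk_cases zd.
  by left; apply: carrierE; exists z.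
right; have [|j ji jz] := @char_map_sphere R X K i (char_map i z); first by exists z.
by rewrite (carrierE jz).
Qed.

Lemma carrier_center i : carrier (char_map i 0) = i.
Proof. by apply: carrierE; exists 0 => //; apply: open_disk0. Qed.

Lemma face_center i : face i (char_map i 0).
Proof. by apply: open_cell_face; exists 0 => //; apply: open_disk0. Qed.

Lemma cell_le_dim i j : cell_le i j -> i = j \/ (cell_dim i < cell_dim j)%N.
Proof. by move=> /(_ _ (face_center i))/face_cases; rewrite carrier_center. Qed.

Lemma cell_le_anti i j : cell_le i j -> cell_le j i -> i = j.
Proof.
move=> /cell_le_dim[//|ij] /cell_le_dim[//|ji].
by have := ltn_trans ij ji; rewrite ltnn.
Qed.

Lemma cell_le_refl i : cell_le i i.
Proof. by []. Qed.

Lemma cell_le_trans i j h : cell_le i j -> cell_le j h -> cell_le i h.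
Proof. by move=> ij jh x /ij /jh. Qed.

Lemma cell_meet i j x : face i x -> face j x ->
  exists h, face h = face i `&` face j.
Proof.
move=> ix jx; have [E|[h _ hE]] := sreg.2 i j; last by exists h.
by have : set0 x by rewrite -E.
Qed.

(** The intersection of [face i] with the face of the carrier of [x] is a face through [x]. It is
    the whole carrier, since proper faces of the carrier miss its open cell. So closed cells are
    unions of open cells. *)
Lemma faceE i x : face i x <-> cell_le (carrier x) i.
Proof.
split=> [ix|ci]; last exact/ci/open_cell_face/carrierP.
have cx : face (carrier x) x by apply/open_cell_face/carrierP.
have [h hE] := cell_meet ix cx.
have hx : face h x by rewrite hE.
have hc : cell_le h (carrier x) by rewrite /cell_le hE => y [].
have [->|lt] := face_cases hx; first by rewrite /cell_le hE => y [].
have [hc'|lt'] := cell_le_dim hc; first by rewrite -hc' ltnn in lt.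
by have := ltn_trans lt lt'; rewrite ltnn.
Qed.

(** Interior points are separated by the cell structure, boundary points by regularity, and one of
    each kind by the dimensions of their carriers. *)
Lemma cell_embedding i : ball_embedding (char_map i).
Proof.
split; first exact: char_map_continuous.
have mixed (x y : 'rV[R]_(cell_dim i)) : open_disk x -> unit_sphere y ->
    char_map i x <> char_map i y.
  move=> xo ys E; have [|j ji jy] := @char_map_sphere R X K i (char_map i y).
    by exists y.
  have := carrierE jy; rewrite -E (@carrierE _ i); last by exists x.
  by move=> ij; rewrite /= -ij ltnn in ji.
move=> x y; rewrite !inE => /disk_cases[xo|xs] /disk_cases[yo|ys] E.
- by apply: (@char_map_inj R X K i) => //; rewrite inE.
- by case: (mixed x y).
- by case: (mixed y x).
- have [_ [g _ gK]] := sreg.1 i.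
  by rewrite -(gK x) ?inE // E gK ?inE.
Qed.

Lemma sphere_imageE i x : (char_map i @` @unit_sphere R (cell_dim i)) x <->
  cell_le (carrier x) i /\ carrier x <> i.
Proof.
split=> [[z zs zx]|[/faceE[z /disk_cases[zo|zs] zx] ci]].
- split; first by apply/faceE; exists z => //; apply: sphere_disk.
  have [|j ji jx] := @char_map_sphere R X K i x; first by exists z.
  by rewrite (carrierE jx) => ij; rewrite /= ij ltnn in ji.
- by case: ci; apply: carrierE; exists z.
- by exists z.
Qed.

Lemma closed_face i : closed (face i).
Proof.
apply: compact_closed => //; apply: continuous_compact; first exact: char_map_continuous.
exact: compact_disk.
Qed.

(** The complement is the union of the finitely many closed faces that are not above [G]. *)
Lemma open_star G : open [set x | cell_le G (carrier x)].
Proof.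
rewrite (_ : [set _ | _] = ~` \bigcup_(h in [set h | ~ cell_le G h]) face h).
  by apply/closed_openC/closed_bigcup => [|h _]; [exact: finite_finset|exact: closed_face].
apply/seteqP; split=> x.
  by move=> /= Gx [h /= Gh /faceE xh]; apply: Gh; apply: cell_le_trans xh.
move=> h; apply: contrapT => /= Gx; apply: h; exists (carrier x) => //.
by apply/faceE; apply: cell_le_refl.
Qed.

(** Take [H] of maximal dimension among the proper faces of [F] above [G]. In the star of [H], the
    boundary sphere of [F] then consists of points of [H], and a piece of a sphere fits into a ball
    only in codimension one. *)
Lemma cell_le_lower_facet G F : cell_le G F -> G <> F ->
  exists H, [/\ cell_le G H, cell_le H F & (cell_dim H).+1 = cell_dim F].
Proof.
move=> GF nGF.
pose P := [pred h | `[< cell_le G h >] && `[< cell_le h F >] && (h != F)].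
have PG : P G.
  by apply/andP; split; [apply/andP; split; apply/asboolP|apply/eqP].
case: (@arg_maxnP _ G P (@cell_dim R X K) PG) => H /andP[/andP[/asboolP GH /asboolP HF] /eqP nHF] Hmax.
exists H; split=> //.
have [//|HFlt] := cell_le_dim HF.
have [e dE] : exists e, cell_dim F = (cell_dim H + 1 + e)%N.
  by exists (cell_dim F - cell_dim H - 1)%N; lia.
have [|p ps px] := (sphere_imageE F (char_map H 0)).2.
  by rewrite carrier_center.
have [||||e0 _] := @sphere_piece_in_ball R X hX _ _ _ (char_map F) (char_map H)
    [set x | cell_le H (carrier x)] p 0 dE (cell_embedding F) (cell_embedding H)
    (open_star H) _ ps.
- move=> x [/= Hx /sphere_imageE[xF nxF]].
  suff : face H x by [].
  apply/faceE; have [<-|lt] := cell_le_dim Hx; first exact: cell_le_refl.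
  suff /Hmax : P (carrier x) by rewrite /geq /= leqNgt lt.
  apply/andP; split; last exact/eqP.
  by apply/andP; split; apply/asboolP => //; apply: cell_le_trans Hx.
- by rewrite px /= carrier_center; apply: cell_le_refl.
- by rewrite /closed_disk /= sqnorm0 ler01.
- by rewrite px.
by rewrite dE e0; lia.
Qed.

Lemma cell_dim_between G H F : cell_dim F = (cell_dim G).+2 ->
  cell_le G H -> cell_le H F -> H <> G -> H <> F -> cell_dim H = (cell_dim G).+1.
Proof.
by move=> dF /cell_le_dim[->//|gh] /cell_le_dim[//|hf] _ _; lia.
Qed.

Lemma sphere_not_interior n (q : 'rV[R]_n) : unit_sphere q -> ~ nbhs q (@closed_disk R n).
Proof.
move=> qs /nbhs_rVP[r r0 rP].
have q0 : q != 0 by apply: contra_eq_neq qs => ->; rewrite sqnorm0 eq_sym oner_eq0.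
pose e := r / 2 / `|q|; have nq : 0 < `|q| by rewrite normr_gt0.
have e0 : 0 < e by rewrite !divr_gt0.
have := rP ((1 + e) *: q); rewrite -{1}[q]scale1r -scalerBl opprD addrA subrr sub0r.
rewrite normrZ normrN gtr0_norm // /e divfK ?gt_eqF //.
rewrite ltr_pdivrMr // ltr_pMr // ltr1n => /(_ isT).
rewrite /closed_disk /= sqnormZ qs mulr1 -/e; nra.
Qed.

Lemma two_balls_cover G H1 H2 F : cell_dim F = (cell_dim G).+2 ->
  cell_dim H1 = (cell_dim G).+1 -> cell_dim H2 = (cell_dim G).+1 ->
  cell_le G H1 -> cell_le G H2 -> cell_le H1 F -> cell_le H2 F -> H1 <> H2 ->
  exists2 N, nbhs (char_map G 0) N &
    N `&` (char_map F @` @unit_sphere R (cell_dim F)) `<=` face H1 `|` face H2.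
Proof.
move=> dF d1 d2 G1 G2 F1 F2 n12.
have sph H : cell_le H F -> (cell_dim H < cell_dim F)%N ->
    face H `<=` char_map F @` @unit_sphere R (cell_dim F).
  move=> HF lt x /faceE xH; apply/sphere_imageE; split; first exact: cell_le_trans HF.
  by move=> E; have := cell_le_dim xH; rewrite E => -[FH|]; [rewrite FH ltnn in lt|lia].
have rim H : cell_le G H -> (cell_dim G < cell_dim H)%N ->
    open_cell G `<=` char_map H @` @unit_sphere R (cell_dim H).
  move=> GH lt x /carrierE xG; apply/sphere_imageE; rewrite xG; split=> // E.
  by rewrite E ltnn in lt.
have disj : open_cell H1 `&` open_cell H2 = set0.
  by apply/seteqP; split=> // x [/carrierE x1 /carrierE x2]; case: n12; rewrite -x1 -x2.
have [[lt1F lt2F] [ltG1 ltG2]] : ((cell_dim H1 < cell_dim F)%N /\ (cell_dim H2 < cell_dim F)%N) /\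
    ((cell_dim G < cell_dim H1)%N /\ (cell_dim G < cell_dim H2)%N).
  by rewrite dF d1 d2 !ltnS !leqnn.
have S1 := sph H1 F1 lt1F; have S2 := sph H2 F2 lt2F.
have B1 := rim H1 G1 ltG1; have B2 := rim H2 G2 ltG2.
(* The dimensions occur in the types of the maps, so the maps are generalized before the dimensions
   are rewritten. *)
move: S1 S2 B1 B2 disj (cell_embedding F) (cell_embedding H1) (cell_embedding H2)
  (cell_embedding G).
rewrite /face /open_cell.
move: (char_map F) (char_map H1) (char_map H2) (char_map G).
have [eF e1 e2] : [/\ cell_dim F = cell_dim G + 1 + 1, cell_dim H1 = cell_dim G + 1
  & cell_dim H2 = cell_dim G + 1]%N by split; lia.
rewrite eF e1 e2 => phi psi1 psi2 gam S1 S2 B1 B2 disj hF h1 h2 hG.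
exact: nbhs_sphere_of_two_balls.
Qed.

Lemma cell_diamond G F : cell_le G F -> cell_dim F = (cell_dim G).+2 ->
  exists H1 H2, [/\ H1 <> H2, cell_le G H1 /\ cell_le H1 F, cell_le G H2 /\ cell_le H2 F,
    cell_dim H1 = (cell_dim G).+1 /\ cell_dim H2 = (cell_dim G).+1 &
    forall H, cell_le G H -> cell_le H F -> H <> G -> H <> F -> H = H1 \/ H = H2].
Proof.
move=> GF dF.
have nGF : G <> F by move=> E; move: dF; rewrite E; lia.
have [H1 [G1 F1 d1]] := cell_le_lower_facet GF nGF.
have {}d1 : cell_dim H1 = (cell_dim G).+1 by lia.
have [H2 [G2 F2 n2G n2F n12]] : exists H2, [/\ cell_le G H2, cell_le H2 F,
    H2 <> G, H2 <> F & H1 <> H2].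
  (* If [H1] were alone, the boundary sphere of [F] in the star of [G] would lie in [H1], and [q], a
     boundary point of the disk of [H1], would be interior to this disk. *)
  apply: contrapT => nex.
  have [|q qs qx] := (sphere_imageE H1 (char_map G 0)).2.
    by rewrite carrier_center; split=> // E; move: d1; rewrite E; lia.
  have [|p ps px] := (sphere_imageE F (char_map G 0)).2.
    by rewrite carrier_center.
  have dE : cell_dim F = (cell_dim H1 + 1 + 0)%N by lia.
  have [||||_] := @sphere_piece_in_ball R X hX _ _ _ (char_map F) (char_map H1)
    [set x | cell_le G (carrier x)] p q dE (cell_embedding F) (cell_embedding H1)
    (open_star G) _ ps.
  - move=> x [/= Gx /sphere_imageE[xF nxF]].
    suff : face H1 x by [].
    apply/faceE; apply: contrapT => nx1; apply: nex; exists (carrier x); split=> //.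
      by move=> E; apply: nx1; rewrite E.
    by move=> E; apply: nx1; rewrite -E; apply: cell_le_refl.
  - by rewrite px /= carrier_center; apply: cell_le_refl.
  - exact: sphere_disk.
  - by rewrite qx px.
  exact: sphere_not_interior.
have d2 := cell_dim_between dF G2 F2 n2G n2F.
exists H1, H2; split=> // H GH HF nHG nHF.
have dH := cell_dim_between dF GH HF nHG nHF.
apply: contrapT => nH.
have [N Nx NP] := two_balls_cover dF d1 d2 G1 G2 F1 F2 n12.
have [|z zs zx] := (sphere_imageE H (char_map G 0)).2.
  by rewrite carrier_center; split=> // E; apply: nHG.
(* Moving [z] slightly towards the centre of its disk enters the open cell of [H] without leaving
   [N]. *)
have : exists2 y, N y & carrier y = H.
  have := @char_map_continuous R X K H.
  move=> /subspace_continuousP/(_ z (sphere_disk zs) N).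
  rewrite /from_subspace zx => /(_ Nx) hN.
  have /nbhs_rVP[r r0 rP] : nbhs z [set w | closed_disk w -> N (char_map H w)] by [].
  have z0 : z != 0 by apply: contra_eq_neq zs => ->; rewrite sqnorm0 eq_sym oner_eq0.
  have nz : 0 < `|z| by rewrite normr_gt0.
  have [e e0 [e1 er]] : exists2 e, 0 < e & e < 1 /\ e * `|z| < r.
    exists (Num.min (1 / 2) (r / 2 / `|z|)).
      by rewrite lt_min !divr_gt0.
    split; first by rewrite gt_min; apply/orP; left; lra.
    apply: (@le_lt_trans _ _ (r / 2 / `|z| * `|z|)).
      by rewrite ler_pM2r // ge_min lexx orbT.
    by rewrite divfK ?gt_eqF // ltr_pdivrMr // ltr_pMr // ltr1n.
  have zo : open_disk ((1 - e) *: z).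
    by rewrite /open_disk /= sqnormZ zs mulr1; nra.
  exists (char_map H ((1 - e) *: z)); last by apply: carrierE; exists ((1 - e) *: z).
  apply: rP; last exact: open_disk_disk.
  by rewrite -{1}[z]scale1r -scalerBl opprB addrC subrK normrZ gtr0_norm.
move=> [y Ny yH].
have [|/faceE|/faceE] := NP y; first by split=> //; apply/sphere_imageE; rewrite yH.
- by rewrite yH => /cell_le_dim[E|]; [apply: nH; left|lia].
- by rewrite yH => /cell_le_dim[E|]; [apply: nH; right|lia].
Qed.

Lemma cell_has_boundary F : (0 < cell_dim F)%N -> exists2 G, cell_le G F & G <> F.
Proof.
move=> dF; pose p : 'rV[R]_(cell_dim F) := delta_mx 0 (Ordinal dF).
have ps : unit_sphere p.
  rewrite /unit_sphere /= /sqnorm (bigD1 (Ordinal dF)) //= big1 => [|i /negPf iF].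
    by rewrite mxE !eqxx expr1n addr0.
  by rewrite mxE iF andbF expr0n.
have [|? ?] := (sphere_imageE F (char_map F p)).1; first by exists p.
by exists (carrier (char_map F p)).
Qed.

(** The unit sphere of the line is [{p, -p}]. This is the diamond property with the empty face at
    the bottom. *)
Lemma cell_edge F : cell_dim F = 1%N ->
  exists v1 v2, [/\ v1 <> v2, cell_le v1 F /\ v1 <> F, cell_le v2 F /\ v2 <> F &
    forall v, cell_le v F -> v <> F -> v = v1 \/ v = v2].
Proof.
move=> dF; pose p : 'rV[R]_(cell_dim F) := const_mx 1.
have sph (z : 'rV[R]_(cell_dim F)) : unit_sphere z <-> z = p \/ z = - p.
  move: z @p; rewrite dF => z; rewrite /unit_sphere /= /sqnorm big_ord1.
  split=> [/eqP|[->|->]]; rewrite ?mxE ?sqrrN ?expr1n //.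
  rewrite sqrf_eq1 => /orP[]/eqP zE; [left|right]; apply/rowP => i;
    by rewrite (ord1 i) zE !mxE.
have pS : unit_sphere p by apply/sph; left.
have mS : unit_sphere (- p) by apply/sph; right.
have b1 : cell_le (carrier (char_map F p)) F /\ carrier (char_map F p) <> F.
  by apply/sphere_imageE; exists p.
have b2 : cell_le (carrier (char_map F (- p))) F /\ carrier (char_map F (- p)) <> F.
  by apply/sphere_imageE; exists (- p).
have point v (a b : 'rV[R]_(cell_dim v)) : cell_le v F -> v <> F -> a = b.
  move=> /cell_le_dim[//|lt] _; have d0 : cell_dim v = 0%N by lia.
  by apply/rowP => i; have := ltn_ord i; rewrite {2}d0.
exists (carrier (char_map F p)), (carrier (char_map F (- p))); split=> //.
  move=> E; have [a ao aE] := carrierP (char_map F p).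
  have := carrierP (char_map F (- p)); rewrite -E => -[b bo bE].
  have : p = - p.
    apply: (cell_embedding F).2; rewrite ?inE; [exact: sphere_disk..|].
    by rewrite -aE -bE (point _ a b b1.1 b1.2).
  move=> /rowP/(_ (cast_ord (esym dF) ord0)); rewrite !mxE => /eqP.
  by rewrite -subr_eq0 opprK gt_eqF // addr_gt0.
move=> v vF nvF.
have [|z /sph zE zv] := (sphere_imageE F (char_map v 0)).2.
  by rewrite carrier_center.
have := carrier_center v; rewrite -zv; by case: zE => -> <-; [left|right].
Qed.

End CellPoset.

(** * Graded families of subsets of a set with d + 2 elements *)

Section ClosureSystems.
Variables (T L : finType) (S : L -> {set T}) (rho : L -> nat).
Hypothesis S_inj : injective S.
Hypothesis rho_mono : forall x y, S x \proper S y -> (rho x < rho y)%N.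
Hypothesis diamond : forall x y, S x \proper S y -> rho y = (rho x).+2 ->
  exists z1 z2, [/\ z1 <> z2, S x \proper S z1 /\ S z1 \proper S y,
    S x \proper S z2 /\ S z2 \proper S y &
    forall z, S x \proper S z -> S z \proper S y -> z = z1 \/ z = z2].

Lemma neq_proper x y : S x \subset S y -> x <> y -> S x \proper S y.
Proof. by move=> xy nxy; rewrite finset.properEneq xy andbT; apply/eqP => /S_inj. Qed.

(** The rank grows strictly along chains from the empty set, which gives the bound. In case of
    equality, a set covered by [S x] omits a single element [u1]. To omit [u] instead, remove [u]
    from that set by induction and take the other side of the diamond under [x]. *)
Lemma downset_closed :
  (exists2 t, S t = finset.set0 & rho t = 0%N) ->
  (forall x y, S x \proper S y ->
    exists z, [/\ S x \subset S z, S z \proper S y & (rho z).+1 = rho y]) ->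
  (forall x, rho x <= #|S x|)%N /\
  forall x, #|S x| = rho x -> forall Q : {set T}, Q \subset S x ->
    exists2 z, S z = Q & rho z = #|Q|.
Proof.
move=> [t tE t0] costep.
have cover x n : rho x = n.+1 -> exists2 z, S z \proper S x & rho z = n.
  move=> xn; have [|z [_ zx zn]] := costep t x.
    by apply: neq_proper => [|tx]; [rewrite tE finset.sub0set|rewrite -tx t0 in xn].
  by exists z => //; rewrite xn in zn; case: zn.
have low x : (rho x <= #|S x|)%N.
  elim: {x}(rho x) {-2}x (erefl (rho x)) => [|n IHn] x xn; first by rewrite xn.
  have [z zx zn] := cover x n xn.
  by rewrite xn -[in leqLHS]zn; apply: leq_ltn_trans (IHn z zn) (proper_card zx).
split=> // x; elim: {x}(rho x) {-2}x (erefl (rho x)) => [|n IHn] x xn cx Q Qx.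
  have Q0 : Q = finset.set0.
    by apply/eqP; rewrite -cards_eq0 -leqn0 -xn -cx subset_leq_card.
  exists t; by rewrite ?tE ?t0 Q0 // cards0.
have remove u : u \in S x -> exists2 z, S z = (S x :\ u)%SET & rho z = n.
  move=> ux; have [z1 z1x z1n] := cover x n xn.
  have c1 : #|S z1| = n.
    apply/eqP; rewrite eqn_leq -{2}z1n low andbT -ltnS -xn -cx; exact: proper_card.
  have [u1 u1x u1z] : exists2 u1, u1 \in S x & u1 \notin S z1.
    by have /properP[_ [u1 ? ?]] := z1x; exists u1.
  have z1E : S z1 = (S x :\ u1)%SET.
    apply/eqP; rewrite eqEcard; apply/andP; split.
      by rewrite subsetD1 (proper_sub z1x) u1z.
    have := cardsD1 u1 (S x); rewrite u1x cx xn c1; clear; lia.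
  have [->|uu1] := eqVneq u u1; first by exists z1.
  have [|z' z'E z'n] := IHn z1 z1n _ (S z1 :\ u)%SET (subD1set _ _); first by rewrite c1.
  have cz' : (#|S z'|).+1 = n.
    have := cardsD1 u (S z1); rewrite z'E c1 z1E !inE uu1 ux /=; clear; lia.
  have z'z1 : S z' \proper S z1.
    by rewrite z'E properD1 // z1E !inE uu1.
  have [||a1 [a2 [na [xa1 a1y] [xa2 a2y] aP]]] := @diamond z' x.
  - exact: proper_trans z'z1 z1x.
  - by move: cz'; rewrite xn z'n -z'E; clear; lia.
  have other a : S z' \proper S a -> S a \proper S x -> a <> z1 ->
      S a = (S x :\ u)%SET.
    move=> za ax na1.
    have ca : #|S a| = n.
      by have := proper_card za; have := proper_card ax; move: cz'; rewrite cx xn; clear; lia.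
    have [v vx va] : exists2 v, v \in S x & v \notin S a by have /properP[_ [v ? ?]] := ax; exists v.
    have aE : S a = (S x :\ v)%SET.
      apply/eqP; rewrite eqEcard subsetD1 (proper_sub ax) va /= ca.
      have := cardsD1 v (S x); rewrite vx cx xn; clear; lia.
    have [<- //|vu] := eqVneq v u.
    case: na1; apply: S_inj; rewrite z1E aE.
    have [-> //|vu1] := eqVneq v u1.
    have : v \in S z' by rewrite z'E z1E !inE vu vu1.
    by move=> /(fintype.subsetP (proper_sub za)); rewrite (negPf va).
  have [a [za ax na1]] : exists a, [/\ S z' \proper S a, S a \proper S x & a <> z1].
    have [E|] := pselect (a1 = z1); last by exists a1.
    by exists a2; split=> // E2; apply: na; rewrite E E2.
  have aE := other a za ax na1; exists a => //.
  have ra1 := rho_mono za; have ra2 := rho_mono ax.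
  by move: ra1 ra2 cz'; rewrite xn z'n -z'E; clear; lia.
have [->|] := eqVneq Q (S x); first by exists x; rewrite ?cx.
rewrite eqEproper Qx /= negbK => /properP[_ [u ux uQ]].
have [z zE zn] := remove u ux.
apply: (IHn z zn); last by rewrite zE subsetD1 Qx uQ.
have := cardsD1 u (S x); rewrite zE ux cx xn zn; clear; lia.
Qed.

End ClosureSystems.

Section FacetSystems.
Variables (T L : finType) (S : L -> {set T}) (rho : L -> nat) (d : nat).
Hypothesis cT : #|T| = d.+2.
Hypothesis S_inj : injective S.
Hypothesis rho_mono : forall x y, S x \proper S y -> (rho x < rho y)%N.
Hypothesis diamond : forall x y, S x \proper S y -> rho y = (rho x).+2 ->
  exists z1 z2, [/\ z1 <> z2, S x \proper S z1 /\ S z1 \proper S y,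
    S x \proper S z2 /\ S z2 \proper S y &
    forall z, S x \proper S z -> S z \proper S y -> z = z1 \/ z = z2].
Variables (top bot : L).
Hypothesis topE : S top = finset.set0.
Hypothesis rho_top : rho top = 0%N.
Hypothesis botE : S bot = [set: T]%SET.
Hypothesis rho_bot : rho bot = d.+1.
Hypothesis step : forall x y, S x \proper S y ->
  exists z, [/\ S x \proper S z, S z \subset S y & rho z = (rho x).+1].
Hypothesis capS : forall x y, exists z, S z = (S x :&: S y)%SET.
Hypothesis singS : forall t, exists x, S x = [set t]%SET.

Let costep x y : S x \proper S y ->
  exists z, [/\ S x \subset S z, S z \proper S y & (rho z).+1 = rho y].
Proof.
move=> xy; have := rho_mono xy.
elim: {x}(rho y - rho x)%N {-2}x (erefl (rho y - rho x)%N) xy => [|n IHn] x xn xy lt; first by move: xn lt; clear; lia.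
have [z [xz zy zn]] := step xy.
have [<-|/eqP nzy] := eqVneq z y; first by exists x.
have zy' := neq_proper S_inj zy nzy.
have [||w [zw wy wn]] := IHn z _ zy'; [by move: xn zn; clear; lia|exact: rho_mono|].
by exists w; split=> //; apply: fintype.subset_trans zw; apply: proper_sub.
Qed.

Let rho_le x : (rho x <= d.+1)%N.
Proof.
have [->|/eqP nx] := eqVneq x bot; first by rewrite rho_bot.
by rewrite -rho_bot ltnW // rho_mono //; apply: neq_proper => //; rewrite botE finset.subsetT.
Qed.

Let low_and_down := downset_closed S_inj rho_mono diamond (ex_intro2 _ _ top topE rho_top) costep.

(** The complements, with rank [d.+1 - rho x], satisfy the same hypotheses, and [T] has [d.+2]
    elements. *)
Let high_and_up : (forall x, #|S x| <= (rho x).+1)%N /\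
  forall x, #|S x| = (rho x).+1 -> forall Q : {set T}, S x \subset Q ->
    exists2 z, S z = Q & (rho z).+1 = #|Q|.
Proof.
have pC (x y : L) : ((~: S x)%SET \proper (~: S y)%SET) = (S y \proper S x).
  exact: properC.
have [|||||h1 h2] := @downset_closed T L (fun x => ~: S x)%SET (fun x => d.+1 - rho x)%N.
- by move=> x y /finset.setC_inj/S_inj.
- by move=> x y; rewrite pC => /rho_mono; have := rho_le x; clear; lia.
- move=> x y; rewrite pC => yx E.
  have [|z1 [z2 [nz [a1 a2] [b1 b2] zP]]] := diamond yx.
    by have := rho_le x; have := rho_le y; move: E; clear; lia.
  exists z1, z2; rewrite !pC; split=> // z; rewrite !pC => ? ?; exact: zP.
- by exists bot; rewrite ?botE ?finset.setCT // rho_bot subnn.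
- move=> x y; rewrite pC => /step[z [yz zx zn]].
  exists z; rewrite pC finset.setCS; split=> //.
  by have := rho_le z; move: zn; clear; lia.
have cC (Q : {set T}) : (#|Q| + #|(~: Q)%SET| = d.+2)%N by rewrite cardsC cT.
split=> [x|x cx Q xQ].
  by have := h1 x; have := cC (S x); have := rho_le x; clear; lia.
have [||z zE zn] := h2 x _ (~: Q)%SET; last 1 first.
- exists z; first exact: finset.setC_inj.
  by have := cC Q; have := rho_le z; move: zn; clear; lia.
- by have := cC (S x); have := rho_le x; move: cx; clear; lia.
- by rewrite finset.setCS.
Qed.

Let low := low_and_down.1.
Let down := low_and_down.2.
Let high := high_and_up.1.
Let up := high_and_up.2.

Lemma facet_system_structure : exists A B : {set T},
  [/\ (A :&: B)%SET = finset.set0, (1 < #|A|)%N, (1 < #|B|)%N &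
    forall Q : {set T}, (exists x, S x = Q) <->
      (~~ (A \subset Q) /\ ~~ (B \subset Q)) \/ (A :|: B)%SET \subset Q].
Proof.
have E01 x : #|S x| = rho x \/ #|S x| = (rho x).+1.
  by have := low x; have := high x; clear; lia.
pose E1 := [pred x | #|S x| == (rho x).+1].
have E1bot : E1 bot by rewrite /= botE cardsT cT rho_bot.
case: (@arg_minnP _ bot E1 (fun x => #|S x|) E1bot) => xD /eqP xD1 xDmin.
pose D := S xD.
(* If a set of excess 1 missed [q] in [D], adding [D :\ q] to it and meeting with [D] would put
   [D :\ q] into the family. Its rank is below that of [D], so it has excess 1 and contradicts
   minimality. *)
have E1D y : #|S y| = (rho y).+1 <-> D \subset S y.
  split=> [y1|Dy]; last first.
    by have [z /S_inj -> <-] := up xD1 Dy.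
  apply: contraT => /subsetPn[q qD qy].
  have [w wE _] := up y1 (finset.subsetUl (S y) (D :\ q)).
  have [z zE] := capS w xD.
  have {}zE : S z = (D :\ q)%SET.
    rewrite zE wE -/D; apply/setP => s; rewrite !inE.
    by have [->|] := eqVneq s q; rewrite ?(negPf qy) //=; case: (s \in D); rewrite ?orbT ?andbF.
  have zD : S z \proper S xD by rewrite zE properD1.
  have cz : #|S z| = rho xD.
    by have := cardsD1 q D; rewrite zE qD /D xD1; clear; lia.
  have [z0|z1] := E01 z; first by have := rho_mono zD; move: z0 cz; clear; lia.
  have := xDmin z; rewrite /= z1 eqxx => /(_ isT).
  by have := proper_card zD; rewrite z1; clear; lia.
have E0D y : #|S y| = rho y -> ~~ (D \subset S y).
  by move=> y0; apply/negP => /E1D; rewrite y0; clear; lia.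
(* Suppose a maximal set [S y] of excess 0 has rank below [d], and go up two steps. All sets above
   it have excess 1, so the two middle sets of the diamond have two more elements than [S y], inside
   a set with three more. Their meet is then strictly between [S y] and [S a1], which differ in rank
   by 1. *)
have maxE0 x : #|S x| = rho x -> exists y, [/\ #|S y| = rho y, S x \subset S y & #|S y| = d].
  move=> x0; pose P := [pred y | (#|S y| == rho y) && (S x \subset S y)].
  have Px : P x by rewrite /= x0 eqxx subxx.
  case: (@arg_maxnP _ x P (fun y => #|S y|) Px) => y /andP[/eqP y0 xy] ymax.
  exists y; split=> //.
  have notE0 z : S y \proper S z -> #|S z| = (rho z).+1.
    move=> yz; have [z0|//] := E01 z.
    have := ymax z; rewrite /geq /= z0 eqxx (fintype.subset_trans xy (proper_sub yz)) => /(_ isT).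
    by have := proper_card yz; rewrite z0; clear; lia.
  have nybot : y <> bot by move=> E; move: y0; rewrite E botE cardsT cT rho_bot; clear; lia.
  have ybot : S y \proper S bot by apply: neq_proper => //; rewrite botE finset.subsetT.
  have := rho_mono ybot; rewrite rho_bot y0 ltnS leq_eqVlt => /orP[/eqP //|rlt].
  have [y1 [yy1 _ y1n]] := step ybot.
  have c1 := notE0 y1 yy1.
  have y1bot : S y1 \proper S bot.
    by apply: neq_proper; rewrite ?botE ?finset.subsetT // => E; move: y1n rlt; rewrite E rho_bot; clear; lia.
  have [z [y1z _ zn]] := step y1bot.
  have yz := proper_trans yy1 y1z.
  have cz := notE0 z yz.
  have [|a1 [a2 [na [ya1 a1z] [ya2 a2z] _]]] := diamond yz; first by rewrite zn y1n.
  have ra a : S y \proper S a -> S a \proper S z -> rho a = (rho y).+1.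
    by move=> /rho_mono + /rho_mono; rewrite zn y1n; clear; lia.
  have ra1 := ra _ ya1 a1z; have ra2 := ra _ ya2 a2z.
  have ca1 := notE0 _ ya1; have ca2 := notE0 _ ya2.
  have [w wE] := capS a1 a2.
  have cw : (#|S y| < #|S w|)%N.
    have := cardsUI (S a1) (S a2); rewrite -wE.
    have : (#|(S a1 :|: S a2)%SET| <= #|S z|)%N.
      by apply: subset_leq_card; rewrite finset.subUset !proper_sub.
    by rewrite ca1 ca2 cz ra1 ra2 zn y1n y0; clear; lia.
  have yw : S y \proper S w.
    by rewrite properEcard cw andbT wE finset.subsetI !proper_sub.
  have wa1 : S w \proper S a1.
    apply: neq_proper => //; first by rewrite wE finset.subsetIl.
    move=> wa; apply: na; apply: S_inj; apply/eqP; rewrite eqEcard ca1 ca2 ra1 ra2 leqnn andbT.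
    by rewrite -wa wE finset.subsetIr.
  by have := rho_mono yw; have := rho_mono wa1; rewrite ra1; clear; lia.
pose closed Q := [exists x, S x == Q].
have closedP Q : reflect (exists x, S x = Q) (closed Q).
  by apply: (iffP existsP) => -[x xQ]; exists x; apply/eqP.
pose edge p q := closed (~: [set p; q])%SET.
have edgeC p q : edge p q = edge q p by rewrite /edge finset.setUC.
have card2C (p q : T) : p != q -> #|(~: [set p; q])%SET| = d.
  by move=> pq; have := cardsC [set p; q]%SET; rewrite cards2 pq cT; clear; lia.
have E0edge x : #|S x| = rho x ->
    exists p q, [/\ p \in D, q \in D, p != q, edge p q & S x \subset (~: [set p; q])%SET].
  move=> /maxE0[y [y0 xy yd]].
  have : #|(~: S y)%SET| == 2%N by have := cardsC (S y); rewrite cT yd => h; apply/eqP; move: h; clear; lia.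
  move=> /cards2P[p [q [pq yC]]].
  have yE : S y = (~: [set p; q])%SET by rewrite -yC finset.setCK.
  (* For [s] outside [D], the complement of [s] contains [D] and so has rank [d], the rank of its
     proper subset [S y]. *)
  have inD s : s \in (~: S y)%SET -> s \in D.
    rewrite inE => sy; apply: contraT => sD.
    have [|z zE zn] := up xD1 (Q := (~: [set s])%SET).
      by apply/fintype.subsetP => r rD; rewrite !inE; apply: contraNneq sD => <-.
    have cs : #|(~: [set s])%SET| = d.+1 by have := cardsC [set s]%SET; rewrite cards1 cT; clear; lia.
    have yz : S y \proper S z.
      rewrite properEcard zE cs yd ltnSn andbT.
      by apply/fintype.subsetP => r ry; rewrite !inE; apply: contraNneq sy => <-.
    by have := rho_mono yz; move: zn; rewrite -y0 yd cs; clear; lia.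
  exists p, q; split=> //; last by rewrite -yE.
  - by apply: inD; rewrite yC !inE eqxx.
  - by apply: inD; rewrite yC !inE eqxx orbT.
  - by apply/closedP; exists y.
have edgeE0 x p q : p \in D -> S x = (~: [set p; q])%SET -> #|S x| = rho x.
  move=> pD xE; have [//|/E1D/fintype.subsetP/(_ p pD)] := E01 x.
  by rewrite xE !inE eqxx.
(* The complement of the triple belongs to the family by [down]. The two sets strictly between it
   and [T] are complements of pairs in the triple, so exactly two of the three pairs are edges. *)
have triangle p q s : p \in D -> q \in D -> s \in D -> p != q -> p != s -> q != s ->
    edge p q -> edge p s = ~~ edge q s.
  move=> pD qD sD pq ps qs epq; have /closedP[x xE] := epq.
  have [|y yE yn] := down (edgeE0 x p q pD xE) (Q := (~: [set p; q; s])%SET).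
    by rewrite xE finset.setCS finset.subsetUl.
  have cy : #|S y| = d.-1.
    rewrite yE; have := cardsC [set p; q; s]%SET; rewrite finset.setUC cardsU1 !inE cards2 cT.
    by rewrite pq ![s == _]eq_sym (negPf ps) (negPf qs) /=; clear; lia.
  have d0 : (0 < d)%N.
    have := subset_leq_card (finset.subsetT [set p; q; s]%SET).
    rewrite cardsT cT finset.setUC cardsU1 !inE cards2.
    by rewrite pq ![s == _]eq_sym (negPf ps) (negPf qs) /=; clear; lia.
  have ybot : S y \proper S bot.
    by rewrite botE properEcard finset.subsetT cardsT cT cy; clear; lia.
  have [|z1 [z2 [nz [yz1 z1b] [yz2 z2b] zP]]] := diamond ybot.
    by move: d0; rewrite rho_bot yn -yE cy; clear; lia.
  have between u v : u \in [set p; q; s]%SET -> v \in [set p; q; s]%SET -> u != v ->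
      forall x, S x = (~: [set u; v])%SET -> S y \proper S x /\ S x \proper S bot.
    move=> up' vp uv w wE; have cw := card2C u v uv; rewrite -wE in cw; split.
      rewrite properEcard cy cw; apply/andP; split; last by move: d0; clear; lia.
      by rewrite yE wE finset.setCS finset.subUset !finset.sub1set up' vp.
    by rewrite botE properEcard finset.subsetT cardsT cT cw /=; clear; lia.
  have bpq := between p q; have bps := between p s; have bqs := between q s.
  rewrite !inE !eqxx ?orbT in bpq bps bqs.
  have {bpq}[bpq bpq'] := bpq isT isT pq x xE.
  have form z : S y \proper S z -> S z \proper S bot ->
      [\/ S z = (~: [set p; q])%SET, S z = (~: [set p; s])%SET | S z = (~: [set q; s])%SET].
    move=> yz zb; have cz : #|S z| = d.
      have [//|/E1D Dz] : #|S z| = d \/ #|S z| = (rho z).+1.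
        have [z0|] := E01 z; last by right.
        left; have := rho_mono yz; have := rho_mono zb.
        by rewrite rho_bot yn -yE cy z0; clear; lia.
      (* A set of excess 1 contains [D], hence the triple, hence everything. *)
      have : S z = [set: T]%SET.
        apply/setP => r; rewrite !inE; have [rp|rp] := boolP (r \in [set p; q; s]%SET).
          by apply: (fintype.subsetP Dz); move: rp; rewrite !inE => /orP[/orP[]|] /eqP ->.
        by apply: (fintype.subsetP (proper_sub yz)); rewrite yE finset.in_setC.
      by move=> zT; move: zb; rewrite botE zT fintype.properxx.
    have zC : (~: S z)%SET \subset [set p; q; s]%SET by rewrite -finset.setCS finset.setCK -yE proper_sub.
    have key r u v : r \in S z -> [set p; q; s]%SET = [set r; u; v]%SET -> u != v ->
        S z = (~: [set u; v])%SET.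
      move=> rz E uv; apply/esym/eqP; rewrite eqEcard cz card2C // leqnn andbT.
      apply/fintype.subsetP => w; rewrite !inE negb_or => /andP[wu wv].
      have := fintype.subsetP zC w; rewrite E !inE (negPf wu) (negPf wv) !orbF.
      by case: (boolP (w \in S z)) => // wz /(_ isT)/eqP wr; rewrite wr rz in wz.
    have [sz|sz] := boolP (s \in S z).
      apply: Or31; apply: (key s) => //; apply/setP => r; rewrite !inE.
      by case: (r == p); case: (r == q); case: (r == s).
    have [qz|qz] := boolP (q \in S z).
      apply: Or32; apply: (key q) => //; apply/setP => r; rewrite !inE.
      by case: (r == p); case: (r == q); case: (r == s).
    have [pz|pz] := boolP (p \in S z); first by apply: Or33; apply: (key p).
    have : ([set p; q; s]%SET \subset (~: S z)%SET).
      by apply/fintype.subsetP => r; rewrite !inE => /orP[/orP[]|] /eqP ->.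
    move=> /subset_leq_card; have := cardsC (S z).
    rewrite finset.setUC cardsU1 !inE cards2 cT cz.
    by rewrite pq ![s == _]eq_sym (negPf ps) (negPf qs) /=; clear; lia.
  apply/idP/idP => [/closedP[a aE]|/negP nqs].
    apply/negP => /closedP[b bE].
    have [ya ab] := bps isT isT ps a aE; have [yb bb] := bqs isT isT qs b bE.
    have ne : [/\ x <> a, x <> b & a <> b].
      split=> E; [move: xE; rewrite E aE|move: xE; rewrite E bE|move: aE; rewrite E bE];
        move=> /finset.setC_inj/setP.
      + by move=> /(_ q); rewrite !inE eqxx orbT (negPf qs) eq_sym (negPf pq).
      + by move=> /(_ p); rewrite !inE eqxx (negPf pq) (negPf ps).
      + by move=> /(_ p); rewrite !inE eqxx (negPf pq) (negPf ps).
    case: ne => n1 n2 n3.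
    by case: (zP x bpq bpq') (zP a ya ab) (zP b yb bb) => [] ? [] ? [] ?; subst.
  have [z [yz zb nzx]] : exists z, [/\ S y \proper S z, S z \proper S bot & z <> x].
    have [E|] := pselect (z1 = x); last by exists z1.
    by exists z2; split=> // E2; apply: nz; rewrite E E2.
  case: (form z yz zb) => zE.
  - by case: nzx; apply: S_inj; rewrite zE xE.
  - by apply/closedP; exists z.
  - by case: nqs; apply/closedP; exists z.
have [p0 [q0 [p0D q0D pq0 e0 _]]] : exists p q,
    [/\ p \in D, q \in D, p != q, edge p q & S top \subset (~: [set p; q])%SET].
  by apply: E0edge; rewrite topE cards0 rho_top.
(* [B] consists of the neighbours of [p0]; the triangle rule with [p0] as one corner decides all
   other pairs. *)
pose B := [set s in D | (s != p0) && edge p0 s]%SET; pose A := (D :\: B)%SET.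
have AB : (A :|: B)%SET = D.
  by apply/setP => s; rewrite !inE; case: (s \in D); case: (_ != _); case: (edge _ _).
have p0A : p0 \in A by rewrite !inE eqxx /= p0D.
have q0B : q0 \in B by rewrite !inE q0D eq_sym pq0 e0.
have AB0 : (A :&: B)%SET = finset.set0.
  by apply/setP => s; rewrite !inE; case: (s \in D); case: (_ != _); case: (edge _ _).
have disj s : s \in A -> s \in B = false.
  by move=> sA; apply/negP => sB; have /setP/(_ s) := AB0; rewrite finset.in_setI sA sB finset.in_set0.
have nedgeA s : s \in A -> s != p0 -> ~~ edge p0 s.
  by rewrite !inE => /andP[+ sD] sp; rewrite sD sp.
have sub s : s \in A \/ s \in B -> s \in D by rewrite -AB finset.in_setU => -[] ->; rewrite ?orbT.
have crossAB p q : p \in A -> q \in B -> edge p q.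
  move=> pA qB; have := qB; rewrite !inE => /and3P[qD qp0 eq].
  have [-> //|pp0] := eqVneq p p0.
  have pq : p != q by apply: contraTneq qB => <-; rewrite (disj _ pA).
  have := triangle p0 q p p0D qD (sub p (or_introl pA)).
  rewrite !(eq_sym _ p) !(eq_sym p0) qp0 pp0 pq => /(_ isT isT isT eq).
  by rewrite (negPf (nedgeA p pA pp0)) edgeC => /esym/negbFE.
have sameA p q : p \in A -> q \in A -> p != q -> ~~ edge p q.
  move=> pA qA pq; apply/negP => epq.
  have [pp0|pp0] := eqVneq p p0.
    by have := nedgeA q qA; rewrite -pp0 eq_sym pq epq => /(_ isT).
  have [qp0|qp0] := eqVneq q p0.
    by have := nedgeA p pA pp0; rewrite -qp0 edgeC epq.
  have := triangle p q p0 (sub p (or_introl pA)) (sub q (or_introl qA)) p0D pq pp0 qp0 epq.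
  by rewrite ![edge _ p0]edgeC (negPf (nedgeA p pA pp0)) (negPf (nedgeA q qA qp0)).
have sameB p q : p \in B -> q \in B -> p != q -> ~~ edge p q.
  rewrite !inE => /and3P[pD pp0 ep] /and3P[qD qp0 eq] pq.
  have := triangle p0 p q p0D pD qD; rewrite !(eq_sym p0) pp0 qp0 pq => /(_ isT isT isT ep).
  by rewrite eq => /esym.
have closedE Q : (exists x, S x = Q) <->
    (~~ (A \subset Q) /\ ~~ (B \subset Q)) \/ (A :|: B)%SET \subset Q.
  rewrite AB; split=> [[x <-]|[[/subsetPn[p pA pQ] /subsetPn[q qB qQ]]|DQ]].
  - have [x0|/E1D Dx] := E01 x; last by right.
    left; have [p [q [pD qD pq epq]]] := E0edge x x0.
    move=> /fintype.subsetP xpq.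
    have [px qx] : p \notin S x /\ q \notin S x.
      by split; apply/negP => /xpq; rewrite !inE eqxx ?orbT.
    have notsub (C : {set T}) r : r \in C -> r \notin S x -> ~~ (C \subset S x).
      by move=> rC rx; apply/subsetPn; exists r.
    have := pD; have := qD; rewrite -AB => /setUP[qA|qB] /setUP[pA|pB].
    + by have := sameA p q pA qA pq; rewrite epq.
    + by split; [apply: notsub qA qx|apply: notsub pB px].
    + by split; [apply: notsub pA px|apply: notsub qB qx].
    + by have := sameB p q pB qB pq; rewrite epq.
  - have /closedP[x xE] := crossAB p q pA qB.
    have [|z zE _] := down (edgeE0 x p q (sub p (or_introl pA)) xE) (Q := Q); last by exists z.
    by rewrite xE; apply/fintype.subsetP => r rQ; rewrite !inE; apply/norP; split; apply: contraTneq rQ => ->.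
  - by have [z zE _] := up xD1 DQ; exists z.
exists A, B; split=> //.
(* Otherwise the singleton of [p0] would contain [A] but not [B], and could not belong to the
   family. *)
- rewrite ltnNge; apply/negP => cA.
  have AE : A = [set p0]%SET by apply/esym/eqP; rewrite eqEcard finset.sub1set p0A cards1.
  have /closedE := singS p0; rewrite AE subxx => -[[]//|/fintype.subsetP/(_ q0)].
  by rewrite !inE q0D eq_sym (negPf pq0) e0 /= => /(_ isT).
- rewrite ltnNge; apply/negP => cB.
  have BE : B = [set q0]%SET by apply/esym/eqP; rewrite eqEcard finset.sub1set q0B cards1.
  have /closedE := singS q0; rewrite AB BE subxx => -[[]//|/fintype.subsetP/(_ p0 p0D)].
  by rewrite !inE (negPf pq0).
Qed.

End FacetSystems.

(** * Pyramids over products of two simplices *)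

Section PyramidOverSimplexProduct.
Context {R : realType}.
Variables (n : nat) (A B : {set 'I_n}) (p0 q0 : 'I_n).
Hypothesis p0A : p0 \in A.
Hypothesis q0B : q0 \in B.
Hypothesis AB : forall i, i \in A -> i \in B -> False.
Implicit Types (x y v : 'rV[R]_n) (S : {set 'I_n}).

(* The iterated pyramid over a product of two simplices: its facets are
   indexed by the coordinates, and its vertices are the points [e_p + e_q] for
   [p \in A], [q \in B] and the points [e_c] for [c] outside [A :|: B]. *)
Definition pyramid : set 'rV[R]_n :=
  [set x | [/\ forall i, 0 <= x 0 i, \sum_(i in A) x 0 i = \sum_(i in B) x 0 i &
    \sum_(i | i \notin B) x 0 i = 1]].

Definition pyramid_face S : set 'rV[R]_n :=
  [set x | pyramid x /\ forall t, t \in S -> x 0 t = 0].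

(** In the first case the face contains a vertex [e_p + e_q], in the second only apexes [e_c] can
    remain. *)
Definition face_index S : Prop :=
  (~~ (A \subset S) /\ ~~ (B \subset S)) \/ (A :|: B)%SET \subset S.

Let e_ (i : 'I_n) : 'rV[R]_n := delta_mx 0 i.

(** All pairs index vertices, with repetitions: an apex depends only on the first component, and
    [e_ p0 + e_ q0] is the default for the pairs left over. *)
Definition pyramid_vertex (j : 'I_n * 'I_n) : 'rV[R]_n :=
  if (j.1 \in A) && (j.2 \in B) then e_ j.1 + e_ j.2
  else if j.1 \notin (A :|: B)%SET then e_ j.1 else e_ p0 + e_ q0.

Lemma e_E i k : e_ i 0 k = (k == i)%:R.
Proof. by rewrite mxE eqxx. Qed.

Lemma sum_e (P : pred 'I_n) i : \sum_(k | P k) e_ i 0 k = (P i)%:R.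
Proof.
under eq_bigr do rewrite e_E.
have [Pi|Pi] := boolP (P i).
  by rewrite (bigD1 i) //= eqxx big1 ?addr0 // => k /andP[_ /negPf ->].
by rewrite big1 // => k Pk; case: eqP Pi => // <-; rewrite Pk.
Qed.

Lemma e_ge0 i k : 0 <= e_ i 0 k.
Proof. by rewrite e_E ler0n. Qed.

Let notAB i : i \in A -> (i \in B) = false.
Proof. by move=> iA; apply/negP => /(AB iA). Qed.

Let notBA i : i \in B -> (i \in A) = false.
Proof. by move=> iB; apply/negP => iA; apply: AB iB. Qed.

Lemma pyramid_edge p q : p \in A -> q \in B -> pyramid (e_ p + e_ q).
Proof.
move=> pA qB; split=> [i||].
- by rewrite mxE addr_ge0 ?e_ge0.
- by under eq_bigr do rewrite mxE; under [RHS]eq_bigr do rewrite mxE;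
    rewrite !big_split /= !sum_e pA qB (notAB pA) (notBA qB) addrC.
- by under eq_bigr do rewrite mxE; rewrite big_split /= !sum_e qB (notAB pA) addr0.
Qed.

Lemma pyramid_apex c : c \notin (A :|: B)%SET -> pyramid (e_ c).
Proof.
rewrite finset.in_setU negb_or => /andP[cA cB]; split=> [i||]; first exact: e_ge0.
- by rewrite !sum_e (negPf cA) (negPf cB).
- by rewrite sum_e cB.
Qed.

Lemma pyramid_vertexP j : pyramid (pyramid_vertex j).
Proof.
rewrite /pyramid_vertex; case: ifP => [/andP[]|_]; first exact: pyramid_edge.
by case: ifP => [|_]; [exact: pyramid_apex|exact: pyramid_edge].
Qed.

Lemma pyramid_comb (J : finType) (c : J -> R) (w : J -> 'rV[R]_n) :
  (forall j, 0 <= c j) -> \sum_j c j = 1 -> (forall j, pyramid (w j)) ->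
  pyramid (\sum_j c j *: w j).
Proof.
move=> c0 c1 wP.
have swap (P : pred 'I_n) : \sum_(i | P i) (\sum_j c j *: w j) 0 i =
    \sum_j c j * \sum_(i | P i) w j 0 i.
  under eq_bigr do rewrite summxE.
  rewrite exchange_big /=; apply: eq_bigr => j _; rewrite mulr_sumr.
  by apply: eq_bigr => i _; rewrite mxE.
split=> [i||].
- rewrite summxE sumr_ge0 // => j _; rewrite mxE mulr_ge0 //; by have [] := wP j.
- by rewrite !swap; apply: eq_bigr => j _; have [_ ->] := wP j.
- by rewrite swap -[RHS]c1; apply: eq_bigr => j _; have [_ _ ->] := wP j; rewrite mulr1.
Qed.

(** The product coupling of the restrictions of [x] to [A] and [B], which have the same mass. An
    apex receives its weight only at the second component [q0], because the indexing repeats it. *)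
Definition pyramid_weight x (j : 'I_n * 'I_n) : R :=
  if (j.1 \in A) && (j.2 \in B) then x 0 j.1 * x 0 j.2 / \sum_(i in A) x 0 i
  else if (j.1 \notin (A :|: B)%SET) && (j.2 == q0) then x 0 j.1 else 0.

Lemma pyramid_weight_ge0 x j : pyramid x -> 0 <= pyramid_weight x j.
Proof.
move=> [x0 _ _]; rewrite /pyramid_weight; case: ifP => _.
  by rewrite divr_ge0 ?mulr_ge0 ?sumr_ge0.
by case: ifP.
Qed.

(* Division by an empty mass is harmless: [x 0 p] vanishes as well. *)
Lemma pyramid_mass x p : pyramid x -> p \in A :|: B ->
  x 0 p * (\sum_(i in A) x 0 i) / (\sum_(i in A) x 0 i) = x 0 p.
Proof.
move=> [x0 xAB _] pAB; have [s0|s0] := eqVneq (\sum_(i in A) x 0 i) 0; last first.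
  by rewrite mulfK.
rewrite s0 mulr0 mul0r; apply/esym/eqP.
move: pAB => /setUP[pA|pB].
  by move/eqP: s0; rewrite psumr_eq0 // => /allP/(_ p); rewrite mem_index_enum pA => /(_ isT).
by move/eqP: s0; rewrite xAB psumr_eq0 // => /allP/(_ p); rewrite mem_index_enum pB => /(_ isT).
Qed.

Lemma pyramid_weight_sum x (h : 'I_n * 'I_n -> R) :
  \sum_j pyramid_weight x j * h j =
  \sum_(p in A) \sum_(q in B) x 0 p * x 0 q / (\sum_(i in A) x 0 i) * h (p, q) +
  \sum_(c | c \notin (A :|: B)%SET) x 0 c * h (c, q0).
Proof.
rewrite (eq_bigr (fun j => pyramid_weight x (j.1, j.2) * h (j.1, j.2))); last by case.
rewrite -(pair_big xpredT xpredT (fun p q => pyramid_weight x (p, q) * h (p, q))) /=.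
rewrite (bigID (mem A)) /=; congr (_ + _).
  apply: eq_bigr => p pA; rewrite (bigID (mem B)) /= [X in _ + X]big1 ?addr0.
    by apply: eq_bigr => q qB; rewrite /pyramid_weight /= pA qB.
  by move=> q qB; rewrite /pyramid_weight /= pA (negPf qB) finset.in_setU pA mul0r.
rewrite (bigID (mem B)) /= big1 ?add0r => [|p /andP[pA pB]].
  apply: eq_big => [p|p /andP[pA pB]]; first by rewrite finset.in_setU negb_or.
  rewrite (bigD1 q0) //= big1 ?addr0 => [|q /negPf qq0].
    by rewrite /pyramid_weight /= (negPf pA) finset.in_setU (negPf pA) (negPf pB) eqxx.
  by rewrite /pyramid_weight /= (negPf pA) qq0 andbF mul0r.
by apply: big1 => q _; rewrite /pyramid_weight /= (negPf pA) finset.in_setU pB orbT mul0r.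
Qed.

Lemma sum_pick (P : pred 'I_n) (f : 'I_n -> R) i :
  \sum_(p | P p) f p * (i == p)%:R = if P i then f i else 0.
Proof.
have [Pi|Pi] := boolP (P i).
  rewrite (bigD1 i) //= eqxx mulr1 big1 ?addr0 // => p /andP[_].
  by rewrite eq_sym => /negPf ->; rewrite mulr0.
by apply: big1 => p Pp; case: eqP Pi => [->|_ _]; rewrite ?Pp // mulr0.
Qed.

Lemma pyramid_decomposition x : pyramid x ->
  \sum_j pyramid_weight x j = 1 /\ \sum_j pyramid_weight x j *: pyramid_vertex j = x.
Proof.
move=> px; have [x0 xAB x1] := px; set s := \sum_(i in A) x 0 i in xAB.
have inA p : p \in A -> p \in (A :|: B)%SET by rewrite finset.in_setU => ->.
have inB p : p \in B -> p \in (A :|: B)%SET by rewrite finset.in_setU orbC => ->.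
have mass p : p \in (A :|: B)%SET -> x 0 p * (s / s) = x 0 p.
  by move=> pAB; rewrite mulrA; apply: pyramid_mass.
split.
  under eq_bigr do rewrite -[pyramid_weight _ _]mulr1.
  rewrite pyramid_weight_sum -/s -[RHS]x1 [RHS](bigID (mem A)) /=; congr (_ + _).
    apply: eq_big => [p|p pA]; first by case: (boolP (p \in A)) => [/notAB ->|]; rewrite ?andbF.
    under eq_bigr do rewrite mulr1 -mulrA.
    by rewrite -mulr_sumr -mulr_suml -xAB mass ?inA.
  apply: eq_big => [p|p _]; last by rewrite mulr1.
  by rewrite finset.in_setU negb_or andbC.
apply/rowP => i; rewrite summxE.
under eq_bigr do rewrite mxE.
rewrite pyramid_weight_sum -/s.
(* Each vertex [e_p + e_q] is split into its two ends; summing out the opposite end yields the two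
   marginals of the coupling. *)
rewrite (eq_bigr (fun p => x 0 p * (s / s) * (i == p)%:R +
    \sum_(q in B) (x 0 q * (x 0 p / s)) * (i == q)%:R)); last first.
  move=> p pA; rewrite [in X in X + _]xAB mulr_suml mulr_sumr mulr_suml -big_split /=.
  apply: eq_bigr => q qB; rewrite /pyramid_vertex /= pA qB mxE !e_E mulrDr.
  by rewrite -xAB !mulrA [x 0 q * x 0 p]mulrC.
under [X in _ + X]eq_bigr => c cAB.
  rewrite /pyramid_vertex /= cAB ifF ?e_E; last first.
    by apply/negbTE; rewrite negb_and; apply/orP; left; apply: contra cAB => /inA.
  over.
rewrite big_split /= exchange_big /= !sum_pick.
under [X in _ + X + _]eq_bigr => q qB.
  rewrite -mulr_suml -mulr_sumr -mulr_suml -/s mass ?inB //.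
  over.
rewrite sum_pick /= finset.in_setU.
have [iA|iA] := boolP (i \in A); first by rewrite (notAB iA) mass ?inA // !addr0.
by case: (boolP (i \in B)) => _; rewrite ?add0r ?addr0.
Qed.

(** The second clause makes all coordinates of the barycentre of the points positive, which the
    computation of the dimension relies on. *)
Lemma pyramid_hull : exists (m : nat) (w : 'M[R]_(m.+1, n)),
  pyramid = convex_hull w /\ forall i, exists k, 0 < w k i.
Proof.
pose J : finType := ('I_n * 'I_n)%type.
have J0 : #|J| = #|J|.-1.+1 by rewrite prednK //; apply/card_gt0P; exists (p0, q0).
pose h (k : 'I_#|J|.-1.+1) : J := enum_val (cast_ord (esym J0) k).
pose h' (j : J) : 'I_#|J|.-1.+1 := cast_ord J0 (enum_rank j).
have hK : cancel h h' by move=> k; rewrite /h /h' enum_valK cast_ordKV.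
have hK' : cancel h' h by move=> j; rewrite /h /h' cast_ordK enum_rankK.
have hbij : {on [pred _ | true], bijective h} by apply: onW_bij; exists h'.
exists #|J|.-1, (\matrix_k pyramid_vertex (h k)); split; last first.
  move=> i; have [j jP] : exists j, 0 < pyramid_vertex j 0 i.
    have [iA|iA] := boolP (i \in A).
      by exists (i, q0); rewrite /pyramid_vertex /= iA q0B mxE !e_E eqxx ltr_pwDl ?ltr01 ?ler0n.
    have [iB|iB] := boolP (i \in B).
      by exists (p0, i); rewrite /pyramid_vertex /= p0A iB mxE !e_E eqxx ltr_wpDl ?ltr01 ?ler0n.
    exists (i, i); rewrite /pyramid_vertex /= (negPf iA) finset.in_setU (negPf iA) (negPf iB) /=.
    by rewrite e_E eqxx ltr01.
  by exists (h' j); rewrite mxE hK'.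
have mulE (c : 'rV[R]_#|J|.-1.+1) :
    c *m (\matrix_k pyramid_vertex (h k)) = \sum_j c 0 (h' j) *: pyramid_vertex j.
  rewrite mulmx_sum_row (reindex h) //=; apply: eq_bigr => k _.
  by rewrite rowK hK.
have sumE (c : 'rV[R]_#|J|.-1.+1) : \sum_k c 0 k = \sum_j c 0 (h' j).
  by rewrite [RHS](reindex h) //=; apply: eq_bigr => k _; rewrite hK.
apply/seteqP; split=> [x px|_ [c [c0 c1] <-]].
  have [w1 wx] := pyramid_decomposition px.
  exists (\row_k pyramid_weight x (h k)).
    split=> [k|]; first by rewrite mxE pyramid_weight_ge0.
    by rewrite sumE -w1; apply: eq_bigr => j _; rewrite mxE hK'.
  by rewrite mulE -[RHS]wx; apply: eq_bigr => j _; rewrite mxE hK'.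
rewrite mulE; apply: pyramid_comb => //; first by rewrite -sumE.
exact: pyramid_vertexP.
Qed.

Lemma small_multiple (P : pred 'I_n) y v : (forall i, P i -> 0 < y 0 i) ->
  exists2 e, 0 < e & forall i, P i -> e * `|v 0 i| <= y 0 i.
Proof.
(* The added 1 keeps the denominator positive where [v] vanishes. *)
move=> y0; pose b i := y 0 i / (`|v 0 i| + 1).
have d0 i : 0 < `|v 0 i| + 1 by rewrite ltr_wpDl.
exists (\big[Num.min/1]_(i | P i) b i).
  apply/bigmin_gtP; split; rewrite ?ltr01 // => i Pi.
  by rewrite /b divr_gt0 ?y0.
move=> i Pi; apply: (@le_trans _ _ (b i * `|v 0 i|)).
  by rewrite ler_wpM2r //; apply: bigmin_le_cond.
rewrite /b mulrAC ler_pdivrMr // ler_wpM2l ?lerDl //; exact/ltW/y0.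
Qed.

Lemma pyramid_move y v (e : R) : pyramid y -> 0 < e ->
  (forall i, 0 < y 0 i -> e * `|v 0 i| <= y 0 i) ->
  (forall i, y 0 i = 0 -> v 0 i = 0) ->
  \sum_(i in A) v 0 i = \sum_(i in B) v 0 i -> \sum_(i | i \notin B) v 0 i = 0 ->
  pyramid (y + e *: v).
Proof.
move=> [y0 yAB y1] e0 small zero vAB v0.
have swap (P : pred 'I_n) : \sum_(i | P i) (y + e *: v) 0 i =
    \sum_(i | P i) y 0 i + e * \sum_(i | P i) v 0 i.
  by rewrite mulr_sumr -big_split /=; apply: eq_bigr => i _; rewrite !mxE.
split=> [i||]; [|by rewrite !swap yAB vAB|by rewrite swap y1 v0 mulr0 addr0].
rewrite !mxE; have [yi|yi] := eqVneq (y 0 i) 0; first by rewrite yi zero // mulr0 addr0.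
have := small i; rewrite lt_def yi y0 => /(_ isT).
rewrite -{1}(gtr0_norm e0) -normrM ler_norml => /andP[h _].
by rewrite addrC -lerBlDr sub0r.
Qed.

(** The differences of vertices span the kernel of the two linear equations. Conversely to the
    obvious inclusion, the barycentre has positive coordinates, so a small multiple of any kernel
    vector can be added to it within the pyramid. *)
Lemma pyramid_polytope d : n = d.+2 -> polytope d pyramid.
Proof.
move=> nd; have [m [w [PE wpos]]] := pyramid_hull.
exists m, w; split=> //.
set W := \matrix_i _.
pose a1 : 'cV[R]_n := \col_i ((i \in A)%:R - (i \in B)%:R).
pose a2 : 'cV[R]_n := \col_i (i \notin B)%:R.
pose M := row_mx a1 a2.
have charsum (P : pred 'I_n) v : \sum_i v 0 i * (P i)%:R = \sum_(i | P i) v 0 i.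
  by rewrite [RHS]big_mkcond; apply: eq_bigr => i _; case: (P i); rewrite ?mulr1 ?mulr0.
have a1E v : (v *m a1) 0 0 = \sum_(i in A) v 0 i - \sum_(i in B) v 0 i.
  rewrite mxE -!charsum -sumrB; apply: eq_bigr => i _.
  by rewrite mxE mulrBr.
have a2E v : (v *m a2) 0 0 = \sum_(i | i \notin B) v 0 i.
  by rewrite mxE -charsum; apply: eq_bigr => i _; rewrite mxE.
have rk2 : \rank M = 2%N.
  apply/eqP; have : row_full M; last by [].
  have eM i (a : 'cV[R]_n) : (e_ i *m a) 0 0 = a i 0 by rewrite -rowE mxE.
  have mx1 (u : 'M[R]_1) c : u 0 0 = c -> u = c%:M by move=> <-; apply: mx11_scalar.
  (* A left inverse of [M]: the two equations take the values 1, 0 on its first row and 0, 1 on its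
     second. *)
  apply/row_fullP; exists (col_mx (- e_ q0) (e_ p0 + e_ q0)).
  rewrite mul_col_row !mulNmx !mulmxDl.
  rewrite (mx1 (- (e_ q0 *m a1)) 1); last first.
    by rewrite mxE eM mxE q0B (notBA q0B) sub0r opprK.
  rewrite (mx1 (- (e_ q0 *m a2)) 0) ?raddf0; last by rewrite mxE eM mxE q0B oppr0.
  rewrite (mx1 (e_ p0 *m a1 + e_ q0 *m a1) 0) ?raddf0; last first.
    by rewrite mxE !eM !mxE q0B p0A (notBA q0B) (notAB p0A) subr0 sub0r subrr.
  rewrite (mx1 (e_ p0 *m a2 + e_ q0 *m a2) 1); last first.
    by rewrite mxE !eM !mxE q0B (notAB p0A) addr0.
  by rewrite -scalar_mx_block.
have mB (u v : 'M[R]_1) : (u - v) 0 0 = u 0 0 - v 0 0 by rewrite !mxE.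
have pw k : pyramid (row k w).
  rewrite PE; exists (delta_mx 0 k); last by rewrite -rowE.
  split=> [i|]; first by rewrite mxE eqxx ler0n.
  rewrite (bigD1 k) //= mxE !eqxx big1 ?addr0 // => i /negPf ik.
  by rewrite mxE ik andbF.
have WM : (W <= kermx M)%MS.
  apply/row_subP => k; rewrite rowK; apply/sub_kermxP.
  have [[_ k1 k2] [_ l1 l2]] := (pw k, pw ord0).
  rewrite mul_mx_row; apply/eqP; rewrite row_mx_eq0; apply/andP; split; apply/eqP;
    apply/matrixP => i j; rewrite !ord1 mulmxBl mB [RHS]mxE.
    by rewrite !a1E k1 l1 !subrr.
  by rewrite !a2E k2 l2 subrr.
have MW : (kermx M <= W)%MS.
  apply/rV_subP => v /sub_kermxP; rewrite mul_mx_row => /eqP; rewrite row_mx_eq0.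
  move=> /andP[/eqP v1 /eqP v2].
  have {}v1 : \sum_(i in A) v 0 i = \sum_(i in B) v 0 i.
    by apply/eqP; rewrite -subr_eq0 -a1E v1 mxE.
  have {}v2 : \sum_(i | i \notin B) v 0 i = 0 by rewrite -a2E v2 mxE.
  pose u : 'rV[R]_m.+1 := const_mx (m.+1%:R^-1).
  have us : std_simplex R m.+1 u.
    split=> [i|]; first by rewrite mxE invr_ge0 ler0n.
    under eq_bigr do rewrite mxE.
    by rewrite sumr_const card_ord -[RHS](@mulVf _ m.+1%:R) ?pnatr_eq0 // mulr_natr.
  pose y := u *m w.
  have py : pyramid y by rewrite PE; exists u.
  have ypos i : 0 < y 0 i.
    have [k kpos] := wpos i; rewrite mxE (bigD1 k) //= ltr_pwDl //.
      by rewrite mxE mulr_gt0 // invr_gt0 ltr0n.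
    apply: sumr_ge0 => l _; rewrite mxE mulr_ge0 ?invr_ge0 ?ler0n //.
    by have [/(_ i)] := pw l; rewrite mxE.
  have [e e0 eP] := @small_multiple xpredT y v (fun i _ => ypos i).
  have : pyramid (y + e *: v).
    apply: pyramid_move => // i; first by move=> _; apply: eP.
    by move=> yi; have := ypos i; rewrite yi ltxx.
  rewrite PE => -[c [_ c1] cE].
  have vE : v = e^-1 *: ((c - u) *m w).
    by rewrite mulmxBl cE -/y addrC addKr scalerA mulVf ?scale1r // gt_eqF.
  have sub : (c - u) *m w = (c - u) *m W.
    have -> : W = w - const_mx 1 *m row ord0 w.
      apply/row_matrixP => k; rewrite rowK linearB /=; congr (_ - _).
      by rewrite row_mul; apply/rowP => i; rewrite !mxE big_ord1 !mxE mul1r.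
    rewrite mulmxBr mulmxA [X in _ - X *m _](_ : _ = 0) ?mul0mx ?subr0 //.
    apply/matrixP => i j; rewrite !ord1 [RHS]mxE mxE.
    rewrite (eq_bigr (fun k => c 0 k - u 0 k)) => [|k _]; last by rewrite !mxE mulr1.
    by rewrite sumrB c1 us.2 subrr.
  by rewrite vE sub scalemx_sub // submxMl.
have -> : \rank W = \rank (kermx M).
  by apply/eqP; rewrite eqn_leq !mxrankS.
by rewrite mxrank_ker rk2 nd subSS subn1.
Qed.

(** Some vertex of the face involves [t]: an edge through [t], or the apex [e_ t]. This lets [S] be
    recovered from its face. *)
Lemma pyramid_face_index S t : face_index S -> t \notin S ->
  exists2 x, pyramid_face S x & 0 < x 0 t.
Proof.
move=> hS tS; have S0 s : s \in S -> (s == t) = false.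
  by move=> sS; apply: contraNF tS => /eqP <-.
have apex : t \notin (A :|: B)%SET -> exists2 x, pyramid_face S x & 0 < x 0 t.
  move=> tAB; exists (e_ t); last by rewrite e_E eqxx ltr01.
  by split; [exact: pyramid_apex|move=> s sS; rewrite e_E S0].
have edge p q : p \in A -> q \in B -> p \notin S -> q \notin S -> t = p \/ t = q ->
    exists2 x, pyramid_face S x & 0 < x 0 t.
  move=> pA qB pS qS tpq; exists (e_ p + e_ q).
    split; first exact: pyramid_edge.
    move=> s sS; rewrite mxE !e_E.
    have [sp sq] : (s == p) = false /\ (s == q) = false.
      by split; [apply: contraNF pS|apply: contraNF qS] => /eqP <-.
    by rewrite sp sq addr0.
  by rewrite mxE !e_E; case: tpq => ->; rewrite eqxx;
    [rewrite ltr_pwDl|rewrite ltr_wpDl]; rewrite ?ltr01 ?ler0n.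
case: hS => [[/subsetPn[p pA pS] /subsetPn[q qB qS]]|ABS].
  have [tA|tA] := boolP (t \in A); first by apply: (edge t q) => //; left.
  have [tB|tB] := boolP (t \in B); first by apply: (edge p t) => //; right.
  by apply: apex; rewrite finset.in_setU negb_or tA tB.
by apply: apex; apply: contra tS; apply: fintype.subsetP.
Qed.

(** [S] collects the coordinates that vanish on [F], and averaging gives [y] in [F] positive
    elsewhere. From [y] one can move slightly away from any [x] in [pyramid_face S]; the functional
    does not exceed [b] there, so it attains [b] at [x]. As [A] and [B] carry the same mass, [S]
    contains both or neither. *)
Lemma pyramid_face_support F : polytope_face pyramid F -> F <> set0 ->
  exists2 S, face_index S & F = pyramid_face S.
Proof.
move=> [a [b [le_b FE]]] /eqP/set0P[z0 Fz0].
pose S := [set t | `[< forall x, F x -> x 0 t = 0 >]]%SET.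
have SP t : t \in S <-> forall x, F x -> x 0 t = 0.
  by rewrite inE; split=> [/asboolP//|h]; apply/asboolP.
have FP x : F x -> pyramid x by rewrite FE => -[].
have dotE (J : finType) (c : J -> R) (g : J -> 'rV[R]_n) :
    ((\sum_j c j *: g j) *m a) 0 0 = \sum_j c j * (g j *m a) 0 0.
  rewrite mulmx_suml summxE; apply: eq_bigr => j _.
  by rewrite -scalemxAl mxE.
have [y [Fy ypos]] : exists y, F y /\ forall t, t \notin S -> 0 < y 0 t.
  have /choice[g gP] : forall t, exists x, F x /\ (t \notin S -> 0 < x 0 t).
    move=> t; have [tS|tS] := boolP (t \in S); first by exists z0.
    have : ~ (forall x, F x -> x 0 t = 0) by move=> /SP tS'; rewrite tS' in tS.
    move=> /existsNP[x /not_implyP[Fx xt]]; exists x; split=> // _.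
    by rewrite lt_def; have [-> _ _] := FP x Fx; rewrite andbT; apply/eqP.
  have n0 : 0 < n%:R :> R by rewrite ltr0n (leq_ltn_trans _ (ltn_ord p0)).
  pose c (t : 'I_n) : R := n%:R^-1.
  have c1 : \sum_t c t = 1.
    by rewrite sumr_const card_ord -[RHS](mulVf (lt0r_neq0 n0)) mulr_natr.
  exists (\sum_t c t *: g t); split=> [|t tS].
    rewrite FE; split.
      apply: pyramid_comb => // t; first by rewrite invr_ge0 ler0n.
      by apply: FP; case: (gP t).
    rewrite dotE (eq_bigr (fun t => c t * b)) -?mulr_suml ?c1 ?mul1r // => t _.
    by have [] := gP t; rewrite FE => -[_ ->].
  rewrite summxE (bigD1 t) //= ltr_pwDl //.
    by rewrite mxE mulr_gt0 ?invr_gt0 //; apply: (gP t).2.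
  apply: sumr_ge0 => s _; rewrite mxE mulr_ge0 ?invr_ge0 ?ler0n //.
  by have [/FP[]] := gP s.
have FS : F = pyramid_face S.
  apply/seteqP; split=> [x Fx|x [px xS]].
    by split; [exact: FP|move=> t /SP; apply].
  have py := FP y Fy.
  have [e e0 eP] := @small_multiple (fun t => t \notin S) y (y - x) ypos.
  have [[x0 xAB x1] [y0 yAB y1]] := (px, py).
  have : pyramid (y + e *: (y - x)).
    apply: pyramid_move => //.
    - move=> i yi; apply: eP; apply/negP => /SP/(_ y Fy) yi0.
      by rewrite yi0 ltxx in yi.
    - move=> i yi; rewrite !mxE yi sub0r xS ?oppr0 //.
      by apply: contraT => /ypos; rewrite yi ltxx.
    - under eq_bigr do rewrite !mxE; under [RHS]eq_bigr do rewrite !mxE.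
      by rewrite !sumrB xAB yAB.
    - by under eq_bigr do rewrite !mxE; rewrite sumrB x1 y1 subrr.
  move=> /le_b; rewrite mulmxDl -scalemxAl mulmxBl.
  have yb : (y *m a) 0 0 = b by move: Fy; rewrite FE => -[].
  have dE (t r q : 'M[R]_1) : (t + e *: (r - q)) 0 0 = t 0 0 + e * (r 0 0 - q 0 0).
    by rewrite !mxE.
  rewrite dE yb gerDl.
  rewrite pmulr_rle0 // subr_le0 => bx.
  by rewrite FE; split=> //; apply/eqP; rewrite eq_le bx le_b.
exists S => //; rewrite /face_index.
have zero (C D : {set 'I_n}) : (forall x, pyramid x -> \sum_(i in C) x 0 i = \sum_(i in D) x 0 i) ->
    C \subset S -> D \subset S.
  move=> CD /fintype.subsetP CS; apply/fintype.subsetP => t tD; apply/SP => x Fx.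
  have px := FP x Fx; have [x0 _ _] := px.
  have : \sum_(i in D) x 0 i = 0.
    by rewrite -CD //; apply: big1 => i /CS/SP; apply.
  by move=> /eqP; rewrite psumr_eq0 // => /allP/(_ t); rewrite mem_index_enum tD => /(_ isT)/eqP.
have ABS : A \subset S -> B \subset S by apply: zero => x [].
have BAS : B \subset S -> A \subset S by apply: zero => x [].
rewrite finset.subUset; have [AS|AS] := boolP (A \subset S).
  by right; rewrite ABS.
by left; split=> //; apply: contra AS.
Qed.

Lemma pyramid_face_le S S' : face_index S -> 
  (pyramid_face S `<=` pyramid_face S') <-> S' \subset S.
Proof.
move=> hS; split=> [sub|/fintype.subsetP sub x [px xS]]; last first.
  by split=> // t /sub/xS.
apply/fintype.subsetP => t tS'; apply: contraT => tS.
have [x /sub[_ xS'] xt] := pyramid_face_index hS tS.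
by rewrite xS' ?ltxx in xt.
Qed.

Lemma pyramid_faceP S : polytope_face pyramid (pyramid_face S).
Proof.
exists (\col_i - (i \in S)%:R), 0.
have dot x : (x *m \col_i - (i \in S)%:R) 0 0 = - \sum_(i in S) x 0 i.
  rewrite mxE -sumrN [RHS]big_mkcond; apply: eq_bigr => i _.
  by rewrite mxE; case: (i \in S); rewrite ?mulrN1 ?oppr0 ?mulr0.
split=> [x [x0 _ _]|]; first by rewrite dot oppr_le0 sumr_ge0.
apply/seteqP; split=> x [px xS]; split=> //.
  by rewrite dot big1 ?oppr0.
move=> t tS; move: xS; rewrite dot => /eqP; rewrite oppr_eq0.
have [x0 _ _] := px.
by rewrite psumr_eq0 // => /allP/(_ t); rewrite mem_index_enum tS => /(_ isT)/eqP.
Qed.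

Lemma pyramid_boundary F : boundary_complex pyramid F <->
  exists S, [/\ face_index S, S <> finset.set0, S <> [set: 'I_n]%SET & F = pyramid_face S].
Proof.
have face0 : pyramid_face finset.set0 = pyramid.
  by apply/seteqP; split=> [x []//|x px]; split=> // t; rewrite finset.in_set0.
have index0 : face_index finset.set0.
  by left; split; apply/subsetPn; [exists p0|exists q0]; rewrite ?finset.in_set0.
split=> [[Fface F0 FP]|[S [hS S0 ST ->]]].
  have [S hS FE] := pyramid_face_support Fface F0; exists S; split=> // SE.
    by apply: FP; rewrite FE SE face0.
  apply: F0; rewrite FE SE; apply/seteqP; split=> // x [[_ _ x1] xT].
  move/eqP: x1; rewrite big1 ?(eq_sym 0) ?oner_eq0 // => i _.
  by rewrite xT // finset.in_setT.
split; first exact: pyramid_faceP.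
  have [t tS] : exists t, t \notin S.
    apply/existsP; apply: contra_notT ST => /existsPn h.
    by apply/setP => t; rewrite finset.in_setT; have := h t; rewrite negbK.
  by have [x Sx _] := pyramid_face_index hS tS => S00; rewrite S00 in Sx.
rewrite -face0 => E; apply: S0; apply/eqP; rewrite -finset.subset0.
by apply/(pyramid_face_le _ index0); rewrite E.
Qed.

End PyramidOverSimplexProduct.

(** * The face lattice of a pseudomanifold *)

Section FacetLattice.
Context {R : realType} {X : topologicalType} (K : cw_complex R X) (e : nat).
Hypothesis sreg : strongly_regular K.
Hypothesis pmK : pseudomanifold K e.
Implicit Types i j h : cell K.

Lemma dim_le i : (cell_dim i <= e)%N.
Proof. by have [_ _ [h _] _] := pmK. Qed.

Lemma top_cell_facet i : cell_dim i = e -> facet i.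
Proof.
by move=> ie j ij; have [->//|] := cell_le_dim ij; rewrite ie ltnNge dim_le.
Qed.

Lemma facet_dim i : facet i -> cell_dim i = e.
Proof.
move=> fi; have [_ pure [_ [k kE]] _] := pmK.
by rewrite -kE; apply: pure => //; apply: top_cell_facet.
Qed.

Lemma below_facet i : exists2 F, facet F & cell_le i F.
Proof.
pose P := [pred h : cell K | `[< cell_le i h >]].
have Pi : P i by apply/asboolP.
case: (@arg_maxnP _ i P (@cell_dim R X K) Pi) => F /asboolP iF Fmax.
exists F => // j Fj.
have Pj : P j by apply/asboolP; apply: cell_le_trans Fj.
have := Fmax j Pj; rewrite /geq /= => jF.
by have [->//|] := cell_le_dim Fj; rewrite ltnNge jF.
Qed.

Lemma upper_cover j : (cell_dim j < e)%N ->
  exists2 h, cell_le j h & cell_dim h = (cell_dim j).+1.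
Proof.
move=> je; have [F0 fF0 jF0] := below_facet j.
pose P := [pred h : cell K | `[< cell_le j h >] && (h != j)].
have PF0 : P F0.
  apply/andP; split; first exact/asboolP.
  by apply: contraTneq je => <-; rewrite facet_dim // ltnn.
case: (@arg_minnP _ F0 P (@cell_dim R X K) PF0) => F /andP[/asboolP jF /eqP nFj] Fmin.
exists F => //.
have [H [jH HF HE]] := cell_le_lower_facet sreg jF (fun E => nFj (esym E)).
rewrite -HE; congr _.+1.
have [<-//|lt] := cell_le_dim jH.
suff /Fmin : P H by rewrite -HE ltnn.
by apply/andP; split; [apply/asboolP|apply: contraTneq lt => ->; rewrite ltnn].
Qed.

Lemma ridge_facets j : (cell_dim j).+1 = e ->
  exists F1 F2, [/\ F1 <> F2, cell_dim F1 = e /\ cell_le j F1,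
    cell_dim F2 = e /\ cell_le j F2 &
    forall F, cell_dim F = e -> cell_le j F -> F = F1 \/ F = F2].
Proof.
move=> je; have [_ _ _ /(_ j je) /eqP/cards2P[F1 [F2 [n12 E]]]] := pmK.
have inE' F : (cell_dim F = e /\ cell_le j F) <-> F = F1 \/ F = F2.
  have /setP/(_ F) := E; rewrite !inE => {}E; split.
    by move=> [Fe /asboolP jF]; move: E; rewrite Fe jF eqxx => /esym/orP[]/eqP; auto.
  move=> FE; have : (F == F1) || (F == F2) by case: FE => ->; rewrite eqxx ?orbT.
  by rewrite -E => /andP[/eqP ? /asboolP ?].
exists F1, F2; split; [exact/eqP|by apply/inE'; left|by apply/inE'; right|].
by move=> F Fe jF; apply/inE'.
Qed.

(** For a ridge these are its two facets; in lower dimension they come from the diamond between [j]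
    and a face two dimensions higher. *)
Lemma two_covers j : (cell_dim j < e)%N ->
  exists h1 h2, [/\ h1 <> h2, cell_le j h1, cell_le j h2,
    cell_dim h1 = (cell_dim j).+1 & cell_dim h2 = (cell_dim j).+1].
Proof.
move=> je; have [jE|jE] := eqVneq (cell_dim j).+1 e.
  have [F1 [F2 [n12 [e1 j1] [e2 j2] _]]] := ridge_facets jE.
  by exists F1, F2; rewrite jE.
have [h jh hE] := upper_cover je.
have [|F hF FE] := @upper_cover h; first by rewrite hE ltn_neqAle jE.
have [|h1 [h2 [n12 [j1 _] [j2 _] [d1 d2] _]]] := @cell_diamond _ _ K sreg j F (cell_le_trans jh hF).
  by rewrite FE hE.
by exists h1, h2.
Qed.

(** The intersection of [h1] and [h2] is a face above [j] and below two distinct covers of [j], so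
    it is [j]. *)
Lemma cover_meet j h1 h2 i : h1 <> h2 -> cell_le j h1 -> cell_le j h2 ->
  cell_dim h1 = (cell_dim j).+1 -> cell_dim h2 = (cell_dim j).+1 ->
  cell_le i h1 -> cell_le i h2 -> cell_le i j.
Proof.
move=> n12 j1 j2 d1 d2 i1 i2.
have [h hE] := cell_meet sreg (j1 _ (face_center j)) (j2 _ (face_center j)).
have jh : cell_le j h by rewrite /cell_le hE => x jx; split; [exact: j1|exact: j2].
have h1' : cell_le h h1 by rewrite /cell_le hE => x [].
have h2' : cell_le h h2 by rewrite /cell_le hE => x [].
have ih : cell_le i h by rewrite /cell_le hE => x ix; split; [exact: i1|exact: i2].
have [->//|lt] := cell_le_dim jh.
have [E|] := cell_le_dim h1'; last by rewrite d1 ltnS leqNgt lt.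
case: n12; rewrite -E; have [//|] := cell_le_dim h2'.
by rewrite d2 E d1 ltnn.
Qed.

(** Downward induction on the dimension of [j], which is the intersection of two faces covering it
    unless it is a facet. *)
Lemma cell_le_facets i j :
  (forall F, facet F -> cell_le j F -> cell_le i F) -> cell_le i j.
Proof.
elim: {j}(e - cell_dim j)%N {-2}j (erefl (e - cell_dim j)%N) => [|n IHn] j jn sub.
  apply: sub; last exact: cell_le_refl.
  by apply: top_cell_facet; apply/eqP; rewrite eqn_leq dim_le -subn_eq0 jn.
have je : (cell_dim j < e)%N by rewrite -subn_gt0 jn.
have [h1 [h2 [n12 j1 j2 d1 d2]]] := two_covers je.
apply: (cover_meet n12 j1 j2 d1 d2); apply: IHn.
- by rewrite d1 subnS jn.
- by move=> F fF hF; apply: sub => //; apply: cell_le_trans hF.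
- by rewrite d2 subnS jn.
- by move=> F fF hF; apply: sub => //; apply: cell_le_trans hF.
Qed.

(** A cell of least positive dimension is an edge, and a cell below both of its ends would equal
    both. Hence no face lies in all facets. *)
Lemma not_least_cell i : (0 < e)%N -> exists j, ~ cell_le i j.
Proof.
move=> e0; have [_ _ [_ [k kE]] _] := pmK.
pose P := [pred h : cell K | (0 < cell_dim h)%N].
have Pk : P k by rewrite /= kE.
case: (@arg_minnP _ k P (@cell_dim R X K) Pk) => F F0 Fmin.
have F1 : cell_dim F = 1%N.
  have [G GF nGF] := cell_has_boundary sreg F0.
  have [H [_ _ HE]] := cell_le_lower_facet sreg GF nGF.
  rewrite -HE; congr _.+1; apply/eqP; rewrite -leqn0 leqNgt; apply/negP => /Fmin.
  by rewrite -HE ltnn.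
have [v1 [v2 [n12 [l1 n1] [l2 n2] _]]] := cell_edge sreg F1.
have vertex v : cell_le v F -> v <> F -> cell_le i v -> i = v.
  by move=> /cell_le_dim[//|lt] _ /cell_le_dim[//|]; rewrite F1 ltnS leqn0 in lt; rewrite (eqP lt).
have [i1|i1] := pselect (cell_le i v1); last by exists v1.
have [i2|i2] := pselect (cell_le i v2); last by exists v2.
by case: n12; rewrite -(vertex v1 l1 n1 i1); apply: vertex.
Qed.

Variables (T : finType) (g : T -> cell K).
Hypothesis g_inj : injective g.
Hypothesis g_facet : forall t, facet (g t).
Hypothesis facet_g : forall F, facet F -> exists t, F = g t.
Hypothesis e_gt0 : (0 < e)%N.
Hypothesis cT : #|T| = e.+3.

Definition facets_above i : {set T} := [set t | `[< cell_le i (g t) >]]%SET.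

Lemma facets_aboveP i t : (t \in facets_above i) <-> cell_le i (g t).
Proof. by rewrite inE; split=> [/asboolP|h] //; apply/asboolP. Qed.

Lemma facets_above_le i j : facets_above j \subset facets_above i <-> cell_le i j.
Proof.
split=> [/fintype.subsetP sub|ij]; last first.
  by apply/fintype.subsetP => t /facets_aboveP jt; apply/facets_aboveP; apply: cell_le_trans jt.
apply: cell_le_facets => F /facet_g[t ->] /facets_aboveP/sub; by move=> /facets_aboveP.
Qed.

Lemma facets_above_inj : injective facets_above.
Proof.
by move=> i j E; apply: cell_le_anti; apply/facets_above_le; rewrite E subxx.
Qed.

Lemma facets_above_proper i j :
  facets_above i \proper facets_above j <-> cell_le j i /\ j <> i.
Proof.
split=> [ij|[ji nji]].
  split; first by apply/facets_above_le; apply: proper_sub.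
  by move=> E; rewrite E fintype.properxx in ij.
rewrite finset.properEneq; apply/andP; split; last exact/facets_above_le.
by apply/eqP => /facets_above_inj E; apply: nji.
Qed.

Lemma facets_above_neq0 i : facets_above i <> finset.set0.
Proof.
move=> E; have [F /facet_g[t ->] it] := below_facet i.
by have /facets_aboveP := it; rewrite E finset.in_set0.
Qed.

Lemma facets_above_neqT i : facets_above i <> [set: T]%SET.
Proof.
move=> E; have [j] := not_least_cell i e_gt0; apply.
by apply/facets_above_le; rewrite E finset.subsetT.
Qed.

(* The face lattice: [None] is the top and [Some None] the bottom element. *)
Definition flat_set (x : option (option (cell K))) : {set T} :=
  match x with
  | None => finset.set0
  | Some None => [set: T]%SET
  | Some (Some i) => facets_above i
  end.

(** The empty face counts as having dimension -1 and the whole complex as having dimension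
    [e.+1]. *)
Definition flat_corank (x : option (option (cell K))) : nat :=
  match x with
  | None => 0
  | Some None => e.+2
  | Some (Some i) => e.+1 - cell_dim i
  end.

Lemma flat_set_inj : injective flat_set.
Proof.
have T0 : [set: T]%SET <> finset.set0 by move=> /(congr1 (fun A : {set T} => #|A|)); rewrite cardsT cards0 cT.
move=> [[i|]|] [[j|]|] //= E.
- by rewrite (facets_above_inj E).
- by case: (facets_above_neqT E).
- by case: (facets_above_neq0 E).
- by case: (facets_above_neqT (esym E)).
- by case: (facets_above_neq0 (esym E)).
- by case: T0.
Qed.

Lemma flat_not_above_bot (Q : {set T}) : flat_set (Some None) \proper Q -> False.
Proof. by rewrite properE finset.subsetT andbF. Qed.

Lemma flat_not_below_top (Q : {set T}) : Q \proper flat_set None -> False.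
Proof. by rewrite properE finset.sub0set andbF. Qed.

Lemma flat_top_proper i : flat_set None \proper flat_set (Some (Some i)).
Proof. by rewrite finset.properEneq finset.sub0set andbT eq_sym; apply/eqP/facets_above_neq0. Qed.

Lemma flat_bot_proper i : flat_set (Some (Some i)) \proper flat_set (Some None).
Proof. by rewrite finset.properEneq finset.subsetT andbT; apply/eqP/facets_above_neqT. Qed.

Lemma flat_corank_mono x y : flat_set x \proper flat_set y ->
  (flat_corank x < flat_corank y)%N.
Proof.
case: x y => [[i|]|] [[j|]|] //.
- move=> /facets_above_proper[/cell_le_dim[//|ji] _] /=.
  by have := dim_le i; lia.
- by move=> _ /=; lia.
- by move=> /flat_not_below_top.
- by move=> /flat_not_above_bot.
- by move=> /flat_not_above_bot.
- by move=> /flat_not_above_bot.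
- by move=> _ /=; have := dim_le j; lia.
- by move=> /flat_not_below_top.
Qed.

Lemma flat_step x y : flat_set x \proper flat_set y ->
  exists z, [/\ flat_set x \proper flat_set z, flat_set z \subset flat_set y &
    flat_corank z = (flat_corank x).+1].
Proof.
have lower i : (0 < cell_dim i)%N -> forall G, cell_le G i -> G <> i ->
    exists H, [/\ facets_above i \proper facets_above H, facets_above H \subset facets_above G
      & (e.+1 - cell_dim H)%N = (e.+1 - cell_dim i).+1].
  move=> i0 G Gi nGi; have [H [GH Hi HE]] := cell_le_lower_facet sreg Gi nGi.
  exists H; split.
  - by apply/facets_above_proper; split=> // E; move: HE; rewrite E; lia.
  - exact/facets_above_le.
  - by have := dim_le i; lia.
case: x y => [[i|]|] [[j|]|].
- move=> /facets_above_proper[ji nji].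
  have i0 : (0 < cell_dim i)%N by have [//|] := cell_le_dim ji; lia.
  by have [H HP] := lower i i0 j ji nji; exists (Some (Some H)).
- move=> ib; have [i0|i0] := posnP (cell_dim i).
    by exists (Some None); split=> //=; rewrite i0 subn0.
  have [G Gi nGi] := cell_has_boundary sreg i0.
  have [H [iH _ HE]] := lower i i0 G Gi nGi.
  by exists (Some (Some H)); split=> //=; apply: finset.subsetT.
- by move=> /flat_not_below_top.
- by move=> /flat_not_above_bot.
- by move=> /flat_not_above_bot.
- by move=> /flat_not_above_bot.
- move=> _; have [F fF jF] := below_facet j.
  exists (Some (Some F)); split; [exact: flat_top_proper|exact/facets_above_le|].
  by rewrite /= facet_dim // subSnn.
- move=> _; have [_ _ [_ [k kE]] _] := pmK.
  exists (Some (Some k)); split; [exact: flat_top_proper|exact: finset.subsetT|].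
  by rewrite /= kE subSnn.
- by move=> /flat_not_below_top.
Qed.

Lemma flat_diamond x y : flat_set x \proper flat_set y ->
  flat_corank y = (flat_corank x).+2 ->
  exists z1 z2, [/\ z1 <> z2, flat_set x \proper flat_set z1 /\ flat_set z1 \proper flat_set y,
    flat_set x \proper flat_set z2 /\ flat_set z2 \proper flat_set y &
    forall z, flat_set x \proper flat_set z -> flat_set z \proper flat_set y ->
      z = z1 \/ z = z2].
Proof.
case: x y => [[i|]|] [[j|]|].
- move=> /facets_above_proper[ji nji] /= ij.
  have iE : cell_dim i = (cell_dim j).+2 by have := dim_le i; have := dim_le j; lia.
  have [H1 [H2 [n12 [j1 i1] [j2 i2] [d1 d2] HP]]] := cell_diamond sreg ji iE.
  have bet H : cell_le j H -> cell_le H i -> cell_dim H = (cell_dim j).+1 ->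
      facets_above i \proper facets_above H /\ facets_above H \proper facets_above j.
    by move=> jH Hi dH; split; apply/facets_above_proper; split=> // E;
      [rewrite -E dH in iE|rewrite -E in dH]; lia.
  exists (Some (Some H1)), (Some (Some H2)); split; [by case|exact: bet|exact: bet|].
  move=> [[h|]|]; [|by move=> _ /flat_not_above_bot|by move=> /flat_not_below_top].
  move=> /facets_above_proper[hi nhi] /facets_above_proper[jh njh].
  by case: (HP h jh hi (fun E => njh (esym E)) nhi) => ->; [left|right].
- move=> _ /= iE.
  have i1 : cell_dim i = 1%N by have := dim_le i; lia.
  have [v1 [v2 [n12 l1 l2 vP]]] := cell_edge sreg i1.
  exists (Some (Some v1)), (Some (Some v2)); split.
  - by case.
  - by split; [apply/facets_above_proper|apply: flat_bot_proper].
  - by split; [apply/facets_above_proper|apply: flat_bot_proper].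
  move=> [[h|]|]; [|by move=> _ /flat_not_above_bot|by move=> /flat_not_below_top].
  by move=> /facets_above_proper[hi nhi] _; case: (vP h hi nhi) => ->; [left|right].
- by move=> /flat_not_below_top.
- by move=> /flat_not_above_bot.
- by move=> /flat_not_above_bot.
- by move=> /flat_not_above_bot.
- move=> _ /= jE; have je : (cell_dim j).+1 = e by have := dim_le j; lia.
  have [F1 [F2 [n12 [e1 j1] [e2 j2] FP]]] := ridge_facets je.
  exists (Some (Some F1)), (Some (Some F2)); split.
  - by case.
  - split; first exact: flat_top_proper.
    by apply/facets_above_proper; split=> // E; rewrite -E in e1; lia.
  - split; first exact: flat_top_proper.
    by apply/facets_above_proper; split=> // E; rewrite -E in e2; lia.
  move=> [[h|]|]; [|by move=> _ /flat_not_above_bot|by move=> /flat_not_below_top].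
  move=> _ /facets_above_proper[jh njh].
  have he : cell_dim h = e by have [//|] := cell_le_dim jh; have := dim_le h; lia.
  by case: (FP h he jh) => ->; [left|right].
(* An interval of length 2 from top to bottom would mean [e = 0]. *)
- by move=> _ /= [E]; lia.
- by move=> /flat_not_below_top.
Qed.

(** Meets of facet sets are joins of faces. If some facet contains [i] and [j], take a face [m] of
    least dimension containing both; its intersection with any facet containing both is again such a
    face, hence equals [m]. *)
Lemma flat_meet x y : exists z, flat_set z = (flat_set x :&: flat_set y)%SET.
Proof.
case: x => [[i|]|]; last by exists None; rewrite finset.set0I.
  case: y => [[j|]|]; last by exists None; rewrite finset.setI0.
    have [E|[t]] := finset.set_0Vmem (facets_above i :&: facets_above j).
      by exists None; rewrite /= E.
    rewrite finset.in_setI => /andP[/facets_aboveP it /facets_aboveP jt].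
    pose P := [pred h : cell K | `[< cell_le i h /\ cell_le j h >]].
    have Pt : P (g t) by apply/asboolP.
    case: (@arg_minnP _ (g t) P (@cell_dim R X K) Pt) => m /asboolP[im jm] mmin.
    exists (Some (Some m)); apply/setP => u; rewrite finset.in_setI; apply/idP/andP.
      by move=> /facets_aboveP mu; split; apply/facets_aboveP; apply: cell_le_trans mu.
    move=> [/facets_aboveP iu /facets_aboveP ju]; apply/facets_aboveP.
    have [h hE] := cell_meet sreg (im _ (face_center i)) (iu _ (face_center i)).
    have hm : cell_le h m by rewrite /cell_le hE => ? [].
    have hu : cell_le h (g u) by rewrite /cell_le hE => ? [].
    have Ph : P h.
      by apply/asboolP; split; rewrite /cell_le hE => ? ?; split;
        [exact: im|exact: iu|exact: jm|exact: ju].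
    have [<-//|] := cell_le_dim hm; by rewrite ltnNge mmin.
  by exists (Some (Some i)); rewrite /= finset.setIT.
by exists y; rewrite /= finset.setTI.
Qed.

Lemma flat_singleton t : exists x, flat_set x = [set t]%SET.
Proof.
exists (Some (Some (g t))); apply/setP => u; rewrite finset.in_set1; apply/idP/eqP.
  move=> /facets_aboveP tu; apply: g_inj; apply/esym.
  by apply: cell_le_anti => //; rewrite /cell_le (g_facet tu).
by move=> ->; apply/facets_aboveP; apply: cell_le_refl.
Qed.

Lemma facets_above_structure : exists A B : {set T},
  [/\ (A :&: B)%SET = finset.set0, (1 < #|A|)%N, (1 < #|B|)%N &
    forall Q : {set T}, (exists x, flat_set x = Q) <->
      (~~ (A \subset Q) /\ ~~ (B \subset Q)) \/ (A :|: B)%SET \subset Q].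
Proof.
apply: (@facet_system_structure T _ flat_set flat_corank e.+1 cT flat_set_inj
  flat_corank_mono flat_diamond None (Some None)) => //.
- exact: flat_step.
- exact: flat_meet.
- exact: flat_singleton.
Qed.

End FacetLattice.

(** In dimension 0 the faces partition the space into finitely many closed sets. Each is therefore
    also open, and by connectedness it is the whole space. *)
Lemma pseudomanifold0_connected (R : realType) (X : topologicalType) (K : cw_complex R X) :
  strongly_regular K -> pseudomanifold K 0 -> connected [set: X] ->
  forall i j : cell K, i = j.
Proof.
move=> sreg pmK conn.
have d0 (i : cell K) : cell_dim i = 0%N by apply/eqP; rewrite -leqn0; apply: dim_le pmK i.
have carE (i : cell K) x : face i x <-> carrier K x = i.
  split=> [/(face_cases)[//|]|<-]; first by rewrite !d0.
  by apply/faceE => //; apply: cell_le_refl.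
have full (i : cell K) : face i = setT.
  apply: conn; first by exists (char_map i 0); apply: face_center.
    exists (~` \bigcup_(j in [set j | j <> i]) face j).
      by apply/closed_openC/closed_bigcup => [|j _]; [exact: finite_finset|exact: closed_face].
    rewrite setTI; apply/seteqP; split=> [x /carE xi [j /= ji /carE xj]|x nx].
      by apply: ji; rewrite -xi.
    by apply/carE; apply: contrapT => xi; apply: nx; exists (carrier K x) => //; apply/carE.
  by exists (face i); [exact: closed_face|rewrite setTI].
by move=> i j; apply: cell_le_anti; rewrite /cell_le !full.
Qed.

Theorem theorem3p10 (R : realType) (X : topologicalType) (K : cw_complex R X)
    (d : nat) :
  (0 < d)%N ->
  strongly_regular K ->
  normal_pseudomanifold K d.-1 ->
  num_facets K = d.+2 ->
  exists (n : nat) (P : set 'rV[R]_n),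
    polytope d P /\
    combinatorially_equivalent (faces K) (boundary_complex P).
Proof.
case: d => [//|e] _ sreg [pmK conn _ _]; rewrite -[e.+1.-1]/e in pmK * => nf.
have [e0|e0] := posnP e.
  rewrite e0 in pmK nf.
  have : (#|[set i : cell K | `[< facet i >]]%SET| <= 1)%N.
    by apply/card_le1_eqP => i j _ _; apply: pseudomanifold0_connected.
  by rewrite -/(num_facets K) nf.
pose g (t : 'I_e.+3) : cell K := enum_val (cast_ord (esym nf) t).
have g_inj : injective g by move=> t u /enum_val_inj/cast_ord_inj.
have g_facet t : facet (g t).
  by have := enum_valP (cast_ord (esym nf) t); rewrite inE => /asboolP.
have facet_g F : facet F -> exists t, F = g t.
  move=> fF; have FA : F \in [set i : cell K | `[< facet i >]]%SET by rewrite inE; apply/asboolP.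
  by exists (cast_ord nf (enum_rank_in FA F)); rewrite /g cast_ordK enum_rankK_in.
have cT : #|'I_e.+3| = e.+3 by rewrite card_ord.
have [A [B [AB0 cA cB closedE]]] :=
  facets_above_structure sreg pmK g_inj g_facet facet_g e0 cT.
have [p0 p0A] : exists p0, p0 \in A by apply/card_gt0P; apply: ltnW.
have [q0 q0B] : exists q0, q0 \in B by apply/card_gt0P; apply: ltnW.
have AB i : i \in A -> i \in B -> False.
  by move=> iA iB; have /setP/(_ i) := AB0; rewrite finset.in_setI iA iB finset.in_set0.
have leE := facets_above_le sreg pmK facet_g.
exists e.+3, (@pyramid R e.+3 A B); split.
  exact: (@pyramid_polytope R _ A B p0 q0 p0A q0B AB e.+1).
(* [f] has to be defined on all subsets; on a face it unfolds to the polytope face indexed by the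
   facets above it. *)
pose f (E : set X) := @pyramid_face R _ A B [set t | `[< E `<=` face (g t) >]]%SET.
have fE i : f (face i) = @pyramid_face R _ A B (facets_above g i) by [].
have idx i : face_index A B (facets_above g i) by apply/closedE; exists (Some (Some i)).
have f_le (i j : cell K) : f (face i) `<=` f (face j) <-> face i `<=` face j.
  rewrite !fE; apply: iff_trans (leE i j).
  exact: (pyramid_face_le AB _ (idx i)).
exists f; split; last by move=> _ _ [i _ <-] [j _ <-].
split.
- move=> _ [i _ <-]; apply/(pyramid_boundary p0A q0B AB).
  exists (facets_above g i); split=> //.
  + exact: (facets_above_neq0 facet_g).
  + exact: (facets_above_neqT sreg pmK facet_g e0).
- move=> E E'; rewrite !inE => -[i _ <-] [j _ <-] ff.
  by apply/seteqP; split; apply/f_le; rewrite ff.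
- move=> F /(pyramid_boundary p0A q0B AB)[S [hS S0 ST ->]].
  have /closedE[[[i|]|] xS] := hS.
  + by exists (face i); [exists i|rewrite fE -xS].
  + by case: ST.
  + by case: S0.
Qed.
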